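(* Assume (A1)–(A4) and run Algorithm SC with step sizes $\alpha_{ij,k}=\alpha_{ij,1}/k^{\gamma_{ij}}$ and $\beta_{i,k}=\beta_{i,1}/k$, where (i) $\alpha_{ij,1}=\alpha_{ji,1}>0$ for all $(i,j)\in\mathcal{E}$ and $\beta_{i,1}>0$ for all $i\in\mathcal{V}$; (ii) $1/2<\gamma_{ij}=\gamma_{ji}\le1$ and $\nu_{ij}+\gamma_{ij}\le1$ for all $(i,j)\in\mathcal{E}$. Let $h=\min_{(i,j)\in\mathcal{E}}(\nu_{ij}/2+\gamma_{ij})$, $\mathcal{E}'=\{(i,j)\in\mathcal{E}:\nu_{ij}+\gamma_{ij}=1\}$, $\underline\beta=\min_{i\in\mathcal{V}}\beta_{i,1}$, $m'=\min_{(i,j)\in\mathcal{E}'}\alpha_{ij,1}e^{-\|\theta\|_1/b_{ij}}/b_{ij}$ (when $\mathcal{E}'\neq\varnothing$), and $a=\delta\underline\beta/N$ if $\mathcal{E}'=\varnothing$, and $a=\dfrac{\delta\lambda_2(\mathcal{L})\underline\beta\, m'}{2Nn\bar H^2\underline\beta+N\lambda_2(\mathcal{L})m'}$ if $\mathcal{E}'\neq\varnothing$. Then for every $i\in\mathcal{V}$, almost surely, $\tilde\theta_{i,k}=O(k^{-a})$ if $2h-2a>1$; $\tilde\theta_{i,k}=O(\ln k/k^{h-1/2})$ if $2h-2a=1$; $\tilde\theta_{i,k}=O(\sqrt{\ln k}/k^{h-1/2})$ if $2h-2a<1$.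
   Context: Network: undirected weighted graph with sensor set $\mathcal{V}=\{1,\dots,N\}$, symmetric nonnegative weights $a_{ij}=a_{ji}$, with $a_{ij}>0$ iff $(i,j)\in\mathcal{E}$; the edge set $\mathcal{E}$ is regarded as a set of ordered pairs that is symmetric ($(i,j)\in\mathcal{E}\iff(j,i)\in\mathcal{E}$), $M=|\mathcal{E}|/2$ is the number of undirected edges, and $\mathcal{N}_i=\{j:(i,j)\in\mathcal{E}\}$. The Laplacian is $\mathcal{L}=\mathcal{D}-\mathcal{A}$ with $\mathcal{A}=(a_{ij})$, $\mathcal{D}=\mathrm{diag}(\sum_{j\in\mathcal{N}_i}a_{ij})$; $\lambda_2(\mathcal{L})$ is its second smallest eigenvalue. Observations: unknown $\theta\in\mathbb{R}^n$; sensor $i$ observes $y_{i,k}=H_{i,k}\theta+w_{i,k}$, $k\ge1$, with deterministic $H_{i,k}\in\mathbb{R}^{m_i\times n}$ and noise $w_{i,k}\in\mathbb{R}^{m_i}$. Let $d_{i,k}$ ($i\in\mathcal{V},k\ge1$) be the dithering noises used below, $\mathcal{F}_k=\sigma(w_{i,t},d_{i,t}: i\in\mathcal{V},1\le t\le k)$ and $\mathcal{F}^w_k=\sigma(w_{i,t}: i\in\mathcal{V},1\le t\le k)$. Assumptions. (A1) There is $\bar H>0$ with $\|H_{i,k}\|\le\bar H$ for all $i,k$, and there are a positive integer $p$ and $\delta>0$ with $\frac1p\sum_{t=k}^{k+p-1}\sum_{i=1}^N H_{i,t}^\top H_{i,t}\ge\delta I_n$ for all $k\ge1$. (A2) $\{w_{i,k},\mathcal{F}_k\}$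 is a martingale difference sequence and $\sup_{i,k}\mathbb{E}[\|w_{i,k}\|^\rho\mid\mathcal{F}^w_{k-1}]<\infty$ a.s. for some $\rho>2$. (A3) The graph is connected, i.e. $\mathrm{rank}(\mathcal{L})=N-1$. (A4) The $d_{i,k}$ are i.i.d. with the Laplace distribution $\mathrm{Lap}(0,1)$ (density $f(x)=\frac12e^{-|x|}$, distribution function $F$), mutually independent over all $(i,k)$, and independent of all $w_{j,t}$. Algorithm SC. Inputs: deterministic initial estimates $\hat\theta_{i,0}\in\mathbb{R}^n$; event-triggered coefficients $\nu_{ij}=\nu_{ji}\ge0$; noise coefficients $b_{ij}=b_{ji}>0$; step sizes $\alpha_{ij,k}=\alpha_{ji,k}>0$ ($(i,j)\in\mathcal{E}$) and $\beta_{i,k}>0$. For $k=1,2,\dots$: let $\varphi_k\in\mathbb{R}^n$ be the $l$-th standard basis vector, where $k=nq+l$ with $q\in\mathbb{N}\cup\{0\}$, $l\in\{1,\dots,n\}$; set $x_{i,k}=\varphi_k^\top\hat\theta_{i,k-1}$; set $C_{ij,k}=\nu_{ij}b_{ij}\ln k$; set $s_{ij,k}=1$ if $x_{i,k}+b_{ij}d_{i,k}>0$ and $s_{ij,k}=-1$ otherwise. Sensor $i$ sends the one-bit message $s_{ij,k}$ to neighbor $j$ iff $|x_{i,k}+b_{ij}d_{i,k}|>C_{ij,k}$; sensor $i$ sets $\hat s_{ji,k}=s_{ji,k}$ if it received $s_{ji,k}$ from $j$, and $\hat s_{ji,k}=0$ otherwise. With $G_{ij,k}(x)=F((x-C_{ij,k})/b_{ij})-F((-x-C_{ij,k})/b_{ij})$,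 update $\check\theta_{i,k}=\hat\theta_{i,k-1}+\varphi_k\sum_{j\in\mathcal{N}_i}\alpha_{ij,k}a_{ij}(\hat s_{ji,k}-G_{ij,k}(x_{i,k}))$, $\hat\theta_{i,k}=\check\theta_{i,k}+\beta_{i,k}H_{i,k}^\top(y_{i,k}-H_{i,k}\hat\theta_{i,k-1})$. Write $\tilde\theta_{i,k}=\hat\theta_{i,k}-\theta$. Here $\|\theta\|_1$ is the $\ell_1$ norm, and for random vectors $X_k$ and positive numbers $r_k$, ''$X_k=O(r_k)$ a.s.'' means $\sup_k\|X_k\|/r_k<\infty$ almost surely. *)

(* Defs.v *)
From HB Require Import structures.
From mathcomp Require Import all_boot all_order all_algebra.
From mathcomp Require Import all_classical all_reals all_analysis measurable_realfun.
Set Implicit Arguments. Unset Strict Implicit. Unset Printing Implicit Defensive.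
Import Order.TTheory GRing.Theory Num.Theory.
Import numFieldNormedType.Exports.
Local Open Scope classical_set_scope.
Local Open Scope ring_scope.

Definition enorm {R : realType} {m : nat} (v : 'cV[R]_m) : R :=
  Num.sqrt (\sum_(l < m) v l 0 ^+ 2).

Definition l1norm {R : realType} {m : nat} (v : 'cV[R]_m) : R :=
  \sum_(l < m) `|v l 0|.

Definition loewner_ge {R : realType} {n : nat} (A B : 'M[R]_n) : Prop :=
  forall x : 'cV[R]_n, 0 <= (x^T *m (A - B) *m x) 0 0.

Definition opnorm_le {R : realType} {p q : nat} (M : 'M[R]_(p, q)) (c : R) : Prop :=
  forall x : 'cV[R]_q, enorm (M *m x) <= c * enorm x.

Definition laplacian {R : realType} {N : nat} (aw : 'I_N -> 'I_N -> R) : 'M[R]_N :=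
  \matrix_(i, j) ((i == j)%:R * (\sum_(l < N | 0 < aw i l) aw i l) - aw i j).

Definition sorted_eigenvalues {R : realType} {N : nat} (M : 'M[R]_N) (s : seq R) : Prop :=
  sorted <=%R s /\ char_poly M = \prod_(x <- s) ('X - x%:P).

(* second smallest eigenvalue (for a real symmetric matrix, whose characteristic
   polynomial splits over R) *)
Definition lambda2 {R : realType} {N : nat} (M : 'M[R]_N) : R :=
  xget 0 [set x | exists s, sorted_eigenvalues M s /\ x = s`_1].

Definition lap_density {R : realType} (x : R) : R := expR (- `|x|) / 2.

Definition lapF {R : realType} (x : R) : R :=
  if x < 0 then expR x / 2 else 1 - expR (- x) / 2.

(* Algorithm SC (run pathwise, for one realization of the noises)      *)
Section AlgorithmSC.
Variables (R : realType) (N n : nat) (m : 'I_N -> nat).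
Variable aw : 'I_N -> 'I_N -> R.
Variables (nu b : 'I_N -> 'I_N -> R).
Variable alpha : 'I_N -> 'I_N -> nat -> R.
Variable beta : 'I_N -> nat -> R.
Variable H : forall i : 'I_N, nat -> 'M[R]_(m i, n).
Variable theta : 'cV[R]_n.
Variable theta0 : 'I_N -> 'cV[R]_n.
Variable w : forall i : 'I_N, nat -> 'cV[R]_(m i).
Variable dn : 'I_N -> nat -> R.

(* phi_k = l-th standard basis vector, k = n q + l, 1 <= l <= n *)
Definition phi (k : nat) : 'cV[R]_n :=
  \col_(l < n) ((nat_of_ord l == (k.-1 %% n)%N)%:R).

Definition yobs (i : 'I_N) (k : nat) : 'cV[R]_(m i) := H i k *m theta + w i k.

Definition xval (est : 'I_N -> 'cV[R]_n) (k : nat) (i : 'I_N) : R :=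
  ((phi k)^T *m est i) 0 0.

Definition Cthr (i j : 'I_N) (k : nat) : R := nu i j * b i j * ln k%:R.

Definition sbit (est : 'I_N -> 'cV[R]_n) (i j : 'I_N) (k : nat) : R :=
  if 0 < xval est k i + b i j * dn i k then 1 else -1.

(* \hat s_{ji,k}: what sensor i holds from neighbor j *)
Definition shat (est : 'I_N -> 'cV[R]_n) (j i : 'I_N) (k : nat) : R :=
  if Cthr j i k < `|xval est k j + b j i * dn j k| then sbit est j i k else 0.

Definition Gfun (i j : 'I_N) (k : nat) (x : R) : R :=
  lapF ((x - Cthr i j k) / b i j) - lapF ((- x - Cthr i j k) / b i j).

Definition SC_step (k : nat) (est : 'I_N -> 'cV[R]_n) (i : 'I_N) : 'cV[R]_n :=
  let x := xval est k i in
  let check := est i +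
    (\sum_(j < N | 0 < aw i j) alpha i j k * aw i j * (shat est j i k - Gfun i j k x))
      *: phi k in
  check + beta i k *: ((H i k)^T *m (yobs i k - H i k *m est i)).

Fixpoint SC_est (k : nat) : 'I_N -> 'cV[R]_n :=
  match k with
  | 0 => theta0
  | k'.+1 => SC_step k'.+1 (SC_est k')
  end.

End AlgorithmSC.

Section Proba.
Context {R : realType} {d : measure_display} {T : measurableType d}.
Local Open Scope ereal_scope.

Definition sigma_of {C : Type} (D : set C) (X : C -> T -> R) : set (set T) :=
  <<s [set A | exists c B, D c /\ measurable B /\ A = X c @^-1` B] >>.

Definition mutually_independent {I : eqType} (P : probability T R)
    (G : I -> set (set T)) : Prop :=
  forall (s : seq I) (A : I -> set T), uniq s ->
    (forall i, i \in s -> G i (A i)) ->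
    P (\bigcap_(i in [set` s]) A i) = \big[*%E/1%E]_(i <- s) P (A i).

Definition cond_exp_nonneg (P : probability T R) (G : set (set T))
    (X : T -> \bar R) (Z : T -> \bar R) : Prop :=
  (forall t, 0 <= Z t) /\
  (forall B : set (\bar R), measurable B -> G (Z @^-1` B)) /\
  (forall A, G A -> \int[P]_(t in A) Z t = \int[P]_(t in A) X t).

End Proba.

Section Filtrations.
Context {R : realType} {d : measure_display} {T : measurableType d}.
Context {N : nat} {m : 'I_N -> nat}.
Variable w : forall i : 'I_N, nat -> T -> 'cV[R]_(m i).
Variable dn : 'I_N -> nat -> T -> R.

Definition wcoord (c : {i : 'I_N & 'I_(m i)} * nat) (t : T) : R :=
  w (projT1 c.1) c.2 t (projT2 c.1) 0.

Definition wdcoord (c : ({i : 'I_N & 'I_(m i)} * nat) + ('I_N * nat)) (t : T) : R :=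
  match c with inl c' => wcoord c' t | inr c' => dn c'.1 c'.2 t end.

Definition Fw (k : nat) : set (set T) :=
  sigma_of [set c | (1 <= c.2 <= k)%N] wcoord.

Definition Fwd (k : nat) : set (set T) :=
  sigma_of [set c | match c with
                    | inl c' => (1 <= c'.2 <= k)%N
                    | inr c' => (1 <= c'.2 <= k)%N end] wdcoord.

Definition Fw_all : set (set T) := sigma_of [set c | (1 <= c.2)%N] wcoord.

(* sigma(d_{i,k}) (trivial sigma-algebra for the unused index k = 0) *)
Definition Fd (i : 'I_N) (k : nat) : set (set T) :=
  sigma_of [set _ : unit | (0 < k)%N] (fun _ => dn i k).

End Filtrations.

(* Main.v *)
(** Let [e_k] be the matrix of estimation errors, one row per sensor. One step of
    the algorithm is [e_(k+1) = e_k + f_k(e_k) + noise], where the noise is a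
    martingale difference and, because the quantized channel [G] is increasing
    with slope at least [k^(-nu) exp(-|x|/b) / b],
    [<e, f_k(e)> <= - (beta/k) sum_i |H_i e_i|^2 - c_k sum_ij (a_ij/2) (phi.(e_i - e_j))^2].
    Excitation and the cyclic choice of [phi] give coercivity of these two forms only
    after averaging over a window of times. Subtracting from [|e|^2] linearly weighted
    sums of the forms over the next window turns the averaging into a telescoping
    term and yields a quadratic Lyapunov function [U_k] that contracts by
    [1 - 2a/k + O(k^(-1-s))] at every step; the rate [a] comes from splitting [e] into
    its mean over the sensors and the deviations, the latter being controlled
    by the spectral gap of the Laplacian.

    A message is sent with conditional probability [O(k^(-nu))], so the gain times the
    noise variance is [O(k^(-2h))]. A Robbins-Siegmund type argument for [(om_k U_k)^r],
    [1 < r <= min(2, rho/2)], with [om_k] equal to [k^(2a)], [k^(2h-1)/(ln k)^2]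
    or [k^(2h-1)/ln k], gives the three rates. Since the slope of [G] and the sending
    probability depend on the current state, the argument is run three times: to
    bound the errors, to make them decay like some power of [k], and finally, with the
    limiting slope [exp(-|theta|_1/b)/b], to get the sharp rate. *)
Require Import Defs.
From HB Require Import structures.
From mathcomp Require Import all_boot all_order all_algebra.
From mathcomp Require Import all_classical all_reals all_analysis measurable_realfun.
From mathcomp Require Import ring lra.
From mathcomp Require complex spectral sesquilinear.
Import Order.TTheory GRing.Theory Num.Theory.
Import numFieldNormedType.Exports.
Local Open Scope classical_set_scope.
Local Open Scope ring_scope.
Set Implicit Arguments. Unset Strict Implicit. Unset Printing Implicit Defensive.

(** The conditional moments have only random bounds and the slope of [G] degenerates for large
    states, while the estimates want deterministic constants. Every pass therefore runs on adapted
    events [B k] with an integer cutoff; a path is dropped when it leaves them, and almost every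
    path stays in those of some cutoff. In place of conditional expectations, supermartingale
    inequalities compare integrals over past events on which the process is bounded.

    The power [r > 1] makes the last rate sharp. With [om_k = k^(2h-1)/ln k] the noise input has the
    non-summable order [1/(k ln k)]; but there the contraction beats the growth of [om_k] by a term
    of order [1/k], and Young's inequality turns the input into [1/(k (ln k)^r)]. The bound
    [r <= rho/2] keeps the [r]-th power of the squared noise integrable.

    The moments in (A2) are conditioned on past observation noises alone, whereas the estimates also
    depend on past dithers. Independence carries the bounds over to the larger filtration by a
    pi-system argument. *)

(** * The Laplace distribution function: tail and slope bounds *)

Section Laplace.
Variable R : realType.
Implicit Types u v x y : R.

Lemma expR_ge1Bx x : 1 - x <= expR (- x).
Proof. by have := expR_ge1Dx (- x). Qed.

Lemma lapF_ge0 u : 0 <= lapF u.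
Proof.
rewrite /lapF; case: ltP => hu; first by rewrite divr_ge0 ?expR_ge0.
have : expR (- u) <= 1 by rewrite -expR0 ler_expR; lra.
lra.
Qed.

Lemma lapF_le1 u : lapF u <= 1.
Proof.
rewrite /lapF; case: ltP => hu.
  have : expR u <= 1 by rewrite -expR0 ler_expR; lra.
  lra.
have := expR_ge0 (- u); lra.
Qed.

Lemma lapFN u : lapF (- u) = 1 - lapF u.
Proof.
rewrite /lapF oppr_lt0; case: (ltgtP 0 u) => hu; rewrite ?opprK.
- lra.
- lra.
- by rewrite -hu oppr0 expR0; lra.
Qed.

(** For [u >= 0] this is [cosh u >= 1], obtained from [exp(-u) (exp u - 1)^2 >= 0]. *)
Lemma lapF_le_expR u : lapF u <= expR u / 2.
Proof.
rewrite /lapF; case: ltP => hu //.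
have : expR u * expR (- u) = 1 by rewrite -expRD subrr expR0.
have := mulr_ge0 (expR_ge0 (- u)) (sqr_ge0 (expR u - 1)).
move: (expR u) (expR (- u)) => a b h1 h2.
have : b * (a - 1) ^+ 2 = a * b * a - 2 * (a * b) + b by ring.
rewrite h2; lra.
Qed.

(** The density is at least [exp(-K)/2] on [[-K, K]]. Without derivatives: on the positive half-line
    this is [exp t >= 1 + t], the negative half-line follows by the symmetry [lapFN], and an
    interval around 0 is cut at 0. *)
Lemma lapF_incr_ge u v K : v <= u -> `|u| <= K -> `|v| <= K ->
  expR (- K) / 2 * (u - v) <= lapF u - lapF v.
Proof.
have pos x y : 0 <= y -> y <= x -> `|x| <= K ->
    expR (- K) / 2 * (x - y) <= lapF x - lapF y.
  move=> y0 yx xK; rewrite /lapF !ltNge y0 (le_trans y0 yx)/=.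
  have h1 : expR (- K) <= expR (- x).
    by rewrite ler_expR lerN2 (le_trans _ xK)// ler_norm.
  have h2 : 1 + (x - y) <= expR (x - y) by exact: expR_ge1Dx.
  have -> : expR (- y) = expR (- x) * expR (x - y) by rewrite -expRD; congr expR; lra.
  have := expR_gt0 (- K).
  move: (expR (- K)) (expR (- x)) (expR (x - y)) h1 h2 => a b c h1 h2; nra.
move=> vu uK vK; have [v0|v0] := leP 0 v; first exact: pos.
have neg x y : x <= 0 -> y <= x -> `|y| <= K ->
    expR (- K) / 2 * (x - y) <= lapF x - lapF y.
  move=> x0 yx yK; have := pos (- y) (- x); rewrite !lapFN normrN => H.
  have := H _ _ yK; rewrite oppr_ge0 lerN2 => /(_ x0 yx); lra.
have [u0|u0] := leP u 0; first exact: neg.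
have h0 : `|0 : R| <= K by rewrite normr0 (le_trans _ uK).
have H1 := pos u 0 (lexx _) (ltW u0) uK.
have H2 := neg 0 v (lexx _) (ltW v0) vK.
lra.
Qed.

Lemma lapF_incr_le u v : v <= u -> 0 <= lapF u - lapF v <= (u - v) / 2.
Proof.
move=> vu; apply/andP; split.
  have := @lapF_incr_ge u v (Num.max `|u| `|v|) vu.
  rewrite !le_max !lexx orbT => /(_ isT isT); apply: le_trans.
  by rewrite mulr_ge0 ?divr_ge0 ?expR_ge0 ?subr_ge0.
have pos x y : 0 <= y -> y <= x -> lapF x - lapF y <= (x - y) / 2.
  move=> y0 yx; rewrite /lapF !ltNge y0 (le_trans y0 yx)/=.
  have -> : expR (- x) = expR (- y) * expR (- (x - y)).
    by rewrite -expRD; congr expR; lra.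
  have h2 := expR_ge1Bx (x - y).
  have : expR (- y) <= 1 by rewrite -expR0 ler_expR; lra.
  have := expR_ge0 (- y).
  move: (expR (- y)) (expR (- (x - y))) h2 => a c h2; nra.
have [v0|v0] := leP 0 v; first exact: pos.
have neg x y : x <= 0 -> y <= x -> lapF x - lapF y <= (x - y) / 2.
  move=> x0 yx; have := pos (- y) (- x); rewrite !lapFN => H.
  have := H _ _; rewrite oppr_ge0 lerN2 => /(_ x0 yx); lra.
have [u0|u0] := leP u 0; first exact: neg.
have := pos u 0 (lexx _) (ltW u0); have := neg 0 v (lexx _) (ltW v0).
lra.
Qed.

Lemma lapF_lipschitz u v : `|lapF u - lapF v| <= `|u - v| / 2.
Proof.
wlog vu : u v / v <= u.
  move=> H; have [|/ltW] := leP v u; first exact: H.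
  by rewrite distrC (distrC u); exact: H.
have /andP[h1 h2] := lapF_incr_le vu.
by rewrite ger0_norm// ger0_norm// subr_ge0.
Qed.

Lemma measurable_lapF : measurable_fun setT (@lapF R).
Proof.
apply: measurable_fun_ifT => //.
- exact: measurable_fun_ltr.
- by apply: measurable_funM => //; exact: measurable_expR.
- apply: measurable_funB => //; apply: measurable_funM => //.
  exact: (measurableT_comp (@measurable_expR R)).
Qed.

End Laplace.

(** * Spectral gap of the graph Laplacian *)

Section Spectral.
Import complex mxpoly spectral sesquilinear.
Variable R : realType.
Local Notation toC := (real_complex R).
Local Notation "A ^C" := (map_mx toC A) : ring_scope.

Lemma char_poly_similar (F : fieldType) N (A P D : 'M[F]_N) :
  P \in unitmx -> P *m A = D *m P -> char_poly A = char_poly D.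
Proof.
move=> uP PA; rewrite /char_poly.
have detP0 : \det (map_mx (@polyC F) P) != 0.
  by rewrite det_map_mx polyC_eq0 -unitfE -unitmxE.
apply: (mulfI detP0); rewrite -det_mulmx [RHS]mulrC -det_mulmx; congr (\det _).
rewrite /char_poly_mx mulmxBr mulmxBl -!map_mxM PA; congr (_ - _).
by rewrite mul_mx_scalar mul_scalar_mx.
Qed.

(** The matrix is diagonalised over [R[i]], where Hermitian matrices have a unitary eigenbasis. The
    eigenvectors [u i] are complex, so a real vector [x] enters the Parseval identity and the
    diagonal form of [x^T M x] through the moduli of its coordinates. *)
Lemma symmetric_spectral N (M : 'M[R]_N) : M^T = M ->
  exists (d : 'I_N -> R) (u : 'I_N -> 'rV[R[i]]_N),
  [/\ char_poly M = \prod_(x <- [seq d i | i <- enum 'I_N]) ('X - x%:P),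
      forall i, u i *m M^C = toC (d i) *: u i,
      forall i j, \sum_l u i 0 l * Num.conj (u j 0 l) = (i == j)%:R,
      forall x : 'cV[R]_N,
        toC (\sum_l x l 0 ^+ 2) = \sum_i `|(u i *m x^C) 0 0| ^+ 2 &
      forall x : 'cV[R]_N,
        toC ((x^T *m M *m x) 0 0) = \sum_i toC (d i) * `|(u i *m x^C) 0 0| ^+ 2].
Proof.
move=> Msym; pose A := M^C.
have Areal : A \is a mxOver Num.real.
  by apply/mxOverP => i j; rewrite mxE; apply/complex_realP; exists (M i j).
have Aherm : A \is hermsymmx.
  apply: realsym_hermsym => //; apply/is_hermitianmxP.
  by rewrite expr0 scale1r map_mx_id// map_trmx Msym.
have /orthomx_spectralP := hermitian_normalmx Aherm.
have /mxOverP dreal := hermitian_spectral_diag_real Aherm.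
have Punit := spectral_unitarymx A.
move: (spectralmx A) (spectral_diag A) dreal Punit => P sp dreal Punit /= AE.
have uP := unitarymx_unit Punit.
have PA : P *m A = diag_mx sp *m P by rewrite AE !mulmxA mulmxV// mul1mx.
pose d i := complex.Re (sp 0 i).
have dE i : toC (d i) = sp 0 i by rewrite /d RRe_real.
have uxE (x : 'cV[R]_N) i : (row i P *m x^C) 0 0 = (P *m x^C) i 0.
  by rewrite -row_mul mxE.
have xCr (x : 'cV[R]_N) : (x^C)^t*%sesqui = (x^T)^C.
  apply/matrixP => i j; rewrite !mxE/=; apply: CrealP.
  by apply/complex_realP; exists (x j i).
exists d, (fun i => row i P); split.
- apply: (map_poly_inj toC); rewrite map_char_poly.
  rewrite (char_poly_similar uP PA) char_poly_trig; last first.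
    by apply: diag_mx_is_trig.
  rewrite rmorph_prod /= big_map big_enum/=; apply: eq_bigr => i _.
  by rewrite rmorphB/= map_polyX map_polyC/= dE mxE eqxx mulr1n.
- move=> i; rewrite -row_mul PA; apply/rowP => j.
  by rewrite !mxE dE (bigD1 i)//= mxE eqxx mulr1n big1 ?addr0// => l /negPf li;
    rewrite mxE eq_sym li mulr0n mul0r.
- move=> i j; have /unitarymxP/matrixP/(_ i j) := Punit.
  rewrite !mxE => <-; apply: eq_bigr => l _; by rewrite !mxE.
- move=> x; transitivity (((x^C)^t*%sesqui *m x^C) 0 0).
    rewrite xCr -map_mxM !mxE; congr toC; apply: eq_bigr => l _.
    by rewrite !mxE expr2.
  transitivity (((P *m x^C)^t*%sesqui *m (P *m x^C)) 0 0).
    rewrite trmx_mul map_mxM/= -!mulmxA; congr ((_ *m _) 0 0).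
    by rewrite mulmxA -invmx_unitary// mulVmx// mul1mx.
  by rewrite mxE; apply: eq_bigr => i _; rewrite uxE normCK [RHS]mulrC !mxE.
- move=> x; transitivity (((x^C)^t*%sesqui *m A *m x^C) 0 0).
    by rewrite xCr /A -!map_mxM [RHS]mxE.
  transitivity (((P *m x^C)^t*%sesqui *m diag_mx sp *m (P *m x^C)) 0 0).
    rewrite trmx_mul map_mxM/= -!mulmxA; congr ((_ *m _) 0 0).
    by rewrite [in RHS]mulmxA -invmx_unitary// AE !mulmxA.
  rewrite mxE; apply: eq_bigr => i _; rewrite uxE normCK dE.
  by rewrite mul_mx_diag !mxE -mulrA mulrCA; congr (_ * _); rewrite mulrC.
Qed.

Variables (N : nat) (aw : 'I_N -> 'I_N -> R).
Hypothesis aw_ge0 : forall i j, 0 <= aw i j.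
Hypothesis aw_sym : forall i j, aw i j = aw j i.

Lemma laplacian_sym : (laplacian aw)^T = laplacian aw.
Proof.
apply/matrixP => i j; rewrite !mxE eq_sym aw_sym; congr (_ - _).
by case: eqP => [->//|_]; rewrite !mul0r.
Qed.

Lemma laplacian_deg i : \sum_(l < N | 0 < aw i l) aw i l = \sum_l aw i l.
Proof.
rewrite big_mkcond; apply: eq_bigr => l _; case: ltP => // h.
by apply/eqP; rewrite eq_le h aw_ge0.
Qed.

Lemma laplacian_form (x : 'cV[R]_N) :
  (x^T *m laplacian aw *m x) 0 0 =
  (\sum_i \sum_j aw i j * (x i 0 - x j 0) ^+ 2) / 2.
Proof.
rewrite mxE; transitivity (\sum_j \sum_i
    ((i == j)%:R * (\sum_l aw i l) * (x i 0 * x j 0) - aw i j * (x i 0 * x j 0))).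
  apply: eq_bigr => j _; rewrite mxE mulr_suml; apply: eq_bigr => i _.
  by rewrite !mxE laplacian_deg; ring.
rewrite exchange_big/=.
have E1 : \sum_i \sum_j (i == j)%:R * (\sum_l aw i l) * (x i 0 * x j 0)
        = \sum_i \sum_j aw i j * x i 0 ^+ 2.
  apply: eq_bigr => i _; rewrite -mulr_suml; set S := \sum_l aw i l.
  rewrite (bigD1 i)//= eqxx mul1r big1 ?addr0 -?expr2//.
  by move=> j ji; rewrite eq_sym (negPf ji) !mul0r.
have E2 : \sum_i \sum_j aw i j * x i 0 ^+ 2 = \sum_i \sum_j aw i j * x j 0 ^+ 2.
  rewrite exchange_big/=; apply: eq_bigr => i _; apply: eq_bigr => j _.
  by rewrite aw_sym.
under eq_bigr do rewrite sumrB.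
rewrite sumrB E1.
have -> : \sum_i \sum_j aw i j * (x i 0 - x j 0) ^+ 2 =
   \sum_i \sum_j aw i j * x i 0 ^+ 2 + \sum_i \sum_j aw i j * x j 0 ^+ 2
   - 2 * \sum_i \sum_j aw i j * (x i 0 * x j 0).
  rewrite mulr_sumr -big_split/= -sumrB; apply: eq_bigr => i _.
  rewrite mulr_sumr -big_split/= -sumrB; apply: eq_bigr => j _; ring.
rewrite -E2; lra.
Qed.

Lemma laplacian_const : const_mx 1 *m laplacian aw = 0 :> 'rV_N.
Proof.
apply/rowP => j; rewrite !mxE; under eq_bigr do rewrite !mxE mul1r laplacian_deg.
rewrite sumrB (bigD1 j)//= eqxx mul1r [X in _ + X - _]big1 ?addr0; last first.
  by move=> i /negPf ->; rewrite mul0r.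
by apply/eqP; rewrite subr_eq0; apply/eqP/eq_bigr => i _; rewrite aw_sym.
Qed.

Lemma sorted_nth_le (s : seq R) i j : sorted <=%R s -> (i <= j < size s)%N ->
  s`_i <= s`_j.
Proof.
move=> ss /andP[ij js]; apply: (sorted_leq_nth le_trans le_refl) => //.
by rewrite inE (leq_ltn_trans ij js).
Qed.

(** By the rank hypothesis the kernel is spanned by the constant vector, and two orthogonal
    eigenvectors cannot both be constant; so 0 is a simple eigenvalue, the others are positive, and
    a vector of sum 0 has no component along the kernel. *)
Lemma laplacian_spectral_gap : (1 < N)%N -> \rank (laplacian aw) = N.-1 ->
  0 < lambda2 (laplacian aw) /\
  forall x : 'I_N -> R, \sum_i x i = 0 ->
    lambda2 (laplacian aw) * \sum_i x i ^+ 2 <=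
    (\sum_i \sum_j aw i j * (x i - x j) ^+ 2) / 2.
Proof.
move=> N1 rkL; set L := laplacian aw.
have [d [u [cpL uL uu xx xLx]]] := symmetric_spectral laplacian_sym.
have ker1 (v : 'rV[R[i]]_N) : v *m L^C = 0 -> exists c, v = c *: const_mx 1.
  move=> vL; apply/sub_rVP.
  have h1 : ((const_mx 1 : 'rV[R[i]]_N) <= kermx (L^C))%MS.
    apply/sub_kermxP; have /(congr1 (map_mx toC)) := laplacian_const.
    by rewrite map_mxM map_mx0 map_const_mx/= rmorph1.
  have : (v <= kermx (L^C))%MS by apply/sub_kermxP.
  move/submx_trans; apply; rewrite -(geq_leqif (mxrank_leqif_sup h1)).
  rewrite mxrank_ker mxrank_map rkL; case: N N1 {h1 vL} => // -[//|n _].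
  rewrite subSnn lt0n mxrank_eq0; apply/eqP => /matrixP/(_ 0 0).
  by rewrite !mxE => /eqP; rewrite oner_eq0.
have ev0 i : d i = 0 -> exists c, u i = c *: const_mx 1.
  by move=> di; apply: ker1; rewrite uL di rmorph0 scale0r.
have uniq0 i j : d i = 0 -> d j = 0 -> i = j.
  move=> /ev0[c ci] /ev0[c' cj]; apply/eqP; apply: contraT => ij.
  have := uu i j; rewrite (negPf ij)/= ci cj.
  under eq_bigr do rewrite !mxE !mulr1.
  rewrite sumr_const card_ord => /eqP; rewrite mulrn_eq0 -leqn0 leqNgt (ltnW N1)/=.
  rewrite mulf_eq0 conjC_eq0 => /orP[/eqP c0|/eqP c0].
    have := uu i i; rewrite eqxx ci c0 scale0r big1 => [/eqP|l _]; last by rewrite mxE mul0r.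
    by rewrite eq_sym oner_eq0.
  have := uu j j; rewrite eqxx cj c0 scale0r big1 => [/eqP|l _]; last by rewrite mxE mul0r.
  by rewrite eq_sym oner_eq0.
pose ds := [seq d i | i <- enum 'I_N].
have form_ge0 (x : 'cV[R]_N) : 0 <= (x^T *m L *m x) 0 0.
  rewrite laplacian_form divr_ge0// sumr_ge0// => i _; rewrite sumr_ge0// => j _.
  by rewrite mulr_ge0// sqr_ge0.
have d_ge0 i : 0 <= d i.
  have : eigenvalue L (d i).
    rewrite eigenvalue_root_char cpL root_prod_XsubC.
    by apply/mapP; exists i => //; rewrite mem_enum.
  case/eigenvalueP => v vL v0; have := form_ge0 v^T.
  rewrite trmxK vL -scalemxAl mxE => H.
  have v2 : 0 < (v *m v^T) 0 0.
    rewrite mxE lt_neqAle sumr_ge0 ?andbT; last by move=> l _; rewrite mxE -expr2 sqr_ge0.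
    apply: contra v0 => /eqP/esym H0; apply/eqP/rowP => l.
    have := psumr_eq0P _ H0 => /(_ _ l isT); rewrite !mxE -expr2 => H1.
    by apply/eqP; rewrite -sqrf_eq0 H1// => l' _; rewrite mxE -expr2 sqr_ge0.
  by rewrite pmulr_lge0 in H.
have sorted_ds : sorted_eigenvalues L (sort <=%R ds).
  split; first by apply: sort_sorted; exact: le_total.
  by rewrite cpL; apply: perm_big; rewrite perm_sym perm_sort.
(* [lambda2] is a choice with default 0. Exhibiting one sorted list of eigenvalues rules the default
   out, and whichever list is chosen is a permutation of [ds] by unique factorisation. *)
have /(@xgetPex _ 0) : exists x, (fun x => exists s, sorted_eigenvalues L s /\ x = s`_1) x.
  by exists (sort <=%R ds)`_1, (sort <=%R ds).
rewrite -/(lambda2 L) => -[s [[ss cps] ->]].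
have pds : perm_eq ds s by apply: prod_XsubC_eq; rewrite -cps cpL.
have szs : size s = N by rewrite -(perm_size pds) size_map size_enum_ord.
have s_ge0 x : x \in s -> 0 <= x.
  by rewrite -(perm_mem pds) => /mapP[i _ ->].
have cnt0 : (count_mem 0%R s <= 1)%N.
  rewrite -(seq.permP pds) count_map -size_filter.
  have : uniq [seq i <- enum 'I_N | d i == 0] by rewrite filter_uniq// enum_uniq.
  case E : [seq i <- enum 'I_N | d i == 0] => [|i [|j l]] // /andP[].
  have dl x : x \in [:: i, j & l] -> d x = 0.
    by rewrite -E mem_filter => /andP[/eqP].
  have di : d i = 0 by apply: dl; rewrite mem_head.
  have dj : d j = 0 by apply: dl; rewrite !inE eqxx orbT.
  by rewrite (uniq0 _ _ di dj) mem_head.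
have s1_gt0 : 0 < s`_1.
  rewrite lt_neqAle s_ge0 ?mem_nth ?szs// andbT; apply/eqP => s10.
  have s00 : s`_0 = 0.
    have : s`_0 <= s`_1 by apply: sorted_nth_le => //; rewrite szs.
    rewrite -s10 => s0; apply/eqP.
    by rewrite eq_le s0 s_ge0// mem_nth// szs (ltnW N1).
  move: cnt0 s10 s00 szs N1; case: (s) => [|x [|y l]] /=; last first.
    by move=> c y0 x0 _ _; move: c; rewrite -y0 x0 !eqxx.
  - by move=> _ _ _ <-.
  - by move=> _ _ _ <-.
split => // x sx; pose xv : 'cV[R]_N := \col_i x i.
have -> : (\sum_i \sum_j aw i j * (x i - x j) ^+ 2) / 2 = (xv^T *m L *m xv) 0 0.
  rewrite laplacian_form; congr (_ / _).
  by apply: eq_bigr => i _; apply: eq_bigr => j _; rewrite !mxE.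
rewrite -lecR rmorphM/=.
have -> : \sum_i x i ^+ 2 = \sum_i xv i 0 ^+ 2 by apply: eq_bigr => i _; rewrite mxE.
rewrite [X in _ * X]xx xLx mulr_sumr; apply: ler_sum => i _.
have [di0|di0] := eqVneq (d i) 0.
  have [c ->] := ev0 _ di0.
  rewrite -scalemxAl mxE.
  suff -> : ((const_mx 1 : 'rV[R[i]]_N) *m xv^C) 0 0 = 0.
    by rewrite mulr0 normr0 expr0n/= !mulr0.
  rewrite mxE; under eq_bigr do rewrite !mxE mul1r.
  by rewrite -rmorph_sum/= sx rmorph0.
rewrite ler_wpM2r ?exprn_ge0// lecR.
have : d i \in s by rewrite -(perm_mem pds); apply/mapP; exists i => //; rewrite mem_enum.
case/(nthP 0) => -[|j] js dE; last by rewrite -dE; apply: sorted_nth_le => //; rewrite js.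
(* If [d i] is the head of the sorted list, it lies below the eigenvalue 0 of the constants, hence
   is 0, against [di0]. *)
have : 0 \in s.
  rewrite -root_prod_XsubC -cps -eigenvalue_root_char; apply/eigenvalueP.
  exists (const_mx 1); first by rewrite laplacian_const scale0r.
  apply/eqP => /rowP/(_ (Ordinal (ltnW N1))).
  by rewrite !mxE => /eqP; rewrite oner_eq0.
case/(nthP 0) => j' j's s0.
have : s`_0 <= s`_j' by apply: sorted_nth_le => //; rewrite j's.
rewrite dE s0 => d0; by case/eqP: di0; apply/eqP; rewrite eq_le d0 d_ge0.
Qed.
End Spectral.

(** * A maximal inequality for perturbed supermartingales killed outside adapted sets *)

Section SupermartingaleMaximal.
Context {R : realType} {d : measure_display} {T : measurableType d}.
Variable P : probability T R.
Variable G : nat -> set (set T).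
Hypothesis G_meas : forall k, <<s G k >> `<=` measurable.
Hypothesis G_mono : forall k, <<s G k >> `<=` <<s G k.+1 >>.
Variable D : nat -> T -> R.
Hypothesis D_ge0 : forall k t, 0 <= D k t.
Hypothesis D_adapted : forall k,
  measurable_fun [set: g_sigma_algebraType (G k)] (D k).
Variable B : nat -> set T.
Hypothesis B_adapted : forall k, <<s G k >> (B k).
Variables (eps : nat -> R) (M : R).
Hypothesis eps_ge0 : forall k, 0 <= eps k.
Hypothesis eps_prod : forall k, \prod_(i < k) (1 + eps i) <= M.
(** The summand 1 lets [eps k] absorb additive as well as multiplicative perturbations: an increase
    of [D] by [eps k] is part of [(1 + eps k) (D + 1)]. *)
Hypothesis D_super : forall k (L : R) A, <<s G k >> A ->
  A `<=` B k -> A `<=` [set t | D k t <= L] ->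
  (\int[P]_(t in A) (D k.+1 t + 1)%:E <=
     (1 + eps k)%:E * \int[P]_(t in A) (D k t + 1)%:E)%E.

(** Dividing by [pr k] removes the factors [1 + eps k]; the bound [pr k <= M] recovers [D] from the
    normalised process [E]. *)
Let pr k : R := \prod_(i < k) (1 + eps i).
Let E k t : R := (D k t + 1) / pr k.

Let pr_gt0 k : 0 < pr k.
Proof. by apply: prodr_gt0 => i _; rewrite ltr_pwDl. Qed.

Let E_ge0 k t : 0 <= E k t.
Proof. by rewrite divr_ge0 ?(ltW (pr_gt0 _))// addr_ge0. Qed.

Let Eadapted k : measurable_fun [set: g_sigma_algebraType (G k)] (E k).
Proof. by apply: measurable_funM => //; apply: measurable_funD. Qed.

Let Gpre k (f : T -> R) (C : set R) :
  measurable_fun [set: g_sigma_algebraType (G k)] f -> measurable C ->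
  <<s G k >> (f @^-1` C).
Proof. by move=> mf mC; have := mf measurableT C mC; rewrite setTI. Qed.

Let GI k A1 A2 : <<s G k >> A1 -> <<s G k >> A2 -> <<s G k >> (A1 `&` A2).
Proof. exact: (@measurableI _ (g_sigma_algebraType (G k))). Qed.

Let mE k : measurable_fun setT (E k).
Proof.
move=> _ C mC; rewrite setTI; apply: (G_meas (k := k)).
exact: Gpre.
Qed.

Section level.
Variables (K L : R).
Hypothesis (K_ge0 : 0 <= K) (KL : K + 1 < L).

Let low k : set T := [set t | E k t < L].

(** A path is alive while it lies in the sets [B] and [E] is below [L]. The alive set thus meets
    both requirements of [D_super] at every time. *)
Fixpoint maximal_alive k : set T :=
  match k with
  | 0 => [set t | D 0 t <= K] `&` B 0
  | k'.+1 => maximal_alive k' `&` (low k'.+1 `&` B k'.+1)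
  end.

(** Only crossings of the level [L] by alive paths are recorded; a path that left [B] at an earlier
    time has died without a hit. *)
Fixpoint maximal_hit k : set T :=
  match k with
  | 0 => set0
  | k'.+1 => maximal_hit k' `|` (maximal_alive k' `&` ~` low k'.+1)
  end.

Let low_adapted k : <<s G k >> (low k).
Proof.
have -> : low k = E k @^-1` [set` `]-oo, L[].
  by apply/seteqP; split => t; rewrite /low /= in_itv.
exact: Gpre.
Qed.

Let alive_adapted k : <<s G k >> (maximal_alive k).
Proof.
elim: k => [|k IH] /=.
  apply: GI => //.
  have -> : [set t | D 0 t <= K] = D 0 @^-1` [set` `]-oo, K]].
    by apply/seteqP; split => t; rewrite /= in_itv.
  exact: Gpre.
by apply: GI; [exact: G_mono|apply: GI].
Qed.

Lemma maximal_alive_low k t : maximal_alive k t -> E k t < L.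
Proof.
case: k => [|k] /=; last by case=> _ [].
move=> [h _]; rewrite /E /pr big_ord0 divr1; apply: le_lt_trans KL.
by rewrite lerD2r.
Qed.

Let mlow k : measurable (low k).
Proof. exact: G_meas. Qed.

Let malive k : measurable (maximal_alive k).
Proof. exact: G_meas. Qed.

Lemma maximal_hit_measurable k : measurable (maximal_hit k).
Proof.
elim: k => [|k IH] /=; first exact: measurable0.
by apply: measurableU => //; apply: measurableI => //; apply: measurableC.
Qed.

Let mEA k A : measurable A -> measurable_fun A (EFin \o E k).
Proof. by move=> mA; apply/measurable_EFinP; apply: measurable_funTS. Qed.

Let E_super k : (\int[P]_(t in maximal_alive k) (E k.+1 t)%:E <=
  \int[P]_(t in maximal_alive k) (E k t)%:E)%E.
Proof.
have scal j A : measurable A ->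
    (\int[P]_(t in A) (E j t)%:E = (pr j)^-1%:E * \int[P]_(t in A) (D j t + 1)%:E)%E.
  move=> mA; rewrite -ge0_integralZl_EFin//.
  - by apply: eq_integral => t _; rewrite -EFinM mulrC.
  - by move=> t _; rewrite lee_fin addr_ge0.
  - have -> : (fun t => (D j t + 1)%:E) = (fun t => (pr j * E j t)%:E).
      apply/funext => t; congr EFin; rewrite /E mulrC divfK// gt_eqF//.
    apply/measurable_EFinP; apply: measurable_funM => //.
    exact: measurable_funTS.
  - by rewrite invr_ge0 ltW.
rewrite !scal//.
have := @D_super k (L * pr k) (maximal_alive k) (@alive_adapted k).
have -> : pr k.+1 = pr k * (1 + eps k) by rewrite /pr big_ord_recr.
have e1 : 0 < 1 + eps k by rewrite ltr_pwDl.
move=> H.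
have /H{}H : maximal_alive k `<=` B k by case: (k) => [|k'] t /= [] // _ [].
have /H{}H : maximal_alive k `<=` [set t | D k t <= L * pr k].
  move=> t /maximal_alive_low; rewrite /E ltr_pdivrMr// => h /=.
  by rewrite (le_trans _ (ltW h))// lerDl.
apply: (@le_trans _ _ ((pr k * (1 + eps k))^-1%:E *
    ((1 + eps k)%:E * \int[P]_(t in maximal_alive k) (D k t + 1)%:E))%E).
  by apply: lee_wpmul2l => //; rewrite lee_fin invr_ge0 mulr_ge0 ?ltW.
rewrite muleA -EFinM.
have -> // : (pr k * (1 + eps k))^-1 * (1 + eps k) = (pr k)^-1.
by rewrite invfM mulfVK// gt_eqF.
Qed.

(** The left side does not increase with [k]: alive paths that cross at time [k+1] carry [E >= L]
    there and move into the hit set, the others at most stay alive, and the integral of [E] over the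
    alive set does not grow. *)
Lemma maximal_hit_bound k :
  (L%:E * P (maximal_hit k) +
   \int[P]_(t in maximal_alive k) (E k t)%:E <= (K + 1)%:E)%E.
Proof.
have L0 : 0 < L by rewrite (le_lt_trans _ KL)// addr_ge0.
elim: k => [|k IH].
  rewrite /= measure0 mule0 add0e.
  apply: (@le_trans _ _ (\int[P]_(t in maximal_alive 0) (cst (K + 1)%:E) t)%E).
    apply: ge0_le_integral => //; first exact: (malive 0).
    - by move=> t _; rewrite lee_fin.
    - exact: (mEA _ (malive 0)).
    - by move=> t [/= h _]; rewrite lee_fin /E /pr big_ord0 divr1 lerD2r.
  rewrite integral_cst// -[leRHS]mule1 lee_wpmul2l//.
    by rewrite lee_fin addr_ge0.
  exact: probability_le1.
apply: le_trans IH.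
set H := maximal_hit k; set A := maximal_alive k.
set U := A `&` ~` low k.+1; set V := A `&` low k.+1.
have mU : measurable U.
  by apply: measurableI; [exact: malive|apply: measurableC; exact: mlow].
have mV : measurable V by apply: measurableI; [exact: malive|exact: mlow].
apply: (@le_trans _ _ (L%:E * (P H + P U) + \int[P]_(t in V) (E k.+1 t)%:E)%E).
  apply: leeD.
    by apply: lee_wpmul2l; [rewrite lee_fin ltW|apply: measureU2 => //; exact: maximal_hit_measurable].
  apply: ge0_subset_integral => //.
  - exact: mEA.
  - by move=> t _; rewrite lee_fin.
  - by move=> t /= [? []].
rewrite ge0_muleDr// -addeA leeD2l//.
apply: le_trans (E_super k); rewrite -/A.
have -> : A = U `|` V by rewrite /U /V -setIUr setvU setIT.
rewrite ge0_integral_setU//; last 3 first.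
- by apply: mEA; exact: measurableU.
- by move=> t _; rewrite lee_fin.
- rewrite disj_set2E /U /V; apply/eqP; rewrite setIACA setICl setI0//.
rewrite leeD2r// -integral_cst//; apply: ge0_le_integral => //.
- by move=> t _; rewrite lee_fin ltW.
- by apply: mEA.
- by move=> t [_ /= /negP]; rewrite -leNgt lee_fin.
Qed.

Lemma maximal_hit_ever : (P (\bigcup_k maximal_hit k) <= ((K + 1) / L)%:E)%E.
Proof.
have L0 : 0 < L by rewrite (le_lt_trans _ KL)// addr_ge0.
have mU : measurable (\bigcup_k maximal_hit k) by apply: bigcup_measurable => k _; exact: maximal_hit_measurable.
have ndhit : nondecreasing_seq maximal_hit.
  apply/nondecreasing_seqP => k; apply/subsetPset => t h /=; by left.
have := nondecreasing_cvg_mu (mu := P) maximal_hit_measurable mU ndhit.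
move=> /cvg_lim <-//; apply: lime_le.
  apply: ereal_nondecreasing_is_cvgn => i j ij.
  by apply: le_measure; rewrite ?inE; [exact: maximal_hit_measurable|exact: maximal_hit_measurable|apply/subsetPset; exact: ndhit].
apply: nearW => k; have := maximal_hit_bound k.
have : (0 <= \int[P]_(t in maximal_alive k) (E k t)%:E)%E.
  by apply: integral_ge0 => t _; rewrite lee_fin.
move=> I0 /(le_trans (leeDl _ I0)) h.
by rewrite EFinM muleC lee_pdivlMl.
Qed.

End level.

(** A path in all [B k] on which [D] is unbounded hits every level. From a start below [j] the level
    [L] is hit with probability at most [(j + 1)/L], so hitting all levels [j + 2 + i] is a null
    event, and there are countably many [j]. *)
Lemma supermartingale_bounded :
  {ae P, forall t, (forall k, B k t) -> exists C : R, forall k, D k t <= C}.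
Proof.
have M0 : 0 < M by apply: lt_le_trans (eps_prod 0); rewrite big_ord0.
pose Nul (j : nat) := \bigcap_(i : nat) \bigcup_k
  maximal_hit j%:R (j%:R + 2 + i%:R) k.
have mhit' j i k : measurable (maximal_hit j%:R (j%:R + 2 + i%:R) k).
  exact: maximal_hit_measurable.
have mN j : measurable (Nul j).
  by apply: bigcap_measurable => // i _; apply: bigcup_measurable => k _.
have N0 j : P (Nul j) = 0%E.
  apply/eqP; rewrite eq_le measure_ge0 andbT; apply/lee_addgt0Pr => e e0.
  rewrite add0e.
  have [i hi] : exists i : nat, (j%:R + 1) / e <= i%:R :> R.
    exists (Num.truncn ((j%:R + 1) / e)).+1.
    by apply: ltW; apply: truncnS_gt.
  apply: (@le_trans _ _ ((j%:R + 1) / (j%:R + 2 + i%:R))%:E).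
    apply: (@le_trans _ _ (P (\bigcup_k maximal_hit j%:R (j%:R + 2 + i%:R) k))).
      apply: le_measure; rewrite ?inE//; first exact: bigcup_measurable.
      by move=> t /(_ i I).
    apply: maximal_hit_ever => //.
    rewrite -addrA ltrD2l; have : 0 <= i%:R :> R by []. lra.
  rewrite lee_fin ler_pdivrMr; last first.
    have : 0 <= i%:R :> R by []. have : 0 <= j%:R :> R by []. lra.
  rewrite ler_pdivrMr// in hi; apply: (le_trans hi).
  rewrite mulrC ler_pM2l//; have : 0 <= j%:R :> R by []. lra.
have : P.-negligible (\bigcup_j Nul j).
  by apply: negligible_bigcup => j; exists (Nul j); split; [exact: mN|exact: N0|].
apply: negligibleS => t; apply: contra_notP => tN Bt.
have [j tNj] : exists j : nat, D 0 t <= j%:R.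
  exists (Num.truncn (D 0 t)).+1; apply: ltW; exact: truncnS_gt.
have [i ti] : exists i, ~ (\bigcup_k maximal_hit j%:R (j%:R + 2 + i%:R) k) t.
  apply: contrapT => /forallNP h; apply: tN; exists j => // i _.
  by apply: contrapT; exact: h.
have al k : maximal_alive j%:R (j%:R + 2 + i%:R) k t.
  elim: k => [|k IH] //=; split => //; split => //=.
  by apply: contrapT => h; apply: ti; exists k.+1 => //=; right.
exists ((j%:R + 2 + i%:R) * M) => k.
have jL : j%:R + 1 < j%:R + 2 + i%:R :> R.
  by rewrite -addrA ltrD2l; have : 0 <= i%:R :> R by []; lra.
have /(maximal_alive_low jL) := al k.
rewrite /E ltr_pdivrMr// => h.
apply: (le_trans _ (le_trans (ltW h) _)); first by rewrite lerDl.
by rewrite ler_pM2l; [exact: eps_prod|apply: le_lt_trans jL; rewrite addr_ge0].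
Qed.

End SupermartingaleMaximal.

(** * Integration against adapted multipliers *)

Section RealIntegrals.
Context {R : realType} {d : measure_display} {T : measurableType d}.
Variable P : {measure set T -> \bar R}.
Variable A : set T.
Hypothesis mA : measurable A.
Implicit Types f g : T -> R.
Local Notation rintegrable f := (P.-integrable A (EFin \o f)).

Lemma rintegrableD f g : rintegrable f -> rintegrable g ->
  rintegrable (fun t => f t + g t).
Proof.
move=> fi gi; apply: eq_integrable (integrableD mA fi gi) => //.
Qed.

Lemma rintegrableZ c f : rintegrable f -> rintegrable (fun t => c * f t).
Proof.
move=> fi; apply: eq_integrable (integrableZl mA c fi) => //.
Qed.

Lemma rintegrable_sum (I : Type) (s : seq I) (F : I -> T -> R) :
  (forall i, rintegrable (F i)) -> rintegrable (fun t => \sum_(i <- s) F i t).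
Proof.
move=> Fi; apply: eq_integrable (@integrable_sum _ _ _ P A mA _ s xpredT _ (fun i _ => Fi i)) => //.
by move=> t _ /=; rewrite sumEFin.
Qed.

Lemma Rintegral_sum (I : Type) (s : seq I) (F : I -> T -> R) :
  (forall i, rintegrable (F i)) ->
  \int[P]_(t in A) (\sum_(i <- s) F i t) = \sum_(i <- s) \int[P]_(t in A) F i t.
Proof.
move=> Fi; elim: s => [|i s IH].
  rewrite big_nil; under eq_Rintegral do rewrite big_nil.
  by rewrite /Rintegral integral0.
rewrite big_cons -IH -RintegralD//; last exact: rintegrable_sum.
by apply: eq_Rintegral => t _; rewrite big_cons.
Qed.

Lemma rintegrable_le f g : measurable_fun A f -> rintegrable g ->
  (forall t, A t -> `|f t| <= g t) -> rintegrable f.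
Proof.
move=> mf gi fg; apply: (le_integrable mA _ _ gi); first exact/measurable_EFinP.
move=> t At /=; rewrite lee_fin (le_trans (fg _ At))// ler_norm//.
Qed.

Lemma rintegrable_bounded_mul (K : R) f g : measurable_fun A f -> rintegrable g ->
  (forall t, A t -> `|f t| <= K) -> rintegrable (fun t => f t * g t).
Proof.
move=> mf gi fK; apply: (@rintegrable_le _ (fun t => K * `|g t|)).
- apply: measurable_funM => //; apply/measurable_EFinP; exact: (measurable_int P).
- by apply: rintegrableZ; exact: (integrable_norm gi).
- by move=> t At; rewrite normrM ler_wpM2r// fK.
Qed.

Lemma rintegrable_cst (K : R) : (P A < +oo)%E -> rintegrable (cst K).
Proof.
by move=> PA; apply: measurable_bounded_integrable => //; exact: bounded_cst.
Qed.

End RealIntegrals.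

Lemma sum_ord_lt (q m : nat) : (q <= m)%N -> (\sum_(i < m) (i < q)%N = q)%N.
Proof.
move=> qm; rewrite -(big_mkord xpredT (fun i => (i < q)%N : nat)) (big_cat_nat (n := q))//=.
rewrite [X in (_ + X)%N]big_nat_cond [X in (_ + X)%N]big1 ?addn0.
  rewrite big_nat_cond (eq_bigr (fun=> 1%N)) -?big_nat_cond ?sum_nat_const_nat ?subn0 ?muln1//.
  by move=> i /andP[/andP[_ ->]].
by move=> i /andP[/andP[qi _] _]; rewrite ltnNge qi.
Qed.

(** The sum counts the levels [1/m, ..., m/m] that are at most [y], so it is [floor(m y)/m]. *)
Lemma level_count_approx (R : realType) (m : nat) (y : R) : (0 < m)%N -> 0 <= y <= 1 ->
  `|y - \sum_(i < m) m%:R^-1 * ((i.+1%:R / m%:R <= y)%R%:R)| <= m%:R^-1.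
Proof.
move=> m0 /andP[y0 y1]; rewrite -mulr_sumr.
have m0' : 0 < m%:R :> R by rewrite ltr0n.
have my0 : 0 <= y * m%:R by rewrite mulr_ge0.
set q := Num.truncn (y * m%:R).
have /andP[q1 q2] : (q%:R <= y * m%:R < q.+1%:R) by exact: truncn_itv.
have qm : (q <= m)%N.
  rewrite -(ler_nat R) (le_trans q1)// -[leRHS]mul1r ler_pM2r//.
have -> : \sum_(i < m) ((i.+1%:R / m%:R <= y)%R%:R : R) = q%:R.
  rewrite -[in RHS](sum_ord_lt qm) natr_sum; apply: eq_bigr => i _; congr (_%:R).
  rewrite ler_pdivrMr//; congr nat_of_bool; apply/idP/idP => h.
    by rewrite -ltnS -(ltr_nat R); apply: le_lt_trans h q2.
  by apply: le_trans q1; rewrite ler_nat.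
have -> : y - m%:R^-1 * q%:R = m%:R^-1 * (y * m%:R - q%:R).
  by rewrite mulrBr mulrCA mulVf ?mulr1// gt_eqF.
rewrite normrM gtr0_norm ?invr_gt0// -[leRHS]mulr1 ler_pM2l ?invr_gt0//.
rewrite ger0_norm ?subr_ge0// lerBlDl; move: q2; rewrite -natr1; exact: ltW.
Qed.

Section Multiplier.
Context {R : realType} {d : measure_display} {T : measurableType d}.
Variable P : probability T R.
Variable G : set (set T).
Hypothesis G_meas : <<s G >> `<=` measurable.

Lemma gsigma_measurable_fun d' (T' : measurableType d') (f : T -> T') A :
  measurable A ->
  measurable_fun [set: g_sigma_algebraType G] f -> measurable_fun A f.
Proof.
move=> mA mf; apply: measurable_funTS => _ C mC.
rewrite setTI; apply: G_meas; have := mf measurableT C mC; by rewrite setTI.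
Qed.

(** After scaling into [[0, 1]], [Y] is approximated within [1/m] by an average of indicators of its
    superlevel sets. These sets belong to the sigma-algebra, where the sign of the integral of [z]
    is known, and the error is at most [1/m] times the integral of [|z|]. *)
Lemma integral_mul_le0 A (z Y : T -> R) (K : R) : <<s G >> A ->
  P.-integrable A (EFin \o z) ->
  (forall C, <<s G >> C -> C `<=` A -> \int[P]_(t in C) z t <= 0) ->
  measurable_fun [set: g_sigma_algebraType G] Y ->
  (forall t, A t -> 0 <= Y t <= K) ->
  \int[P]_(t in A) (Y t * z t) <= 0.
Proof.
move=> GA zi zC mY YK.
have mA : measurable A by exact: G_meas.
wlog K1 : K Y mY YK / K = 1.
  move=> H; have [K0|K0] := leP K 0.
    rewrite (_ : \int[P]_(t in A) _ = \int[P]_(t in A) 0).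
      by rewrite /Rintegral integral0.
    apply: eq_Rintegral => t; rewrite inE => /YK /andP[h1 h2].
    by have -> : Y t = 0; [apply/eqP; rewrite eq_le h1 (le_trans h2)|rewrite mul0r].
  have := H 1 (fun t => K^-1 * Y t); have -> : \int[P]_(t in A) (K^-1 * Y t * z t) =
    K^-1 * \int[P]_(t in A) (Y t * z t).
    rewrite -RintegralZl//; first by apply: eq_Rintegral => t _; rewrite mulrA.
    apply: (@rintegrable_bounded_mul _ _ _ P A mA K) => //.
      exact: gsigma_measurable_fun.
    by move=> t /YK /andP[h1 h2]; rewrite ger0_norm.
  rewrite pmulr_rle0 ?invr_gt0//; apply => //; first exact: measurable_funM.
  move=> t /YK /andP[h1 h2]; rewrite mulr_ge0 ?invr_ge0 ?(ltW K0)//=.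
  by rewrite mulrC ler_pdivrMr// mul1r.
subst K.
have mYA : measurable_fun A Y by exact: gsigma_measurable_fun.
have zYi : P.-integrable A (EFin \o (fun t => Y t * z t)).
  apply: (@rintegrable_bounded_mul _ _ _ P A mA 1) => //.
  by move=> t /YK /andP[h1 h2]; rewrite ger0_norm.
set S := \int[P]_(t in A) `|z t|.
have bnd (m : nat) : (0 < m)%N -> \int[P]_(t in A) (Y t * z t) <= m%:R^-1 * S.
  move=> m0; pose lev (i : nat) : set T := Y @^-1` [set` `[(i.+1%:R / m%:R), +oo[ ].
  have Glev i : <<s G >> (lev i).
    by have := mY measurableT _ (measurable_itv `[(i.+1%:R / m%:R), +oo[ ); rewrite setTI.
  pose Ym t : R := \sum_(i < m) m%:R^-1 * ((i.+1%:R / m%:R <= Y t)%R%:R).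
  pose F (i : 'I_m) t := m%:R^-1 * (z \_ (lev i)) t.
  have levE i t : (z \_ (lev i)) t = (i.+1%:R / m%:R <= Y t)%R%:R * z t.
    rewrite /patch; case: ifPn => [|].
      by rewrite inE /lev /= in_itv /= andbT => ->; rewrite mul1r.
    by rewrite notin_setE /lev /= in_itv /= andbT => /negP/negPf ->; rewrite mul0r.
  have zli i : P.-integrable A (EFin \o (z \_ (lev i))).
    rewrite -restrict_EFin; apply/integrable_restrict => //; first exact: G_meas.
    by apply: integrableS zi => //; apply: measurableI => //; exact: G_meas.
  have Fi i : P.-integrable A (EFin \o F i) by apply: rintegrableZ.
  have YmE : (fun t => Ym t * z t) = (fun t => \sum_(i < m) F i t).
    apply/funext => t; rewrite /Ym mulr_suml; apply: eq_bigr => i _.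
    by rewrite /F levE mulrA.
  have Ymi : P.-integrable A (EFin \o (fun t => Ym t * z t)).
    by rewrite YmE; exact: rintegrable_sum.
  have Ym0 : \int[P]_(t in A) (Ym t * z t) <= 0.
    rewrite YmE Rintegral_sum//; apply: sumr_le0 => i _.
    rewrite (RintegralZl _ mA (zli i)).
    rewrite -Rintegral_mkcondr mulr_ge0_le0 ?invr_ge0//; apply: zC; last by move=> t [].
    by apply: (@measurableI _ (g_sigma_algebraType G)); [exact: GA|exact: Glev].
  have -> : \int[P]_(t in A) (Y t * z t) = \int[P]_(t in A) (Ym t * z t) +
     (\int[P]_(t in A) (Y t * z t) - \int[P]_(t in A) (Ym t * z t)) by rewrite addrC subrK.
  rewrite -[leRHS]add0r lerD// -RintegralB// /S -RintegralZl//; last exact: (integrable_norm zi).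
  apply: le_Rintegral => //.
  - by apply: (@rintegrableD _ _ _ P A mA _ (fun t => - (Ym t * z t))) => //;
    have := rintegrableZ mA (-1) Ymi; apply: eq_integrable => // t _ /=; rewrite mulN1r.
  - by apply: rintegrableZ => //; exact: (integrable_norm zi).
  move=> t At; rewrite -mulrBl (le_trans (ler_norm _))// normrM ler_wpM2r//.
  by apply: level_count_approx => //; exact: YK.
have S0 : 0 <= S by apply: Rintegral_ge0.
rewrite leNgt; apply/negP => I0.
set J := \int[P]_(t in A) (Y t * z t) in I0 bnd *.
have := bnd (Num.truncn (S / J)).+1 isT; rewrite leNgt => /negP; apply.
rewrite mulrC ltr_pdivrMr ?ltr0n// mulrC -ltr_pdivrMr//; exact: truncnS_gt.
Qed.

(** Two applications of the inequality to the nonnegative multiplier [Y + K], against [z] and [- z];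
    the constant [K] integrates to 0 against [z]. *)
Lemma integral_mul_eq0 A (z Y : T -> R) (K : R) : <<s G >> A ->
  P.-integrable A (EFin \o z) ->
  (forall C, <<s G >> C -> C `<=` A -> \int[P]_(t in C) z t = 0) ->
  measurable_fun [set: g_sigma_algebraType G] Y ->
  (forall t, A t -> `|Y t| <= K) ->
  \int[P]_(t in A) (Y t * z t) = 0.
Proof.
move=> GA zi zC mY YK.
have mA : measurable A by exact: G_meas.
have mzi : P.-integrable A (EFin \o (fun t => - z t)).
  by have := rintegrableZ mA (-1) zi; apply: eq_integrable => // t _ /=; rewrite mulN1r.
have mY' : measurable_fun [set: g_sigma_algebraType G] (fun t => Y t + K).
  by apply: measurable_funD.
have YK' t : A t -> 0 <= Y t + K <= K + K.
  by move=> /YK; rewrite ler_norml => /andP[h1 h2]; lra.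
have Yzi : P.-integrable A (EFin \o (fun t => Y t * z t)).
  by apply: (@rintegrable_bounded_mul _ _ _ P A mA K) => //; exact: gsigma_measurable_fun.
have Kzi : P.-integrable A (EFin \o (fun t => K * z t)) by exact: rintegrableZ.
have E : \int[P]_(t in A) ((Y t + K) * z t) = \int[P]_(t in A) (Y t * z t).
  under eq_Rintegral do rewrite mulrDl.
  by rewrite RintegralD// RintegralZl// (zC A)// mulr0 addr0.
apply/eqP; rewrite eq_le; apply/andP; split.
  rewrite -E; apply: (@integral_mul_le0 A _ _ (K + K)) => // C GC CA.
  by rewrite zC.
have := @integral_mul_le0 A (fun t => - z t) (fun t => Y t + K) (K + K) GA mzi _ mY' YK'.
have -> : \int[P]_(t in A) ((Y t + K) * - z t) = - \int[P]_(t in A) (Y t * z t).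
  rewrite -E -mulN1r -RintegralZl//; last first.
    by have := rintegrableD mA Yzi Kzi; apply: eq_integrable => // t _ /=; rewrite mulrDl.
  by apply: eq_Rintegral => t _; rewrite mulN1r mulrN.
rewrite oppr_le0; apply => C GC CA.
have mC : measurable C by exact: G_meas.
have ziC : P.-integrable C (EFin \o z) by exact: integrableS zi.
have -> : \int[P]_(t in C) (- z t) = -1 * \int[P]_(t in C) z t.
  by rewrite -RintegralZl//; apply: eq_Rintegral => t _; rewrite mulN1r.
by rewrite zC// mulr0.
Qed.

End Multiplier.

(** * Independence: freezing and factorisation of integrals *)

Section Freezing.
Context {R : realType} {d : measure_display} {T : measurableType d}.
Variable P : probability T R.
Variable G : set (set T).
Hypothesis G_meas : <<s G >> `<=` measurable.
Local Notation TG := (g_sigma_algebraType G).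
Variable Y : T -> R.
Hypothesis mY : measurable_fun setT Y.
Hypothesis indep : forall A (B : set R), <<s G >> A -> measurable B ->
  P (A `&` Y @^-1` B) = (P A * P (Y @^-1` B))%E.

(** The sample point itself, seen in the coarser sigma-algebra, plays the role of the conditioning
    variable. *)
Let idG : T -> TG := fun t => t.
Let midG : measurable_fun setT idG.
Proof. by move=> _ C mC; rewrite setTI; exact: G_meas. Qed.
Let mpair : measurable_fun setT (fun t => (idG t, Y t)).
Proof. exact: measurable_fun_pair. Qed.

Let idGf : {mfun T >-> TG} := HB.pack idG (isMeasurableFun.Build _ _ _ _ _ midG).
Let Yf : {mfun T >-> R} := HB.pack Y (isMeasurableFun.Build _ _ _ _ _ mY).
Let pairf : {mfun T >-> (TG * R)%type} :=
  HB.pack (fun t => (idG t, Y t)) (isMeasurableFun.Build _ _ _ _ _ mpair).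

(** By independence the law of the pair (sample point, [Y]) is a product measure, and a product
    measure integrates the measure of the sections. *)
Lemma freezing (E : set (TG * R)) : measurable E ->
  P [set t | E (t, Y t)] = (\int[P]_t P (Y @^-1` (xsection E t)))%E.
Proof.
move=> mE.
have := @product_measure_unique _ _ TG (R) R
  (distribution P idGf) (distribution P Yf) (distribution P pairf) _ E mE.
rewrite /product_measure1 => H.
transitivity (distribution P pairf E); first by [].
rewrite -H.
  by rewrite ge0_integral_distribution//; exact: measurable_fun_xsection.
move=> A B mA mB; exact: indep.
Qed.
End Freezing.

Section IndependentIntegral.
Context {R : realType} {d : measure_display} {T : measurableType d}.
Variable P : probability T R.

(** [P] restricted to [D] and pushed forward along [g] equals [P D] times the law of [g].
    Integrating [|y|], which is [y] on the range of [g], over these two measures gives the two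
    sides. *)
Lemma ge0_integral_indep (D : set T) (g : T -> \bar R) : measurable D ->
  measurable_fun setT g -> (forall t, (0 <= g t)%E) ->
  (forall B : set (\bar R), measurable B -> P (g @^-1` B `&` D) = (P D * P (g @^-1` B))%E) ->
  (\int[P]_(t in D) g t = P D * \int[P]_t g t)%E.
Proof.
move=> mD mg g0 ind.
have PDfin : P D \is a fin_num by exact: fin_num_measure.
pose pD : {nonneg R} := NngNum (fine_ge0 (measure_ge0 P D)).
have QD : (\int[P]_(t in D) g t = \int[mrestr P mD]_(t in D) g t)%E.
  apply: eq_measure_integral => A mA AD.
  by rewrite /= /mrestr setIidl.
have QT : (\int[mrestr P mD]_(t in D) g t = \int[mrestr P mD]_t g t)%E.
  rewrite [RHS](@ge0_negligible_integral _ _ _ (mrestr P mD) setT (~` D))//.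
  - by rewrite setTD setCK.
  - exact: measurableC.
  - by rewrite /= /mrestr setICl measure0.
have push (mu : {measure set T -> \bar R}) :
    (\int[mu]_t g t = \int[pushforward mu g]_y `|y|)%E.
  rewrite (ge0_integral_pushforward mg)// preimage_setT.
  by apply: eq_integral => t _ /=; rewrite gee0_abs.
rewrite QD QT !push.
rewrite (eq_measure_integral (mscale pD (pushforward P g))); last first.
  move=> B mB _; rewrite /= /pushforward /mrestr ind//.
  by rewrite -[in LHS](fineK PDfin).
by rewrite ge0_integral_mscale// -[in RHS](fineK PDfin).
Qed.
End IndependentIntegral.

Section DensityMeasure.
Context {R : realType} {d : measure_display} {T : measurableType d}.
Variables (P : {measure set T -> \bar R}) (f : T -> \bar R).
Hypothesis mf : measurable_fun setT f.
Hypothesis f_ge0 : forall t, (0 <= f t)%E.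

(** The proof [mf'] is an argument so that the measure structure, which depends on it, can be
    recovered from the term. Two integrals over a sigma-algebra are compared below through such
    measures and uniqueness on a pi-system. *)
Definition density_measure (mf' : measurable_fun setT f) (A : set T) : \bar R :=
  (\int[P]_(t in A) f t)%E.

Let dm0 : density_measure mf set0 = 0%E.
Proof. exact: integral_set0. Qed.

Let dm_ge0 A : (0 <= density_measure mf A)%E.
Proof. exact: integral_ge0. Qed.

Let dm_add : semi_sigma_additive (density_measure mf).
Proof.
move=> F mF tF mUF; rewrite /density_measure ge0_integral_bigcup//.
  apply: is_cvg_ereal_nneg_natsum_cond => n _ _; exact: integral_ge0.
exact: measurable_funTS.
Qed.

HB.instance Definition _ := isMeasure.Build _ _ _ (density_measure mf) dm0 dm_ge0 dm_add.
End DensityMeasure.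

(** * Filtration, dithers and conditional moments of the observation noise *)

Section Noise.
Context {R : realType} {d : measure_display} {T : measurableType d}.
Variable P : probability T R.
Variables (N : nat) (m : 'I_N -> nat).
Variable w : forall i : 'I_N, nat -> T -> 'cV[R]_(m i).
Variable dn : 'I_N -> nat -> T -> R.
Hypothesis w_meas : forall i k (l : 'I_(m i)), measurable_fun setT (fun t => w i k t l 0).
Hypothesis d_meas : forall i k, measurable_fun setT (dn i k).
Hypothesis d_indep : mutually_independent P
     (fun c : ('I_N * nat) + unit =>
        match c with inl (i, k) => Fd dn i k | inr _ => Fw_all w end).

(** Generating family of [Fwd w dn k], named so that [g_sigma_algebraType] can be formed on it;
    measurability there is adaptedness at time [k]. *)
Definition Gwd (k : nat) : set (set T) :=
  [set A | exists c (B : set R), (match c with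
    | inl c' => (1 <= c'.2 <= k)%N
    | inr c' => (1 <= c'.2 <= k)%N end) /\ measurable B /\
    A = wdcoord w dn c @^-1` B].

Lemma FwdE k : Fwd w dn k = <<s Gwd k >>.
Proof. by []. Qed.

Lemma sigma_of_sub (C : Type) (D : set C) (X : C -> T -> R) (F : set (set T)) :
  sigma_algebra setT F ->
  (forall c B, D c -> measurable B -> F (X c @^-1` B)) -> sigma_of D X `<=` F.
Proof.
by move=> sF H; apply: smallest_sub => // A [c [B [Dc [mB ->]]]]; exact: H.
Qed.

Lemma sigma_of_gen (C : Type) (D : set C) (X : C -> T -> R) c (B : set R) :
  D c -> measurable B -> sigma_of D X (X c @^-1` B).
Proof. by move=> Dc mB; apply: sub_gen_smallest; exists c, B. Qed.

Lemma sigma_of_sigma (C : Type) (D : set C) (X : C -> T -> R) :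
  sigma_algebra setT (sigma_of D X).
Proof. exact: smallest_sigma_algebra. Qed.

Lemma preimage_measurable (f : T -> R) (B : set R) :
  measurable_fun setT f -> measurable B -> measurable (f @^-1` B).
Proof. by move=> mf mB; rewrite -[X in measurable X]setTI; exact: mf. Qed.

Lemma wdcoord_measurable c : measurable_fun setT (wdcoord w dn c).
Proof. by case: c => [[[i l] k]|[i k]]; [exact: (@w_meas i k l)|exact: d_meas]. Qed.

Lemma Fwd_measurable k : <<s Gwd k >> `<=` measurable.
Proof.
apply: sigma_of_sub; first exact: sigma_algebra_measurable.
by move=> c B _ mB; apply: preimage_measurable => //; exact: wdcoord_measurable.
Qed.

Lemma Fw_all_measurable : Fw_all w `<=` measurable.
Proof.
apply: sigma_of_sub; first exact: sigma_algebra_measurable.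
by move=> [[i l] k] B _ mB; apply: preimage_measurable => //; exact: (@w_meas i k l).
Qed.

Lemma Fd_measurable i k : Fd dn i k `<=` measurable.
Proof.
apply: sigma_of_sub; first exact: sigma_algebra_measurable.
by move=> c B _ mB; apply: preimage_measurable.
Qed.

Lemma Fwd_mono k : <<s Gwd k >> `<=` <<s Gwd k.+1 >>.
Proof.
apply: sigma_of_sub; first exact: smallest_sigma_algebra.
move=> c B Dc mB; apply: sub_gen_smallest; exists c, B; split => //.
by case: c Dc => c' /= /andP[-> h] /=; exact: leqW.
Qed.

Lemma Fwd_mono_le k l : (k <= l)%N -> <<s Gwd k >> `<=` <<s Gwd l >>.
Proof.
elim: l => [|l IH]; first by rewrite leqn0 => /eqP ->.
rewrite leq_eqVlt => /orP[/eqP ->//|]; rewrite ltnS => /IH h A /h.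
exact: Fwd_mono.
Qed.

Lemma Fw_sub_Fwd k : Fw w k `<=` <<s Gwd k >>.
Proof.
apply: sigma_of_sub; first exact: smallest_sigma_algebra.
by move=> c B Dc mB; apply: sub_gen_smallest; exists (inl c), B.
Qed.

Lemma Fw_sub_all k : Fw w k `<=` Fw_all w.
Proof.
apply: sigma_of_sub; first exact: smallest_sigma_algebra.
by move=> c B /= /andP[Dc _] mB; apply: sigma_of_gen.
Qed.

Lemma wcoord_adapted i k (l : 'I_(m i)) : (0 < k)%N ->
  measurable_fun [set: g_sigma_algebraType (Gwd k)] (fun t => w i k t l 0).
Proof.
move=> k0 _ B mB; rewrite setTI; apply: sub_gen_smallest.
exists (inl (existT _ i l, k)), B; split => //=; by rewrite k0 leqnn.
Qed.

Lemma dn_adapted i k : (0 < k)%N ->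
  measurable_fun [set: g_sigma_algebraType (Gwd k)] (dn i k).
Proof.
move=> k0 _ B mB; rewrite setTI; apply: sub_gen_smallest.
exists (inr (i, k)), B; split => //=; by rewrite k0 leqnn.
Qed.

Local Notation Ix := (('I_N * nat) + unit)%type.
Local Notation Gs := (fun c : Ix =>
        match c with inl (i, k) => Fd dn i k | inr _ => Fw_all w end).

Let dix (K : nat) : seq Ix :=
  [seq inl p | p <- [seq (i, t) | i <- enum 'I_N, t <- iota 1 K]].

(** Rectangles: an event of the observation noises up to time [K] intersected with one event for
    each dither up to time [K]. They form a pi-system that generates [Fwd w dn K]. *)
Let PiSys (K : nat) : set (set T) := [set E | exists A : Ix -> set T,
  [/\ forall c, Gs c (A c), Fw w K (A (inr tt)) &
      E = A (inr tt) `&` \bigcap_(c in [set` dix K]) A c]].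

Let dixP K i t : (inl (i, t) \in dix K) = (1 <= t <= K)%N.
Proof.
apply/mapP/idP => [[p /allpairsP[[i' t'] /= [_ ht ->]] [_ ->]]|ht].
  by move: ht; rewrite mem_iota add1n ltnS.
exists (i, t) => //; apply/allpairsP; exists (i, t) => //=.
by rewrite mem_enum mem_iota add1n ltnS.
Qed.

Let dix_inr K : (inr tt \in dix K) = false.
Proof. by apply/mapP => -[]. Qed.

Let dix_uniq K : uniq (dix K).
Proof.
rewrite map_inj_uniq; last by move=> x y [].
by apply: allpairs_uniq; rewrite ?enum_uniq ?iota_uniq// => -[a b] [a' b'] _ _ [-> ->].
Qed.

Let Gs_meas c : Gs c `<=` measurable.
Proof. by case: c => [[i k]|[]]; [exact: Fd_measurable|exact: Fw_all_measurable]. Qed.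

Let Gs_sigma c : sigma_algebra setT (Gs c).
Proof. by case: c => [[i k]|[]]; exact: sigma_of_sigma. Qed.

Let sigI (F : set (set T)) A B : sigma_algebra setT F -> F A -> F B -> F (A `&` B).
Proof.
move=> sF FA FB.
have := @measurableI _ (g_sigma_algebraType F) A B.
by rewrite /measurable/= (sigma_algebra_id sF); apply.
Qed.

Let sigT (F : set (set T)) : sigma_algebra setT F -> F setT.
Proof. by case=> F0 FD _; rewrite -(setD0 setT); exact: FD. Qed.

Let bigcap_dix_meas K (A : Ix -> set T) : (forall c, Gs c (A c)) ->
  measurable (\bigcap_(c in [set` dix K]) A c).
Proof.
move=> GA; apply: fin_bigcap_measurable => // c _; exact: (@Gs_meas c _ (GA c)).
Qed.

Let PiSys_meas K : PiSys K `<=` measurable.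
Proof.
move=> E [A [GA _ ->]]; apply: measurableI; last exact: bigcap_dix_meas.
exact: (@Gs_meas (inr tt) _ (GA (inr tt))).
Qed.

Let PiSysI K : setI_closed (PiSys K).
Proof.
move=> E1 E2 [A1 [G1 F1 ->]] [A2 [G2 F2 ->]].
exists (fun c => A1 c `&` A2 c); split.
- by move=> c; apply: (sigI (Gs_sigma c)); [exact: G1|exact: G2].
- exact: (@sigI (Fw w K) _ _ (sigma_of_sigma _ _) F1 F2).
- by rewrite setIACA bigcapI.
Qed.

Let PiSysT K : PiSys K setT.
Proof.
exists (fun=> setT); split.
- by move=> c; exact: (sigT (Gs_sigma c)).
- exact: (@sigT (Fw w K) (sigma_of_sigma _ _)).
- by apply/seteqP; split.
Qed.

Let Fwd_PiSys K : <<s Gwd K >> `<=` <<s PiSys K >>.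
Proof.
apply: sigma_of_sub; first exact: smallest_sigma_algebra.
case=> [c|[i t]] B Dc mB; apply: sub_gen_smallest.
  exists (fun x => if x is inr _ then wcoord w c @^-1` B else setT); split.
  - case=> [[i t]|u]; first exact: (@sigT (Fd dn i t) (sigma_of_sigma _ _)).
    by apply: sigma_of_gen => //; case/andP: Dc.
  - by apply: sigma_of_gen.
  - apply/seteqP; split => s /=; last by case.
    by move=> h; split => // -[p|[]] //=; rewrite dix_inr.
exists (fun x => if x == inl (i, t) then dn i t @^-1` B else setT); split.
- move=> c; case: eqP => [->|_]; last exact: (sigT (Gs_sigma c)).
  by apply: (@sigma_of_gen _ _ (fun _ => dn i t) tt) => //; case/andP: Dc.
- exact: (@sigT (Fw w K) (sigma_of_sigma _ _)).
- apply/seteqP; split => s /=.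
    by move=> h; split => // c _; case: eqP.
  by case=> _ /(_ (inl (i, t))) /=; rewrite eqxx dixP; apply.
Qed.

Let indepE K A (c0 : seq Ix) : uniq (c0 ++ dix K) -> (forall c, Gs c (A c)) ->
  P (\bigcap_(c in [set` c0]) A c `&` \bigcap_(c in [set` dix K]) A c) =
  (\big[*%E/1%E]_(c <- c0) P (A c) * \big[*%E/1%E]_(c <- dix K) P (A c))%E.
Proof.
move=> u GA; rewrite -big_cat /=.
rewrite -(@d_indep (c0 ++ dix K) A u (fun c _ => GA c)) -bigcap_setU.
congr (P (\bigcap_(c in _) _)); apply/seteqP; split => c /=; rewrite mem_cat.
  by case=> ->; rewrite ?orbT.
by case/orP; [left|right].
Qed.

(** Both sides are finite measures in [A]. On rectangles they agree by mutual independence, because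
    the index [(j, k)] is not among those of [dix k.-1]. *)
Lemma dn_indep j k A (B : set R) : (0 < k)%N -> <<s Gwd k.-1 >> A -> measurable B ->
  P (A `&` dn j k @^-1` B) = (P A * P (dn j k @^-1` B))%E.
Proof.
move=> k0 /Fwd_PiSys GA mB; set D := dn j k @^-1` B.
have mD : measurable D by apply: preimage_measurable.
have kk : (k <= k.-1)%N = false by rewrite leqNgt ltn_predL k0.
have PDfin : P D \is a fin_num by exact: fin_num_measure.
pose pD : {nonneg R} := NngNum (fine_ge0 (measure_ge0 P D)).
have H := @g_sigma_algebra_measure_unique _ R T (PiSys k.-1) (@PiSys_meas k.-1)
  (fun=> setT) (fun=> PiSysT k.-1) _ (mrestr P mD) (mscale pD P) (@PiSysI k.-1).
have E X : mscale pD P X = (P D * P X)%E by rewrite -[in RHS](fineK PDfin).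
transitivity (mscale pD P A); last by rewrite muleC -E.
apply: H => //.
- by rewrite bigcup_const.
- move=> X [A0 [G0 _ ->]]; rewrite [RHS]E /= /mrestr.
  pose A1 (x : Ix) := if x == inl (j, k) then D else A0 x.
  have GA1 x : Gs x (A1 x).
    rewrite /A1; case: (x =P inl (j, k)) => [->|_]; last exact: G0.
    exact: (@sigma_of_gen _ _ (fun _ => dn j k) tt).
  have A1d c : c \in dix k.-1 -> A1 c = A0 c.
    move=> cd; rewrite /A1; case: eqP => // ce.
    by move: cd; rewrite ce dixP kk andbF.
  have eqA1 : \bigcap_(c in [set` dix k.-1]) A1 c = \bigcap_(c in [set` dix k.-1]) A0 c.
    by apply: eq_bigcapr => c /= /A1d.
  have u1 : uniq ([:: inr tt] ++ dix k.-1) by rewrite /= dix_inr dix_uniq.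
  have u2 : uniq ([:: inl (j, k); inr tt] ++ dix k.-1).
    by rewrite /= inE/= dixP dix_inr dix_uniq kk andbF.
  have h1 := indepE u1 G0; rewrite bigcap_seq big_seq1 big_seq1 in h1.
  have h2 := indepE u2 GA1.
  have A1j : A1 (inl (j, k)) = D by rewrite /A1 eqxx.
  have A1r : A1 (inr tt) = A0 (inr tt) by [].
  have E3 : (\prod_(c <- dix k.-1) P (A1 c) = \prod_(c <- dix k.-1) P (A0 c))%E.
    by rewrite big_seq [RHS]big_seq; apply: eq_bigr => c /A1d ->.
  rewrite eqA1 E3 bigcap_seq 2!big_cons big_nil setIT 2!big_cons big_nil mule1 A1j A1r in h2.
  by rewrite h1 muleA -h2 [in LHS]setIC setIA.
- by move=> _; rewrite /= /mrestr setTI ltey_eq PDfin.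
Qed.

Let FwallT : set (set T) := [set A | exists (c : {i : 'I_N & 'I_(m i)} * nat) (B : set R),
  (1 <= c.2)%N /\ measurable B /\ A = wcoord w c @^-1` B].

(** The dithers are independent of the whole family [w], so their part of a rectangle factors out of
    the integral of any function of [w]. *)
Let integral_split K (A : Ix -> set T) (C : set T) (g : T -> \bar R) :
  (forall c, Gs c (A c)) -> Fw_all w C ->
  (forall B : set (\bar R), measurable B -> Fw_all w (g @^-1` B)) ->
  (forall t, (0 <= g t)%E) ->
  (\int[P]_(t in C `&` \bigcap_(c in [set` dix K]) A c) g t =
   P (\bigcap_(c in [set` dix K]) A c) * \int[P]_(t in C) g t)%E.
Proof.
move=> GA FC Fg g0; set D := \bigcap_(c in _) _.
have mD : measurable D by exact: bigcap_dix_meas.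
have mg : measurable_fun setT g.
  by move=> _ B mB; rewrite setTI; apply: Fw_all_measurable; exact: Fg.
have mC : measurable C by exact: Fw_all_measurable.
rewrite integral_mkcondl [LHS]ge0_integral_indep//.
- by rewrite -integral_mkcond.
- exact: ((measurable_restrictT g mC).1 (measurable_funTS mg)).
- by move=> t; rewrite /patch; case: ifP.
move=> B mB; set E := _ @^-1` B.
have FE : Fw_all w E.
  have -> : E = (C `&` g @^-1` B) `|` (~` C `&` (fun=> 0%E) @^-1` B).
    apply/seteqP; split => t; rewrite /E /patch /=.
      case: ifPn; first by rewrite inE => Ct h; left.
      by rewrite notin_setE => Ct h; right.
    by case=> -[Ct h]; [rewrite mem_set|rewrite memNset].
  apply: (@measurableU _ (g_sigma_algebraType FwallT)).
    by apply: (@measurableI _ (g_sigma_algebraType FwallT)); [exact: FC|exact: Fg].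
  apply: (@measurableI _ (g_sigma_algebraType FwallT)).
    by apply: (@measurableC _ (g_sigma_algebraType FwallT)); exact: FC.
  by rewrite preimage_cst; case: ifP => _;
    [exact: (@measurableT _ (g_sigma_algebraType FwallT))
    |exact: (@measurable0 _ (g_sigma_algebraType FwallT))].
pose A1 (x : Ix) := if x is inr _ then E else A x.
have GA1 x : Gs x (A1 x) by case: x => [p|u] //=; exact: (GA (inl p)).
have u1 : uniq ([:: inr tt] ++ dix K) by rewrite /= dix_inr dix_uniq.
have h1 := indepE u1 GA1; rewrite bigcap_seq big_seq1 big_seq1 /= in h1.
have h0 := @indepE K A1 [::] (dix_uniq K) GA1.
rewrite bigcap_seq big_nil big_nil setTI mul1e in h0.
have DE : \bigcap_(c in [set` dix K]) A1 c = D.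
  by apply: eq_bigcapr => -[p|[]] //=; rewrite dix_inr.
by rewrite -DE h1 h0 muleC.
Qed.

(** The conditioning in [Z] is on past observation noises only, whereas [A] may involve past
    dithers. On a rectangle the dithers factor out of the integrals of both [f] and [Z], which
    leaves an event of [Fw w k.-1], where the two agree; uniqueness of measures then reaches every
    [A]. *)
Lemma cond_moment_bound k (f Z : T -> \bar R) (M : R) A : (0 < k)%N ->
  (forall t, (0 <= f t)%E) ->
  (forall B : set (\bar R), measurable B -> Fw_all w (f @^-1` B)) ->
  cond_exp_nonneg P (Fw w k.-1) f Z ->
  <<s Gwd k.-1 >> A -> A `<=` [set t | (Z t <= M%:E)%E] ->
  (\int[P]_(t in A) f t <= M%:E * P A)%E.
Proof.
move=> k0 f0 Ff [Z0 [FZ ZE]] /[dup] FA /Fwd_PiSys GA AM.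
have mA : measurable A by exact: Fwd_measurable FA.
(* Cutting [f] and [Z] down to the event [Z <= M] makes the two measures finite, as the uniqueness
   argument requires. *)
pose B0 := Z @^-1` [set` `]-oo, M%:E]%E].
have FB0 : Fw w k.-1 B0 by apply: FZ; exact: emeasurable_itv.
have mf : measurable_fun setT f.
  by move=> _ B mB; rewrite setTI; apply: Fw_all_measurable; exact: Ff.
have mZ : measurable_fun setT Z.
  move=> _ B mB; rewrite setTI; apply: Fw_all_measurable; apply: Fw_sub_all.
  exact: FZ.
have mB0 : measurable B0 by apply: Fw_all_measurable; apply: Fw_sub_all FB0.
have mfB : measurable_fun setT (f \_ B0).
  exact: ((measurable_restrictT f mB0).1 (measurable_funTS mf)).
have mZB : measurable_fun setT (Z \_ B0).
  exact: ((measurable_restrictT Z mB0).1 (measurable_funTS mZ)).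
have fB0 t : (0 <= (f \_ B0) t)%E by rewrite /patch; case: ifP.
have ZB0 t : (0 <= (Z \_ B0) t)%E by rewrite /patch; case: ifP.
have ZBM t : ((Z \_ B0) t <= (Num.max M 0)%:E)%E.
  rewrite /patch; case: ifPn; last by move=> _; rewrite lee_fin le_max lexx orbT.
  rewrite inE /B0 /= in_itv /= => h; apply: (le_trans h).
  by rewrite lee_fin le_max lexx.
have key X : PiSys k.-1 X ->
    (\int[P]_(t in X) (f \_ B0) t = \int[P]_(t in X) (Z \_ B0) t)%E.
  move=> [A0 [G0 F0 ->]]; rewrite -!integral_mkcondr setIAC.
  have F1 : Fw w k.-1 (A0 (inr tt) `&` B0).
    exact: (@sigI (Fw w k.-1) _ _ (sigma_of_sigma _ _) F0 FB0).
  rewrite !integral_split//; last 3 first.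
  - exact: Fw_sub_all F1.
  - by move=> B mB; apply: Fw_sub_all; exact: FZ.
  - exact: Fw_sub_all F1.
  by rewrite ZE.
have H := @g_sigma_algebra_measure_unique _ R T (PiSys k.-1) (@PiSys_meas k.-1)
  (fun=> setT) (fun=> PiSysT k.-1) _ (density_measure P mfB) (density_measure P mZB)
  (@PiSysI k.-1).
have E : (\int[P]_(t in A) (f \_ B0) t = \int[P]_(t in A) (Z \_ B0) t)%E.
  apply: H => //.
  - by rewrite bigcup_const.
  - move=> _; rewrite /= /density_measure key; last exact: PiSysT.
    apply: (@le_lt_trans _ _ (\int[P]_(t in setT) (cst (Num.max M 0)%:E) t)%E).
      by apply: ge0_le_integral.
    rewrite integral_cst//; apply: lte_mul_pinfty => //.
      by rewrite lee_fin le_max lexx orbT.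
    by apply: (le_lt_trans (probability_le1 P measurableT)); exact: ltry.
have AB : A `<=` B0 by move=> t /AM; rewrite /B0 /= in_itv.
have -> : (\int[P]_(t in A) f t = \int[P]_(t in A) (f \_ B0) t)%E.
  by apply: eq_integral => t; rewrite inE => /AB h; rewrite /patch mem_set.
rewrite E.
apply: (@le_trans _ _ (\int[P]_(t in A) (cst M%:E) t)%E).
  apply: ge0_le_integral => //; first exact: measurable_funTS.
  by move=> t At; rewrite /patch mem_set; [exact: AM|exact: AB].
by rewrite integral_cst.
Qed.

End Noise.

(** * Tail of the Laplace law *)

Section LaplaceTail.
Variable R : realType.
Notation mu := (@lebesgue_measure R).

Lemma lap_density_continuous : continuous (@lap_density R).
Proof.
move=> x; apply: cvgM; last exact: cvg_cst.
apply: continuous_comp; last exact: continuous_expR.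
by apply: cvgN; exact: norm_continuous.
Qed.

Lemma lap_density_ge0 (x : R) : 0 <= lap_density x.
Proof. by rewrite divr_ge0// expR_ge0. Qed.

Lemma lap_density_measurable (D : set R) : measurable_fun D (EFin \o @lap_density R).
Proof.
apply/measurable_EFinP; apply: measurable_funTS.
exact: continuous_measurable_fun lap_density_continuous.
Qed.

Lemma is_derive_expRN (x : R) :
  is_derive x (1 : R) (fun x : R => - (expR (- x) / 2)) (expR (- x) / 2).
Proof.
have h : is_derive x (1 : R) (fun x : R => expR (- x)) (- expR (- x)).
  by apply: is_derive_eq; rewrite mulrN1.
have := @is_deriveZ _ _ _ _ (- 2^-1) x (1 : R) _ h.
rewrite /GRing.scale/=; congr is_derive; last by rewrite mulrNN mulrC.
by apply/funext => y /=; rewrite /GRing.scale/= mulNr mulrC.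
Qed.

Lemma is_derive_expR2 (x : R) :
  is_derive x (1 : R) (fun x : R => expR x / 2) (expR x / 2).
Proof.
have := @is_deriveZ _ _ _ _ (2^-1) x (1 : R) _ (is_derive_expR x).
rewrite /GRing.scale/=; congr is_derive; last by rewrite mulrC.
by apply/funext => y /=; rewrite /GRing.scale/= mulrC.
Qed.

Lemma integral_lap_density_gt (c : R) :
  (\int[mu]_(x in `]c, +oo[) (lap_density x)%:E = (lapF (- c))%:E)%E.
Proof.
have pos (a : R) : 0 <= a ->
    (\int[mu]_(x in `]a, +oo[) (lap_density x)%:E = (expR (- a) / 2)%:E)%E.
  move=> a0; rewrite integral_itv_obnd_cbnd; last exact: lap_density_measurable.
  rewrite (@ge0_continuous_FTC2y _ (@lap_density R) (fun x => - (expR (- x) / 2)) a 0).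
  - by rewrite -EFinB sub0r opprK.
  - by move=> x _; exact: lap_density_ge0.
  - exact: continuous_subspaceT lap_density_continuous.
  - rewrite -oppr0 -(mul0r 2^-1); apply: cvgN; apply: cvgM; last exact: cvg_cst.
    exact: cvgr_expR.
  - by move=> x _; have [] := is_derive_expRN x.
  - apply: cvg_at_right_filter; apply: cvgN; apply: cvgM; last exact: cvg_cst.
    by apply: continuous_comp; [exact: opp_continuous|exact: continuous_expR].
  - move=> x; rewrite in_itv /= andbT => ax; rewrite derive1E.
    have [_ ->] := is_derive_expRN x.
    by rewrite /lap_density ger0_norm// (le_trans a0)// ltW.
have [c0|c0] := leP 0 c.
  rewrite pos//; congr EFin; rewrite /lapF oppr_lt0; case: ltP => // c0'.
  by have -> : c = 0; [apply/eqP; rewrite eq_le c0 c0'|rewrite !oppr0 expR0; lra].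
have -> : `]c, +oo[%classic = `]c, 0%R] `|` `]0%R, +oo[ :> set R.
  by rewrite -itv_bndbnd_setU// bnd_simp// ltW.
rewrite ge0_integral_setU//=; last 3 first.
- exact: lap_density_measurable.
- by move=> x _; rewrite lee_fin lap_density_ge0.
- apply: lt_disjoint => x y; rewrite !in_itv/= andbT => /andP[_ h1]; exact: le_lt_trans.
rewrite pos// oppr0 expR0 integral_itv_obnd_cbnd; last exact: lap_density_measurable.
rewrite (@continuous_FTC2 _ (@lap_density R) (fun x => expR x / 2) c 0)//.
- rewrite -EFinB -EFinD; congr EFin; rewrite expR0 /lapF oppr_lt0 ltNge (ltW c0)/= opprK; lra.
- exact: continuous_subspaceT lap_density_continuous.
- have dc (x : R) : {for x, continuous (fun x : R => expR x / 2)}.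
    by apply: cvgM; [exact: continuous_expR|exact: cvg_cst].
  split.
  + by move=> x _; have [] := is_derive_expR2 x.
  + by apply: cvg_at_right_filter; exact: dc.
  + by apply: cvg_at_left_filter; exact: dc.
- move=> x; rewrite in_itv /= => /andP[_ x0]; rewrite derive1E.
  have [_ ->] := is_derive_expR2 x.
  by rewrite /lap_density ltr0_norm// opprK.
Qed.

End LaplaceTail.

(** * Mean and variance of a one-bit message *)

Section OneBit.
Context {R : realType} {d : measure_display} {T : measurableType d}.
Variable P : probability T R.
Variable G : set (set T).
Hypothesis G_meas : <<s G >> `<=` measurable.
Local Notation TG := (g_sigma_algebraType G).
Variable Y : T -> R.
Hypothesis mY : measurable_fun setT Y.
Hypothesis indep : forall A (B : set R), <<s G >> A -> measurable B ->
  P (A `&` Y @^-1` B) = (P A * P (Y @^-1` B))%E.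
Hypothesis Y_lap : forall B : set R, measurable B ->
  P (Y @^-1` B) = (\int[lebesgue_measure]_(x in B) (lap_density x)%:E)%E.

Lemma laplace_gt (c : R) : P (Y @^-1` `]c, +oo[) = (lapF (- c))%:E.
Proof. by rewrite Y_lap// integral_lap_density_gt. Qed.

Lemma laplace_lt (c : R) : P (Y @^-1` `]-oo, c[) = (lapF c)%:E.
Proof.
have -> : `]-oo, c[%classic = ~` `[c, +oo[%classic :> set R by rewrite setCitvr.
have mc : measurable (Y @^-1` `[c, +oo[) by exact: preimage_measurable.
have E : P (Y @^-1` `[c, +oo[) = (lapF (- c))%:E.
  rewrite Y_lap// -integral_itv_obnd_cbnd; last exact: lap_density_measurable.
  exact: integral_lap_density_gt.
by rewrite preimage_setC probability_setC// [P _]E lapFN -EFinB opprB addrC subrK.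
Qed.

Variables (X : T -> R) (A : set T) (b C : R).
Hypothesis mX : measurable_fun [set: TG] X.
Hypothesis GA : <<s G >> A.
Hypothesis b_gt0 : 0 < b.
Hypothesis C_ge0 : 0 <= C.

Let mA : measurable A. Proof. exact: G_meas. Qed.

Let mXT : measurable_fun setT X.
Proof. exact: (gsigma_measurable_fun G_meas). Qed.

(** Freezing [X] at the value [x] reduces the event to the half-line [I x] for [Y]. *)
Let freeze_half (I : R -> set R) (g : R -> R) (h : R -> bool) :
  measurable_fun [set: TG * R] (fun p : TG * R => h (X p.1 + b * p.2)) ->
  (forall x, [set y | h (x + b * y)] = I x) ->
  (forall x, P (Y @^-1` I x) = (g x)%:E) ->
  P (A `&` [set t | h (X t + b * Y t)]) = (\int[P]_(t in A) (g (X t))%:E)%E.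
Proof.
move=> mh hI Ig.
pose E : set (TG * R) := [set p | A p.1 /\ h (X p.1 + b * p.2)].
have mE : measurable E.
  have -> : E = (fst @^-1` A) `&` ((fun p : TG * R => h (X p.1 + b * p.2)) @^-1` [set true]).
    by apply/seteqP; split.
  apply: measurableI.
    by rewrite -[X in measurable X]setTI; apply: measurable_fst.
  by rewrite -[X in measurable X]setTI; exact: mh.
have := freezing G_meas mY indep mE; rewrite [X in P X](_ : _ = A `&` [set t | h (X t + b * Y t)]).
  move=> ->; rewrite [RHS]integral_mkcond; apply: eq_integral => t _.
  rewrite /patch; case: ifPn.
    rewrite inE => At; rewrite -Ig -hI; congr (P _); apply/seteqP; split => s /=.
      by rewrite /xsection/= inE => -[].
    by rewrite /xsection/= inE.
  rewrite notin_setE => At; rewrite (_ : Y @^-1` _ = set0) ?measure0//.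
  by apply/seteqP; split => s //=; rewrite /xsection /= inE => -[].
by apply/seteqP; split.
Qed.

Let mXY : measurable_fun [set: TG * R] (fun p : TG * R => X p.1 + b * p.2).
Proof.
apply: measurable_funD; first exact: (measurableT_comp mX measurable_fst).
by apply: measurable_funM => //; exact: measurable_snd.
Qed.

Lemma onebit_gt :
  P (A `&` [set t | C < X t + b * Y t]) = (\int[P]_(t in A) (lapF ((X t - C) / b))%:E)%E.
Proof.
apply: (@freeze_half (fun x => [set` `](C - x) / b, +oo[ ]) (fun x => lapF ((x - C) / b))
   (fun z => C < z)).
- exact: measurable_fun_ltr.
- move=> x; apply/seteqP; split => y /=; rewrite in_itv /= andbT ltr_pdivrMr// mulrC; lra.
- by move=> x; rewrite laplace_gt -mulNr opprB.
Qed.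

Lemma onebit_lt :
  P (A `&` [set t | X t + b * Y t < - C]) = (\int[P]_(t in A) (lapF ((- X t - C) / b))%:E)%E.
Proof.
apply: (@freeze_half (fun x => [set` `]-oo, (- x - C) / b[ ]) (fun x => lapF ((- x - C) / b))
   (fun z => z < - C)).
- exact: measurable_fun_ltr.
- move=> x; apply/seteqP; split => y /=; rewrite in_itv /= ltr_pdivlMr// mulrC; lra.
- by move=> x; rewrite laplace_lt.
Qed.

Definition onebit (z : R) : R := if C < `|z| then (if 0 < z then 1 else -1) else 0.

(** [0 <= C] makes the events [C < z] and [z < - C] disjoint. *)
Lemma onebitE z : onebit z = (C < z)%R%:R - (z < - C)%R%:R.
Proof.
rewrite /onebit real_ltr_normr ?num_real// ltrNr.
case: (ltP C z) => h1; case: (ltP z (- C)) => h2; case: (ltP 0 z) => h3 //=; try lra.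
all: by have := lt_trans h1 h2; rewrite ltNge (le_trans _ C_ge0)// oppr_le0.
Qed.

Local Notation V := (fun t => onebit (X t + b * Y t)).
Local Notation pp := (fun t => lapF ((X t - C) / b)).
Local Notation pm := (fun t => lapF ((- X t - C) / b)).

Let mz : measurable_fun setT (fun t => X t + b * Y t).
Proof. by apply: measurable_funD => //; apply: measurable_funM. Qed.

Lemma onebit_measurable : measurable_fun setT onebit.
Proof.
have -> : onebit = (fun z => if C < z then (if z < - C then 0 else 1)
                             else (if z < - C then -1 else 0)).
  apply/funext => z; rewrite onebitE; case: ltP => h1; case: ltP => h2 /=; lra.
have mb : measurable_fun setT (fun z : R => z < - C) by exact: measurable_fun_ltr.
by apply: measurable_fun_ifT; [exact: measurable_fun_ltr|apply: measurable_fun_ifT..].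
Qed.

Let mV : measurable_fun setT V.
Proof. exact: (measurableT_comp onebit_measurable mz). Qed.

Let bint (f : T -> R) (K : R) : measurable_fun setT f -> (forall t, `|f t| <= K) ->
  P.-integrable A (EFin \o f).
Proof.
move=> mf fK; apply: (@rintegrable_le _ _ _ P A mA _ (cst K)) => //.
- exact: measurable_funTS.
- apply: rintegrable_cst => //.
  by apply: (le_lt_trans (probability_le1 P mA)); exact: ltry.
Qed.

Let lapFm (f : T -> R) : measurable_fun setT f -> measurable_fun setT (fun t => lapF (f t)).
Proof. move=> mf; exact: (measurableT_comp (@measurable_lapF R) mf). Qed.

Let mpp : measurable_fun setT pp.
Proof. by apply: lapFm; apply: measurable_funM => //; apply: measurable_funB. Qed.

Let mpm : measurable_fun setT pm.
Proof.
apply: lapFm; apply: measurable_funM => //; apply: measurable_funB => //.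
exact: measurableT_comp.
Qed.

Let lapF_norm (x : R) : `|lapF x| <= 1.
Proof. by rewrite ger0_norm ?lapF_le1 ?lapF_ge0. Qed.

Let ipp : P.-integrable A (EFin \o pp). Proof. exact: (bint (K := 1)). Qed.
Let ipm : P.-integrable A (EFin \o pm). Proof. exact: (bint (K := 1)). Qed.

Let ind (h : R -> bool) := fun t => (h (X t + b * Y t))%:R : R.

Let mind (h : R -> bool) : measurable_fun setT h -> measurable_fun setT (ind h).
Proof.
move=> mh; have -> : ind h = fun t => if h (X t + b * Y t) then 1 else 0.
  by apply/funext => t; rewrite /ind; case: (h _).
by apply: measurable_fun_ifT => //; exact: (measurableT_comp mh mz).
Qed.

Let indE (h : R -> bool) : measurable_fun setT h ->
  \int[P]_(t in A) ind h t = fine (P (A `&` [set t | h (X t + b * Y t)])).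
Proof.
move=> mh; have mS : measurable [set t | h (X t + b * Y t)].
  rewrite (_ : [set t | _] = (fun t => h (X t + b * Y t)) @^-1` [set true])//.
  rewrite -[X in measurable X]setTI.
  by have := measurableT_comp mh mz; apply.
rewrite /Rintegral; congr fine.
rewrite (_ : (fun t => (ind h t)%:E) = (fun t => (\1_[set t | h (X t + b * Y t)] t)%:E)).
  by rewrite integral_indic// setIC.
apply/funext => t; rewrite /ind indicE; congr (_%:R)%:E.
by case E: (h _); [rewrite mem_set|rewrite memNset//= E].
Qed.

Let mgt : measurable_fun setT (fun z : R => C < z).
Proof. exact: measurable_fun_ltr. Qed.
Let mlt : measurable_fun setT (fun z : R => z < - C).
Proof. exact: measurable_fun_ltr. Qed.

Let iind (h : R -> bool) : measurable_fun setT h -> P.-integrable A (EFin \o ind h).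
Proof.
move=> mh; apply: (@bint _ 1); first exact: mind.
by move=> t; rewrite /ind; case: (h _); rewrite ?normr1 ?normr0.
Qed.

Lemma onebit_mean :
  \int[P]_(t in A) V t = \int[P]_(t in A) (pp t - pm t).
Proof.
rewrite (@eq_Rintegral _ _ _ P A (fun t => ind (fun z => C < z) t - ind (fun z => z < - C) t)).
  rewrite !RintegralB//; [|exact: iind|exact: iind].
  by rewrite !indE// onebit_gt onebit_lt.
by move=> t _; rewrite onebitE.
Qed.

(** From [(V - g)^2 <= 2 V^2 + 2 g^2] with [g = pp - pm]: [V^2] is the indicator of sending, of
    conditional probability [pp + pm], and [g^2 <= pp + pm] because both lie in [[0, 1]]. The
    variance is thus of the order of the sending probability. *)
Lemma onebit_var :
  \int[P]_(t in A) (V t - (pp t - pm t)) ^+ 2 <= 4 * \int[P]_(t in A) (pp t + pm t).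
Proof.
pose sq t := 2 * (ind (fun z => C < z) t + ind (fun z => z < - C) t) + 2 * (pp t + pm t).
have ipq : P.-integrable A (EFin \o (fun t => pp t + pm t)) by exact: rintegrableD.
have iiq : P.-integrable A
    (EFin \o (fun t => ind (fun z => C < z) t + ind (fun z => z < - C) t)).
  by apply: rintegrableD => //; exact: iind.
apply: (@le_trans _ _ (\int[P]_(t in A) sq t)).
  apply: le_Rintegral => //.
  - apply: (@bint _ 9).
      by apply: measurable_funX; apply: measurable_funB => //; apply: measurable_funB.
    move=> t; rewrite ger0_norm ?sqr_ge0// onebitE.
    have := lapF_ge0 ((X t - C) / b); have := lapF_ge0 ((- X t - C) / b).
    have := lapF_le1 ((X t - C) / b); have := lapF_le1 ((- X t - C) / b).
    move: (lapF _) (lapF _) => u v u1 v1 u0 v0.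
    by case: (C < _); case: (_ < - C); rewrite /=; nra.
  - by apply: rintegrableD => //; apply: rintegrableZ.
  move=> t _; rewrite onebitE /sq /ind.
  have := lapF_ge0 ((X t - C) / b); have := lapF_ge0 ((- X t - C) / b).
  have := lapF_le1 ((X t - C) / b); have := lapF_le1 ((- X t - C) / b).
  move: (lapF _) (lapF _) => u v u1 v1 u0 v0.
  by case: (C < _); case: (_ < - C); rewrite /=; nra.
have E : \int[P]_(t in A) (ind (fun z => C < z) t + ind (fun z => z < - C) t) =
    \int[P]_(t in A) (pp t + pm t).
  rewrite !RintegralD//; [|exact: iind|exact: iind].
  by rewrite !indE// onebit_gt onebit_lt.
have -> : \int[P]_(t in A) sq t =
    2 * \int[P]_(t in A) (ind (fun z => C < z) t + ind (fun z => z < - C) t) +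
    2 * \int[P]_(t in A) (pp t + pm t).
  rewrite -(RintegralZl _ mA iiq) -(RintegralZl _ mA ipq) -RintegralD//.
    exact: (rintegrableZ mA 2 iiq).
  exact: (rintegrableZ mA 2 ipq).
by rewrite E -mulrDl -natrD.
Qed.

End OneBit.

(** * Inequalities for real powers *)

Section ScalarPower.
Variable R : realType.
Implicit Types x y u s r q : R.

(** Convexity of the exponential between [ln (1 + s)] and 0, with weights [q] and [1 - q]. *)
Lemma bernoulli_le s q : 0 <= q <= 1 -> -1 <= s -> (1 + s) `^ q <= 1 + q * s.
Proof.
move=> /andP[q0 q1] s1; have s0 : 0 <= 1 + s by lra.
move: s0; rewrite le_eqVlt => /predU1P[s0|s0].
  rewrite -s0; have -> : s = -1 by lra.
  have [->|qn0] := eqVneq q 0; first by rewrite powRr0; lra.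
  by rewrite powR0//; lra.
rewrite /powR gt_eqF//.
have := @convex_expR R (Itv01 q0 q1) (ln (1 + s)) 0.
rewrite !convRE/= expR0 lnK ?posrE// mulr0 addr0.
by rewrite /unstable.onem; lra.
Qed.

Lemma powR_le_pow2 x r : 1 <= r <= 2 -> 1 <= x -> x `^ r <= x ^+ 2.
Proof. by move=> /andP[r1 r2] x1; rewrite -powR_mulrn ?ler_powR//; lra. Qed.

Lemma powRD_le x y r : 1 <= r <= 2 -> 0 <= x -> 0 <= y ->
  (x + y) `^ r <= 4 * (x `^ r + y `^ r).
Proof.
move=> r12 x0 y0; wlog xy : x y x0 y0 / x <= y.
  by move=> H; have [/H|/ltW/H] := leP x y; [apply|rewrite addrC [x `^ r + _]addrC; apply].
have r0 : 0 <= r by lra.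
apply: (@le_trans _ _ ((2 * y) `^ r)).
  by rewrite ge0_ler_powR ?nnegrE//; lra.
rewrite powRM//; have : 2 `^ r <= 2 ^+ 2 :> R by apply: powR_le_pow2 => //; lra.
have := powR_ge0 x r; have := powR_ge0 y r.
move: (x `^ r) (y `^ r) (2 `^ r) => a b c; nra.
Qed.

Lemma powR_sum_le (I : Type) (l : seq I) (F : I -> R) r : 1 <= r <= 2 ->
  (forall i, 0 <= F i) ->
  (\sum_(i <- l) F i) `^ r <= 4 ^+ size l * \sum_(i <- l) F i `^ r.
Proof.
move=> r12 F0; elim: l => [|i l IH].
  by rewrite !big_nil mulr0 powR0// gt_eqF//; lra.
rewrite !big_cons /= exprS; apply: le_trans (powRD_le r12 (F0 i) _) _.
  exact: sumr_ge0.
have := powR_ge0 (F i) r.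
have : 1 <= 4 ^+ size l :> R by apply: exprn_ege1; lra.
move: (F i `^ r) (_ `^ r) (4 ^+ _) (\sum_(j <- l) _) IH => a b c S; nra.
Qed.

(** With [s = y / u], one has [(1 + s)^r = (1 + s) (1 + s)^(r-1)], and Bernoulli's inequality
    applies to the exponent [r - 1 <= 1]. Unlike a Taylor expansion, this holds down to [s = -1]. *)
Lemma powR_second_order u y r : 1 < r <= 2 -> 0 < u -> 0 <= u + y ->
  (u + y) `^ r <= u `^ r + u `^ (r - 1) * (r * y + (r - 1) * (y ^+ 2 / u)).
Proof.
move=> /andP[r1 r2] u0 uy0; set s := y / u.
have yE : y = u * s by rewrite /s mulrC divfK// gt_eqF.
have s1 : 0 <= 1 + s.
  by move: uy0; rewrite yE -{1}(mulr1 u) -mulrDr pmulr_rge0.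
have -> : u + y = u * (1 + s) by rewrite mulrDr mulr1 -yE.
have ur : u `^ r = u `^ (r - 1) * u.
  by rewrite mulrC mulr_powRB1//; lra.
have sr : (1 + s) `^ r <= (1 + s) * (1 + (r - 1) * s).
  move: s1; rewrite le_eqVlt => /predU1P[<-|s1].
    by rewrite mul0r powR0// gt_eqF//; lra.
  have -> : (1 + s) `^ r = (1 + s) * (1 + s) `^ (r - 1).
    by rewrite mulr_powRB1//; lra.
  by rewrite ler_pM2l// bernoulli_le//; lra.
rewrite powRM//; last by lra.
have -> : y ^+ 2 / u = u * s ^+ 2.
  by rewrite yE; field; rewrite gt_eqF.
rewrite yE ur; have := powR_ge0 u (r - 1).
move: (u `^ (r - 1)) ((1 + s) `^ r) sr => a b sr a0.
have : 0 <= a * u * ((1 + s) * (1 + (r - 1) * s) - b).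
  by rewrite mulr_ge0 ?subr_ge0// mulr_ge0// ltW.
nra.
Qed.

End ScalarPower.

(** * Positive semidefinite forms and their powers *)

Section PsdForms.
Variables (R : realType) (E : lmodType R).
Implicit Types (B : E -> E -> R) (x y z : E).

Definition psd_form B : Prop :=
  [/\ forall x y, B x y = B y x,
      forall c x y z, B (c *: x + y) z = c * B x z + B y z &
      forall x, 0 <= B x x].

Lemma psd_ge0 B x : psd_form B -> 0 <= B x x.
Proof. by case. Qed.

Lemma psd0 B z : psd_form B -> B 0 z = 0.
Proof.
case=> _ lB _; have := lB 1 0 0 z; rewrite scale1r addr0 mul1r => h.
by apply/eqP; rewrite -(subrr (B 0 z)) {2}h addrK.
Qed.

Lemma psd_addl B x y z : psd_form B -> B (x + y) z = B x z + B y z.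
Proof. by case=> _ lB _; have := lB 1 x y z; rewrite scale1r mul1r. Qed.

Lemma psd_scalel B c x z : psd_form B -> B (c *: x) z = c * B x z.
Proof.
by move=> pB; case: (pB) => _ lB _; have := lB c x 0 z; rewrite !addr0 psd0// addr0.
Qed.

Lemma psd_addr B x y z : psd_form B -> B z (x + y) = B z x + B z y.
Proof. by move=> pB; case: (pB) => sB _ _; rewrite !(sB z) psd_addl. Qed.

Lemma psd_scaler B c x z : psd_form B -> B z (c *: x) = c * B z x.
Proof. by move=> pB; case: (pB) => sB _ _; rewrite !(sB z) psd_scalel. Qed.

Lemma psd_sumr B (I : Type) (l : seq I) (F : I -> E) z : psd_form B ->
  B z (\sum_(i <- l) F i) = \sum_(i <- l) B z (F i).
Proof.
move=> pB; elim: l => [|i l IH]; last by rewrite !big_cons psd_addr// IH.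
by case: (pB) => sB _ _; rewrite !big_nil sB psd0.
Qed.

Lemma psd_sqrD B x y : psd_form B -> B (x + y) (x + y) = B x x + 2 * B x y + B y y.
Proof.
move=> pB; case: (pB) => sB _ _.
by rewrite psd_addl// !psd_addr// (sB y x); lra.
Qed.

Lemma psd_cauchy B x y : psd_form B -> B x y ^+ 2 <= B x x * B y y.
Proof.
move=> pB; case: (pB) => sB _ B0.
have H s : 0 <= s ^+ 2 * B x x + 2 * s * B x y + B y y.
  have := B0 (s *: x + y).
  by rewrite psd_sqrD// !psd_scalel// psd_scaler// expr2 !mulrA.
have := B0 x; rewrite le_eqVlt => /predU1P[x0|x0]; last first.
  have := H (- B x y / B x x).
  have -> : (- B x y / B x x) ^+ 2 * B x x + 2 * (- B x y / B x x) * B x y + B y y =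
    B y y - B x y ^+ 2 / B x x by field; rewrite gt_eqF.
  by rewrite subr_ge0 ler_pdivrMr// mulrC.
rewrite -x0 mul0r; have [->|n0] := eqVneq (B x y) 0; first by rewrite expr0n.
(* With [B x x = 0] the polynomial in [s] is affine; at this point it takes the value [-1]. *)
have := H (- (B y y + 1) / (2 * B x y)); rewrite -x0 mulr0 add0r.
have -> : 2 * (- (B y y + 1) / (2 * B x y)) * B x y = - (B y y + 1) by field.
lra.
Qed.

Lemma psd_sqrD_le B x y : psd_form B -> B (x + y) (x + y) <= 2 * (B x x + B y y).
Proof.
move=> pB; have := psd_ge0 (x + (-1) *: y) pB.
by rewrite !psd_sqrD// !psd_scaler// psd_scalel//; lra.
Qed.

Lemma psd_sum_le B (I : Type) (l : seq I) (F : I -> E) : psd_form B ->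
  B (\sum_(i <- l) F i) (\sum_(i <- l) F i) <= 2 ^+ size l * \sum_(i <- l) B (F i) (F i).
Proof.
move=> pB; elim: l => [|i l IH]; first by rewrite !big_nil psd0// mulr0.
rewrite !big_cons /= exprS; apply: le_trans (psd_sqrD_le _ _ pB) _.
have := psd_ge0 (F i) pB.
have : 1 <= 2 ^+ size l :> R by apply: exprn_ege1; lra.
move: (2 ^+ size l) IH => c; nra.
Qed.

(** If [x] dominates [z], the left side is at most [16 (B x x)^r] and the linear term is at least
    [- 4 (B x x)^r], whence 20. Otherwise the second-order inequality applies with increment
    [2 B z x + B x x], whose square is at most [10 (B x x) (B z z)] by Cauchy-Schwarz. *)
Lemma psd_form_pow B z x r : psd_form B -> 1 < r <= 2 ->
  B (z + x) (z + x) `^ r <= B z z `^ r + 2 * r * B z z `^ (r - 1) * B z x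
    + 20 * (B z z `^ (r - 1) * B x x + B x x `^ r).
Proof.
move=> pB r12; have /andP[r1 r2] := r12.
have r0 : 0 <= r by lra.
have CS := psd_cauchy z x pB.
have u0 := psd_ge0 z pB; have v0 := psd_ge0 x pB; have w0 := psd_ge0 (z + x) pB.
have [xz|zx] := leP (B x x) (B z z); last first.
  have h1 : B (z + x) (z + x) `^ r <= 16 * B x x `^ r.
    apply: (@le_trans _ _ ((4 * B x x) `^ r)).
      rewrite ge0_ler_powR ?nnegrE//; first by lra.
      by have := psd_sqrD_le z x pB; lra.
    rewrite powRM//; apply: ler_wpM2r; first exact: powR_ge0.
    have : 4 `^ r <= 4 ^+ 2 :> R by apply: powR_le_pow2; lra.
    lra.
  have h2 : `|B z x| <= B x x.
    rewrite -(@ler_pXn2r _ 2) ?nnegrE// real_normK ?num_real//.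
    by apply: (le_trans CS); rewrite expr2 ler_wpM2r// ltW.
  have h3 : B z z `^ (r - 1) * `|B z x| <= B x x `^ r.
    have -> : B x x `^ r = B x x `^ (r - 1) * B x x.
      by rewrite mulrC mulr_powRB1//; lra.
    apply: ler_pM => //; first exact: powR_ge0.
    by rewrite ge0_ler_powR ?nnegrE//; [lra|exact: ltW].
  have h4 : - (B z z `^ (r - 1) * `|B z x|) <= B z z `^ (r - 1) * B z x.
    rewrite -mulrN ler_wpM2l ?powR_ge0//; have := ler_norm (- B z x); rewrite normrN; lra.
  have := powR_ge0 (B z z) r; have := powR_ge0 (B z z) (r - 1).
  have := mulr_ge0 (powR_ge0 (B z z) (r - 1)) v0.
  move: (B z z `^ (r - 1) * B x x) h1 h3 h4 => c h1 h3 h4 c0.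
  have b0 := powR_ge0 (B x x) r.
  move: (B z z `^ r) (B x x `^ r) b0 (B (z + x) (z + x) `^ r) h1 h3 h4 => a b b0 e h1 h3 h4 _ a0.
  have -> : 2 * r * B z z `^ (r - 1) * B z x = 2 * r * (B z z `^ (r - 1) * B z x) by rewrite !mulrA.
  move: (B z z `^ (r - 1) * `|B z x|) (B z z `^ (r - 1) * B z x) h3 h4 => f g h3 h4.
  have k1 : 0 <= r * (g + b) by rewrite mulr_ge0//; lra.
  have k2 : 0 <= (2 - r) * b by rewrite mulr_ge0//; lra.
  nra.
move: u0; rewrite le_eqVlt => /predU1P[z0|z0].
  have x0 : B x x = 0 by apply/eqP; rewrite eq_le v0 andbT z0.
  have zx0 : B (z + x) (z + x) = 0.
    by apply/eqP; rewrite eq_le w0 andbT; have := psd_sqrD_le z x pB; lra.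
  rewrite zx0 x0 -z0 !powR0; [|lra..].
  by rewrite !(mulr0, mul0r, addr0).
rewrite psd_sqrD// -addrA; set y := 2 * B z x + B x x.
have uy0 : 0 <= B z z + y by rewrite /y addrA -psd_sqrD.
apply: (le_trans (powR_second_order r12 z0 uy0)).
have y2 : y ^+ 2 / B z z <= 10 * B x x.
  rewrite ler_pdivrMr// /y; have : B x x ^+ 2 <= B x x * B z z by rewrite expr2 ler_wpM2l.
  have := sqr_ge0 (2 * B z x - B x x); nra.
have := powR_ge0 (B z z) (r - 1); have := powR_ge0 (B x x) r.
move: (B z z `^ r) (B x x `^ r) (B z z `^ (r - 1)) => a b c b0 c0.
have : c * (r * y + (r - 1) * (y ^+ 2 / B z z)) <= c * (2 * r * B z x + 20 * B x x).
  apply: ler_wpM2l => //; rewrite /y; have : (r - 1) * (y ^+ 2 / B z z) <= (r - 1) * (10 * B x x).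
    by apply: ler_wpM2l => //; lra.
  rewrite /y; move: (_ / B z z) => e; nra.
lra.
Qed.

Lemma psd_formD B1 B2 : psd_form B1 -> psd_form B2 -> psd_form (fun x y => B1 x y + B2 x y).
Proof.
move=> [s1 l1 p1] [s2 l2 p2]; split => [x y|c x y z|x]; first by rewrite s1 s2.
  by rewrite l1 l2; ring.
by rewrite addr_ge0.
Qed.

Lemma psd_formZ c B : 0 <= c -> psd_form B -> psd_form (fun x y => c * B x y).
Proof.
move=> c0 [s1 l1 p1]; split => [x y|e x y z|x]; first by rewrite s1.
  by rewrite l1; ring.
by rewrite mulr_ge0.
Qed.

Lemma psd_form_sum (I : Type) (l : seq I) (B : I -> E -> E -> R) :
  (forall i, psd_form (B i)) -> psd_form (fun x y => \sum_(i <- l) B i x y).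
Proof.
move=> pB; split => [x y|c x y z|x].
- by apply: eq_bigr => i _; case: (pB i) => ->.
- by rewrite mulr_sumr -big_split/=; apply: eq_bigr => i _; case: (pB i) => _ ->.
- by apply: sumr_ge0 => i _; exact: psd_ge0.
Qed.

Lemma psd_form_sq (f : E -> R) : (forall c x y, f (c *: x + y) = c * f x + f y) ->
  psd_form (fun x y => f x * f y).
Proof.
move=> lf; split => [x y|c x y z|x]; first by rewrite mulrC.
  by rewrite lf; ring.
by rewrite -expr2 sqr_ge0.
Qed.

End PsdForms.

(** * From pathwise contraction to almost sure boundedness of [om k * U k] *)

Section Stage.
Context {R : realType} {d : measure_display} {T : measurableType d}.
Variables (P : probability T R) (E : lmodType R) (J : finType).
Variable G : nat -> set (set T).
Hypothesis G_meas : forall k, <<s G k >> `<=` measurable.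
Hypothesis G_mono : forall k, <<s G k >> `<=` <<s G k.+1 >>.
Variables (e z : nat -> T -> E) (g : J -> nat -> E) (eta : J -> nat -> T -> R).
Hypothesis e_step : forall k t, e k.+1 t = z k t + \sum_q eta q k t *: g q k.
Variable Q : nat -> E -> E -> R.
Hypothesis psdQ : forall k, psd_form (Q k).
Local Notation U k t := (Q k (e k t) (e k t)).
Local Notation Uz k t := (Q k.+1 (z k t) (z k t)).
Hypothesis U_meas : forall k,
  measurable_fun [set: g_sigma_algebraType (G k)] (fun t => U k t).
Hypothesis Uz_meas : forall k,
  measurable_fun [set: g_sigma_algebraType (G k)] (fun t => Uz k t).
Hypothesis Uzg_meas : forall k q,
  measurable_fun [set: g_sigma_algebraType (G k)] (fun t => Q k.+1 (z k t) (g q k)).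
Variable B : nat -> set T.
Hypothesis B_adapted : forall k, <<s G k >> (B k).
Variable rho : nat -> R.
Hypothesis rho_ge0 : forall k, 0 <= rho k.
Hypothesis contract : forall k t, B k t -> Uz k t <= rho k * U k t.
Variable r : R.
Hypothesis r12 : 1 < r <= 2.
Variables (v v' gam : J -> nat -> R).
Hypothesis gam_ge0 : forall q k, 0 <= gam q k.
Hypothesis v_ge0 : forall q k, 0 <= v q k.
Hypothesis g_gam : forall q k, Q k.+1 (g q k) (g q k) <= gam q k.
Hypothesis eta_int : forall q k A, <<s G k >> A -> A `<=` B k ->
  P.-integrable A (EFin \o eta q k).
Hypothesis eta_mean : forall q k A, <<s G k >> A -> A `<=` B k ->
  \int[P]_(t in A) eta q k t = 0.
Hypothesis eta2_int : forall q k A, <<s G k >> A -> A `<=` B k ->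
  P.-integrable A (EFin \o (fun t => eta q k t ^+ 2)).
Hypothesis eta2_bound : forall q k A, <<s G k >> A -> A `<=` B k ->
  \int[P]_(t in A) (eta q k t ^+ 2) <= v q k * fine (P A).
Hypothesis etar_int : forall q k A, <<s G k >> A -> A `<=` B k ->
  P.-integrable A (EFin \o (fun t => (eta q k t ^+ 2) `^ r)).
Hypothesis etar_bound : forall q k A, <<s G k >> A -> A `<=` B k ->
  \int[P]_(t in A) ((eta q k t ^+ 2) `^ r) <= v' q k * fine (P A).
Variable om : nat -> R.
Hypothesis om_gt0 : forall k, 0 < om k.
(** The factor 20 comes from [psd_form_pow]. A sum of [#|J|] noise terms costs [2 ^ #|J|] in the
    form, hence at most [4 ^ #|J|] in its [r]-th power, and another [4 ^ #|J|] for the power of the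
    sum. *)
Let Kn : R := 20 * 16 ^+ #|J|.
Variables (eps : nat -> R) (M : R).
Hypothesis eps_ge0 : forall k, 0 <= eps k.
Hypothesis eps_prod : forall k, \prod_(i < k) (1 + eps i) <= M.
(** Here [y] stands for [om k * U k]. After integration the whole recursion reduces to this
    deterministic inequality, which the choice of [om] has to guarantee. *)
Hypothesis weight_step : forall k y, 0 <= y ->
  (om k.+1 * rho k / om k * y) `^ r
  + Kn * ((om k.+1 * rho k / om k * y) `^ (r - 1) * (om k.+1 * \sum_q gam q k * v q k))
  + Kn * (om k.+1 `^ r * \sum_q gam q k `^ r * v' q k) + 1
  <= (1 + eps k) * (y `^ r + 1).

Let r0 : 0 <= r. Proof. by have := r12; lra. Qed.
Let r10 : 0 <= r - 1. Proof. by have := r12; lra. Qed.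
Let r12' : 1 <= r <= 2. Proof. by have := r12; lra. Qed.
Let r1 : 1 <= r. Proof. by have := r12; lra. Qed.
Let rgt0 : 0 < r. Proof. by have := r12; lra. Qed.
Let D k t := (om k * U k t) `^ r.

Let U_ge0 k t : 0 <= U k t. Proof. exact: psd_ge0. Qed.
Let Uz_ge0 k t : 0 <= Uz k t. Proof. exact: psd_ge0. Qed.
Let Kn_ge : 20 * 2 ^+ #|J| <= Kn.
Proof.
rewrite /Kn ler_pM2l// lerXn2r ?nnegrE//.
by rewrite (_ : (16 : R) = 2 + 14); lra.
Qed.
Let Kn_ge0 : 0 <= Kn. Proof. by rewrite mulr_ge0// exprn_ge0. Qed.

Let D_meas k : measurable_fun [set: g_sigma_algebraType (G k)] (D k).
Proof.
by apply: (measurableT_comp (measurable_powR _)); apply: measurable_funM.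
Qed.

Let noise_form k t :
  Q k.+1 (\sum_q eta q k t *: g q k) (\sum_q eta q k t *: g q k) <=
  2 ^+ #|J| * \sum_q gam q k * eta q k t ^+ 2.
Proof.
have := psd_sum_le (index_enum J) (fun q => eta q k t *: g q k) (psdQ k.+1).
rewrite (_ : size (index_enum J) = #|J|); last by rewrite cardT enumT.
move/le_trans; apply; apply: ler_wpM2l; first by rewrite exprn_ge0.
apply: ler_sum => q _; rewrite (psd_scalel _ _ _ (psdQ _)) (psd_scaler _ _ _ (psdQ _)) mulrA -expr2 mulrC.
by rewrite ler_wpM2r ?sqr_ge0.
Qed.

Let pointwise k t : D k.+1 t <= om k.+1 `^ r * Uz k t `^ r
  + \sum_q (om k.+1 `^ r * (2 * r) * (Uz k t `^ (r - 1) * Q k.+1 (z k t) (g q k))) * eta q k t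
  + \sum_q (Kn * om k.+1 `^ r * gam q k * Uz k t `^ (r - 1)) * eta q k t ^+ 2
  + \sum_q (Kn * om k.+1 `^ r * gam q k `^ r) * (eta q k t ^+ 2) `^ r.
Proof.
rewrite /D powRM//; last exact: ltW.
rewrite e_step; set xi := \sum_q eta q k t *: g q k.
have := @psd_form_pow _ _ (Q k.+1) (z k t) xi r (psdQ _) r12.
rewrite {2}/xi psd_sumr//; move=> H.
have nf := noise_form k t; rewrite -/xi in nf.
have xi0 : 0 <= Q k.+1 xi xi by exact: psd_ge0.
set S2 := \sum_q gam q k * eta q k t ^+ 2 in nf.
have S20 : 0 <= S2 by apply: sumr_ge0 => q _; rewrite mulr_ge0// sqr_ge0.
have h4 : Q k.+1 xi xi `^ r <= 16 ^+ #|J| * \sum_q gam q k `^ r * (eta q k t ^+ 2) `^ r.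
  apply: (@le_trans _ _ ((2 ^+ #|J| * S2) `^ r)).
    by rewrite ge0_ler_powR ?nnegrE// mulr_ge0// exprn_ge0.
  rewrite powRM ?exprn_ge0//.
  have c1 : (2 ^+ #|J|) `^ r <= 4 ^+ #|J| :> R.
    apply: (le_trans (powR_le_pow2 _ _)); first exact: r12'.
      by apply: exprn_ege1; lra.
    by rewrite -exprM mulnC exprM (_ : (2 : R) ^+ 2 = 4)//; lra.
  have c2 : S2 `^ r <= 4 ^+ #|J| * \sum_q gam q k `^ r * (eta q k t ^+ 2) `^ r.
    have := @powR_sum_le R J (index_enum J) (fun q => gam q k * eta q k t ^+ 2) r.
    rewrite (_ : size (index_enum J) = #|J|); last by rewrite cardT enumT.
    move=> /(_ _ _) c2; apply: (le_trans (c2 _ _)); first exact: r12'.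
      by move=> q; rewrite mulr_ge0// sqr_ge0.
    apply: ler_wpM2l; first by rewrite exprn_ge0.
    by apply: ler_sum => q _; rewrite powRM// sqr_ge0.
  rewrite (_ : (16 : R) = 4 * 4); last by lra.
  rewrite exprMn -mulrA; apply: ler_pM => //; exact: powR_ge0.
set a := om k.+1 `^ r; have a0 : 0 <= a by exact: powR_ge0.
apply: (le_trans (ler_wpM2l a0 H)).
set b := Uz k t `^ (r - 1); have b0 : 0 <= b by exact: powR_ge0.
rewrite !mulrDr -!addrA; apply: lerD => //; apply: lerD.
  rewrite le_eqVlt; apply/orP; left; apply/eqP; rewrite !mulr_sumr; apply: eq_bigr => q _.
  rewrite (psd_scaler _ _ _ (psdQ k.+1)); ring.
apply: lerD.
  have -> : \sum_q Kn * a * gam q k * b * eta q k t ^+ 2 = a * b * (Kn * S2).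
    by rewrite /S2 !mulr_sumr; apply: eq_bigr => q _; ring.
  have -> : a * (20 * (b * Q k.+1 xi xi)) = a * b * (20 * Q k.+1 xi xi) by ring.
  apply: ler_wpM2l; first by rewrite mulr_ge0.
  apply: (@le_trans _ _ (20 * (2 ^+ #|J| * S2))); first by rewrite ler_pM2l.
  by rewrite mulrA; apply: ler_wpM2r.
have -> : \sum_q Kn * a * gam q k `^ r * (eta q k t ^+ 2) `^ r =
   a * (20 * (16 ^+ #|J| * \sum_q gam q k `^ r * (eta q k t ^+ 2) `^ r)).
  by rewrite !mulr_sumr; apply: eq_bigr => q _; rewrite /Kn; ring.
by apply: ler_wpM2l => //; rewrite ler_pM2l.
Qed.

Let PA_fin A : measurable A -> (P A < +oo)%E.
Proof. by move=> mA; apply: (le_lt_trans (probability_le1 P mA)); exact: ltry. Qed.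

(** On [A] the value [U k] is bounded, hence so are the adapted coefficients of the noise terms. The
    terms linear in [eta] integrate to 0, and those in [eta ^+ 2] and in its [r]-th power are
    bounded through [v] and [v']. *)
Let step_bound k (L : R) A : <<s G k >> A ->
  A `<=` B k -> A `<=` [set t | D k t <= L] ->
  (\int[P]_(t in A) (D k.+1 t + 1)%:E <=
     (1 + eps k)%:E * \int[P]_(t in A) (D k t + 1)%:E)%E.
Proof.
move=> GA AB AL; have mA : measurable A by exact: (G_meas GA).
have mG := gsigma_measurable_fun (G_meas (k := k)).
have [U1 hU1] : exists U1 : R, forall t, A t -> U k t <= U1.
  exists (Num.max 1 L / om k) => t At; have := AL _ At; rewrite /= => DL.
  rewrite ler_pdivlMr// mulrC; have [y1|y1] := leP (om k * U k t) 1.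
    by rewrite le_max y1.
  rewrite le_max; apply/orP; right; apply: le_trans DL.
  by apply: le1r_powR => //; exact: ltW.
have [U2 hU2] : exists U2 : R, forall t, A t -> Uz k t <= U2.
  exists (rho k * U1) => t At; apply: (le_trans (contract (AB _ At))).
  by rewrite ler_wpM2l// hU1.
pose a := om k.+1 `^ r; have a0 : 0 <= a by exact: powR_ge0.
pose b t := Uz k t `^ (r - 1).
have b0 t : 0 <= b t by exact: powR_ge0.
have mb : measurable_fun [set: g_sigma_algebraType (G k)] b.
  exact: (measurableT_comp (measurable_powR _)).
have bb t : A t -> b t <= Num.max 0 U2 `^ (r - 1).
  move=> At; rewrite ge0_ler_powR ?nnegrE ?le_max ?lexx//.
  by rewrite hU2// orbT.
pose Y q t := a * (2 * r) * (b t * Q k.+1 (z k t) (g q k)).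
have mY q : measurable_fun [set: g_sigma_algebraType (G k)] (Y q).
  by apply: measurable_funM => //; apply: measurable_funM.
have [KY hKY] : exists KY : J -> R, forall q t, A t -> `|Y q t| <= KY q.
  exists (fun q => a * (2 * r) * (Num.max 0 U2 `^ (r - 1) * (1 + Num.max 0 U2 * gam q k))).
  move=> q t At; rewrite /Y normrM ger0_norm ?mulr_ge0//.
  apply: ler_wpM2l; first by rewrite !mulr_ge0.
  rewrite normrM ger0_norm//; apply: ler_pM => //; first exact: bb.
  have CS := psd_cauchy (z k t) (g q k) (psdQ k.+1).
  have : `|Q k.+1 (z k t) (g q k)| <= 1 + Q k.+1 (z k t) (g q k) ^+ 2.
    by rewrite -real_normK ?num_real//; have := sqr_ge0 (`|Q k.+1 (z k t) (g q k)| - 1); nra.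
  move/le_trans; apply; rewrite lerD2l; apply: (le_trans CS).
  apply: ler_pM => //; first exact: psd_ge0.
  by rewrite le_max hU2// orbT.
pose W q t := Kn * a * gam q k * b t.
have mW q : measurable_fun [set: g_sigma_algebraType (G k)] (W q).
  exact: measurable_funM.
have W0 q t : 0 <= W q t by rewrite !mulr_ge0.
have [KW hKW] : exists KW : J -> R, forall q t, A t -> W q t <= KW q.
  exists (fun q => Kn * a * gam q k * Num.max 0 U2 `^ (r - 1)) => q t At.
  by apply: ler_wpM2l; [rewrite !mulr_ge0|exact: bb].
pose c q := Kn * a * gam q k `^ r.
have c0 q : 0 <= c q by rewrite !mulr_ge0// powR_ge0.
pose F0 t := a * Uz k t `^ r.
pose F1 t := \sum_q Y q t * eta q k t.
pose F2 t := \sum_q W q t * eta q k t ^+ 2.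
pose F3 t := \sum_q c q * (eta q k t ^+ 2) `^ r.
have iF0 : P.-integrable A (EFin \o F0).
  apply: (@rintegrable_le _ _ _ P A mA _ (cst (a * Num.max 0 U2 `^ r))).
  - apply: mG => //; apply: measurable_funM => //.
    exact: (measurableT_comp (measurable_powR _)).
  - by apply: rintegrable_cst => //; exact: PA_fin.
  - move=> t At; rewrite ger0_norm ?mulr_ge0 ?powR_ge0//.
    apply: ler_wpM2l => //; rewrite ge0_ler_powR ?nnegrE ?le_max ?lexx//.
    by rewrite hU2// orbT.
have iY q : P.-integrable A (EFin \o (fun t => Y q t * eta q k t)).
  by apply: (@rintegrable_bounded_mul _ _ _ P A mA (KY q));
    [exact: mG|exact: eta_int|exact: hKY].
have iW q : P.-integrable A (EFin \o (fun t => W q t * eta q k t ^+ 2)).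
  apply: (@rintegrable_bounded_mul _ _ _ P A mA (KW q));
    [exact: mG|exact: eta2_int|by move=> t At; rewrite ger0_norm// hKW].
have iC q : P.-integrable A (EFin \o (fun t => c q * (eta q k t ^+ 2) `^ r)).
  by apply: rintegrableZ => //; exact: etar_int.
have iF1 : P.-integrable A (EFin \o F1) by exact: rintegrable_sum.
have iF2 : P.-integrable A (EFin \o F2) by exact: rintegrable_sum.
have iF3 : P.-integrable A (EFin \o F3) by exact: rintegrable_sum.
have i1 : P.-integrable A (EFin \o (cst 1 : T -> R)).
  by apply: rintegrable_cst => //; exact: PA_fin.
have mDA k' : measurable_fun A (D k').
  by apply: (gsigma_measurable_fun (G_meas (k := k'))).
have iDk : P.-integrable A (EFin \o (fun t => D k t + 1)).
  apply: rintegrableD => //; apply: (@rintegrable_le _ _ _ P A mA _ (cst L)) => //.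
    by apply: rintegrable_cst => //; exact: PA_fin.
  by move=> t At; rewrite ger0_norm ?powR_ge0//; exact: AL.
have iF : P.-integrable A (EFin \o (fun t => F0 t + F1 t + F2 t + F3 t)).
  by do 3 apply: rintegrableD => //.
have iDS : P.-integrable A (EFin \o (fun t => D k.+1 t + 1)).
  apply: rintegrableD => //; apply: (@rintegrable_le _ _ _ P A mA _ _ _ iF) => //.
  by move=> t At; rewrite ger0_norm ?powR_ge0//; exact: pointwise.
have W2 q : \int[P]_(t in A) (W q t * eta q k t ^+ 2) <= v q k * \int[P]_(t in A) W q t.
  have iW1 : P.-integrable A (EFin \o W q).
    apply: (@rintegrable_le _ _ _ P A mA _ (cst (KW q))); first exact: mG.
      by apply: rintegrable_cst => //; exact: PA_fin.
    by move=> t At; rewrite ger0_norm// hKW.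
  have iv C : measurable C -> P.-integrable C (EFin \o (cst (v q k) : T -> R)).
    by move=> mC; apply: rintegrable_cst => //; exact: PA_fin.
  have H : \int[P]_(t in A) (W q t * (eta q k t ^+ 2 - v q k)) <= 0.
    apply: (@integral_mul_le0 _ _ _ P (G k) (G_meas (k := k)) A _ (W q) (KW q)) => //.
    - have := rintegrableD mA (eta2_int q GA AB) (rintegrableZ mA (-1) (iv _ mA)).
      by apply: eq_integrable => // t _ /=; rewrite mulN1r.
    - move=> C GC CA; have mC : measurable C by exact: (G_meas GC).
      have CB : C `<=` B k by move=> t /CA /AB.
      rewrite RintegralB//; [|exact: eta2_int|exact: iv].
      rewrite Rintegral_cst// subr_le0; exact: eta2_bound.
    - by move=> t At; rewrite W0 hKW.
  have := H; under eq_Rintegral do rewrite mulrBr.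
  rewrite RintegralB//; last first.
    by have := rintegrableZ mA (v q k) iW1; apply: eq_integrable => // t _ /=; rewrite mulrC.
  by rewrite RintegralZr// subr_le0 mulrC.
have Y1 q : \int[P]_(t in A) (Y q t * eta q k t) = 0.
  apply: (@integral_mul_eq0 _ _ _ P (G k) (G_meas (k := k)) A _ (Y q) (KY q)) => //.
  - exact: eta_int.
  - by move=> C GC CA; apply: eta_mean => // t /CA /AB.
  - exact: hKY.
pose H3 := \sum_q c q * v' q k.
pose H2 t := \sum_q v q k * W q t.
have iWv q : P.-integrable A (EFin \o (fun t => v q k * W q t)).
  apply: rintegrableZ => //.
  apply: (@rintegrable_le _ _ _ P A mA _ (cst (KW q))); first exact: mG.
    by apply: rintegrable_cst => //; exact: PA_fin.
  by move=> t At; rewrite ger0_norm// hKW.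
have iH2 : P.-integrable A (EFin \o H2) by exact: rintegrable_sum.
have iH3 : P.-integrable A (EFin \o (cst (H3 + 1) : T -> R)).
  by apply: rintegrable_cst => //; exact: PA_fin.
have main : \int[P]_(t in A) (D k.+1 t + 1) <= (1 + eps k) * \int[P]_(t in A) (D k t + 1).
  apply: (@le_trans _ _ (\int[P]_(t in A) (F0 t + F1 t + F2 t + F3 t + 1))).
    apply: le_Rintegral => //; first exact: rintegrableD.
    by move=> t At; rewrite lerD2r; exact: pointwise.
  have -> : \int[P]_(t in A) (F0 t + F1 t + F2 t + F3 t + 1) =
     \int[P]_(t in A) F0 t + \int[P]_(t in A) F1 t + \int[P]_(t in A) F2 t
     + \int[P]_(t in A) F3 t + fine (P A).
    rewrite RintegralD// [in LHS]Rintegral_cst// mul1r; congr (_ + _).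
    rewrite RintegralD//; last by do 2 apply: rintegrableD => //.
    congr (_ + _); rewrite RintegralD//; last exact: rintegrableD.
    by congr (_ + _); rewrite RintegralD.
  have -> : \int[P]_(t in A) F1 t = 0.
    by rewrite /F1 Rintegral_sum// big1.
  have F2le : \int[P]_(t in A) F2 t <= \int[P]_(t in A) H2 t.
    rewrite /F2 /H2 !Rintegral_sum//; apply: ler_sum => q _.
    apply: (le_trans (W2 q)); rewrite RintegralZl//.
    apply: (@rintegrable_le _ _ _ P A mA _ (cst (KW q))); first exact: mG.
      by apply: rintegrable_cst => //; exact: PA_fin.
    by move=> t At; rewrite ger0_norm// hKW.
  have F3le : \int[P]_(t in A) F3 t <= H3 * fine (P A).
    rewrite /F3 Rintegral_sum// /H3 mulr_suml; apply: ler_sum => q _.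
    rewrite RintegralZl//; last exact: etar_int.
    by rewrite -mulrA; apply: ler_wpM2l => //; exact: etar_bound.
  apply: (@le_trans _ _ (\int[P]_(t in A) (F0 t + H2 t + (H3 + 1)))).
    rewrite RintegralD//; last exact: rintegrableD.
    by rewrite RintegralD// Rintegral_cst//; lra.
  rewrite -RintegralZl//; apply: le_Rintegral => //.
  - by do 2 apply: rintegrableD => //.
  - exact: rintegrableZ.
  move=> t At; set y := om k * U k t.
  have y0 : 0 <= y by rewrite mulr_ge0// ltW.
  apply: le_trans (weight_step k y0).
  have Ry : om k.+1 * Uz k t <= om k.+1 * rho k / om k * y.
    rewrite /y mulrA divfK ?gt_eqF// -mulrA ler_pM2l//.
    by apply: contract; exact: AB.
  have Ry0 : 0 <= om k.+1 * Uz k t by rewrite mulr_ge0// ltW.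
  have R0 : 0 <= om k.+1 * rho k / om k * y by apply: le_trans Ry.
  rewrite [leLHS]addrA; apply: lerD => //; apply: lerD.
    apply: lerD.
      rewrite /F0 /a -powRM//; last exact: ltW.
      by rewrite ge0_ler_powR ?nnegrE.
    have -> : H2 t = Kn * ((om k.+1 * Uz k t) `^ (r - 1) * (om k.+1 * \sum_q gam q k * v q k)).
      rewrite powRM//; last exact: ltW.
      rewrite mulrA mulrCA mulrA; set S := \sum_q gam q k * v q k.
      have -> : H2 t = Kn * a * b t * S.
        by rewrite /H2 /S mulr_sumr; apply: eq_bigr => q _; rewrite /W; ring.
      have -> : a = om k.+1 * om k.+1 `^ (r - 1).
        by rewrite mulr_powRB1// ltW.
      rewrite /b; ring.
    apply: ler_wpM2l => //; apply: ler_wpM2r.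
      rewrite mulr_ge0 ?(ltW (om_gt0 _))//.
      by apply: sumr_ge0 => q _; rewrite mulr_ge0.
    by rewrite ge0_ler_powR ?nnegrE.
  rewrite le_eqVlt; apply/orP; left; apply/eqP.
  by rewrite /H3 !mulr_sumr; apply: eq_bigr => q _; rewrite /c /a; ring.
have EF f : P.-integrable A (EFin \o f) ->
    (\int[P]_(t in A) (f t)%:E = (\int[P]_(t in A) f t)%:E)%E.
  by move=> fi; rewrite /Rintegral fineK//; exact: integrable_fin_num.
by rewrite !EF// -EFinM lee_fin.
Qed.

Lemma stage_bounded :
  {ae P, forall t, (forall k, B k t) -> exists C : R, forall k, om k * U k t <= C}.
Proof.
have D0 k t : 0 <= D k t by exact: powR_ge0.
have := supermartingale_bounded G_meas G_mono D0 D_meas B_adapted eps_ge0 eps_prod step_bound.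
apply: filterS => t H /H [C hC]; exists (Num.max 1 C) => k.
have y0 : 0 <= om k * U k t by rewrite mulr_ge0// ltW.
rewrite le_max; have [//|y1] := leP (om k * U k t) 1.
by apply: le_trans (hC k); rewrite /D le1r_powR ?(ltW y1).
Qed.

End Stage.

(** * Bounded partial sums of power and logarithmic series *)

Section Sums.
Variable R : realType.
Implicit Types (f g : nat -> R).

Definition sum_bounded f := exists S : R, forall n, \sum_(j < n) f j <= S.

Lemma sum_boundedD f g : sum_bounded f -> sum_bounded g ->
  sum_bounded (fun j => f j + g j).
Proof.
move=> [S hS] [S' hS']; exists (S + S') => n; rewrite big_split/=; apply: lerD; [exact: hS|exact: hS'].
Qed.

Lemma sum_boundedZ c f : 0 <= c -> sum_bounded f -> sum_bounded (fun j => c * f j).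
Proof.
by move=> c0 [S hS]; exists (c * S) => n; rewrite -mulr_sumr; apply: ler_wpM2l.
Qed.

Lemma sum_bounded_le f g : (forall j, f j <= g j) -> sum_bounded g -> sum_bounded f.
Proof.
by move=> fg [S hS]; exists S => n; apply: le_trans (hS n); exact: ler_sum.
Qed.

Lemma sum_bounded_telescope f (u : nat -> R) : (forall j, 0 <= u j) ->
  (forall j, f j <= u j - u j.+1) -> sum_bounded f.
Proof.
move=> u0 fu; exists (u 0%N) => n.
apply: (@le_trans _ _ (u 0%N - u n)); last by rewrite lerBlDr lerDl.
elim: n => [|n IH]; first by rewrite big_ord0 subrr.
by rewrite big_ord_recr/=; have := fu n; lra.
Qed.

Lemma prod_1D_bounded f : (forall j, 0 <= f j) -> sum_bounded f ->
  exists M : R, forall n, \prod_(j < n) (1 + f j) <= M.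
Proof.
move=> f0 [S hS]; exists (expR S) => n; apply: (@le_trans _ _ (expR (\sum_(j < n) f j))).
  rewrite expR_sum; apply: ler_prod => j _; rewrite expR_ge1Dx andbT.
  by rewrite addr_ge0.
by rewrite ler_expR.
Qed.

Lemma ln_le_sub1 (x : R) : 0 < x -> ln x <= x - 1.
Proof.
move=> x0; have h : 1 + (x - 1) = x by lra.
by have := @le_ln1Dx R (x - 1); rewrite h; apply; lra.
Qed.

Lemma powRN_ge (t q : R) : 0 < t -> 0 <= q -> 1 + q * (1 - t) <= t `^ (- q).
Proof.
move=> t0 q0; rewrite /powR gt_eqF//; apply: le_trans (expR_ge1Dx _).
rewrite lerD2l mulNr -mulrN ler_wpM2l//.
by have := ln_le_sub1 t0; lra.
Qed.

(** Convexity of [x^(-q)]: the tangent inequality [powRN_ge] at 1, rescaled by [u]. *)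
Lemma powRN_diff (u v q : R) : 0 < v -> v <= u -> 0 <= q ->
  q * u `^ (- (q + 1)) * (u - v) <= v `^ (- q) - u `^ (- q).
Proof.
move=> v0 vu q0; have u0 : 0 < u by apply: lt_le_trans vu.
have -> : v = u * (v / u) by rewrite mulrC divfK// gt_eqF.
set t := v / u; have t0 : 0 < t by rewrite divr_gt0.
rewrite powRM ?(ltW u0) ?(ltW t0)//.
have -> : u `^ (- (q + 1)) = u `^ (- q) / u.
  rewrite opprD powRD; last by apply/implyP => _; rewrite gt_eqF.
  by rewrite powR_inv1// ltW.
have -> : q * (u `^ (- q) / u) * (u - u * t) = u `^ (- q) * (q * (1 - t)).
  by field; rewrite gt_eqF.
have -> : u `^ (- q) * t `^ (- q) - u `^ (- q) = u `^ (- q) * (t `^ (- q) - 1) by ring.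
apply: ler_wpM2l; first exact: powR_ge0.
by have := powRN_ge t0 q0; lra.
Qed.

Lemma sum_bounded_pow k0 (s : R) : (0 < k0)%N -> 0 < s ->
  sum_bounded (fun j => (k0 + j.+1)%:R `^ (- (1 + s)) : R).
Proof.
move=> k00 s0; apply: (@sum_bounded_le _ (fun j => s^-1 * (s * (k0 + j.+1)%:R `^ (- (s + 1))))).
  by move=> j; rewrite mulrA mulVf ?mul1r ?gt_eqF// [1 + s]addrC.
apply: sum_boundedZ; first by rewrite invr_ge0 ltW.
apply: (@sum_bounded_telescope _ (fun j => (k0 + j)%:R `^ (- s))).
  by move=> j; exact: powR_ge0.
move=> j; have := @powRN_diff (k0 + j.+1)%:R (k0 + j)%:R s.
rewrite ltr0n ler_nat addn_gt0 k00 addnS leqnSn => /(_ isT isT (ltW s0)).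
by rewrite -natrB// subSnn mulr1.
Qed.

Lemma ln_nat_gt0 k : (1 < k)%N -> 0 < ln k%:R :> R.
Proof. by move=> k1; rewrite ln_gt0// ltr1n. Qed.

(** Telescoping of [(ln k)^(1-q)], using [ln (k+1) - ln k >= 1/(k+1)]. *)
Lemma sum_bounded_ln k0 (q : R) : (1 < k0)%N -> 1 < q ->
  sum_bounded (fun j => (k0 + j.+1)%:R^-1 * (ln (k0 + j.+1)%:R) `^ (- q) : R).
Proof.
move=> k01 q1; have q0 : 0 < q - 1 by lra.
apply: (@sum_bounded_le _ (fun j => (q - 1)^-1 *
   ((q - 1) * ln (k0 + j.+1)%:R `^ (- (q - 1 + 1)) * (k0 + j.+1)%:R^-1))).
  move=> j; rewrite le_eqVlt; apply/orP; left; apply/eqP.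
  by rewrite subrK !mulrA mulVf ?mul1r ?gt_eqF// mulrC.
apply: sum_boundedZ; first by rewrite invr_ge0 ltW.
apply: (@sum_bounded_telescope _ (fun j => ln (k0 + j)%:R `^ (- (q - 1)))).
  by move=> j; exact: powR_ge0.
move=> j; set k := (k0 + j)%N; have k1 : (1 < k)%N by rewrite ltn_addr.
have -> : (k0 + j.+1)%N = k.+1 by rewrite addnS.
have kp : 0 < k%:R :> R by rewrite ltr0n ltnW.
have kSp : 0 < k.+1%:R :> R by rewrite ltr0n.
have lk : ln k%:R <= ln k.+1%:R :> R by rewrite ler_ln ?posrE// ler_nat.
have := @powRN_diff (ln k.+1%:R) (ln k%:R) (q - 1) (ln_nat_gt0 k1) lk (ltW q0).
apply: le_trans; apply: ler_wpM2l.
  by rewrite mulr_ge0 ?powR_ge0// ltW.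
have := @ln_le_sub1 (k%:R / k.+1%:R); rewrite divr_gt0// => /(_ isT).
rewrite ln_div ?posrE// -natr1.
have -> : k%:R / (k%:R + 1) - 1 = - (k%:R + 1)^-1 :> R.
  by field; rewrite natr1 gt_eqF.
lra.
Qed.

End Sums.

(** * Weights whose growth the contraction compensates *)

Section Weights.
Variable R : realType.

Definition weight (b : R) (ell : nat -> R) (k : nat) : R := k%:R `^ b * ell k.

Definition contraction (a C s : R) (K : nat) : R :=
  1 - 2 * a / K%:R + C * K%:R `^ (- (1 + s)).

Lemma natpow_le1 k (x : R) : (0 < k)%N -> 0 <= x -> (k%:R : R) `^ (- x) <= 1.
Proof.
move=> k0 x0; rewrite -[leRHS](powRr0 (k%:R : R)).
by apply: ler_powR; [rewrite ler1n|rewrite oppr_le0].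
Qed.

Lemma natpow_mono k (x y : R) : (0 < k)%N -> x <= y -> (k%:R : R) `^ x <= k%:R `^ y.
Proof. by move=> k0 xy; apply: ler_powR => //; rewrite ler1n. Qed.

Lemma natpowD k (x y : R) : (0 < k)%N ->
  (k%:R : R) `^ (x + y) = k%:R `^ x * k%:R `^ y.
Proof. by move=> k0; rewrite powRD// pnatr_eq0 -lt0n k0 implybT. Qed.

Lemma natpow_N1 k : (k%:R : R) `^ (- 1) = k%:R^-1.
Proof. by rewrite powR_inv1. Qed.

(** [(1 + 1/k)^b <= exp (b/k) <= 1/(1 - b/k)], which is [1 + b/K] up to order [K^-2] with [K = k+1].
    Multiplying by the contraction leaves [1 - (2a - b)/K], and terms of order [K^-2] are absorbed
    since [s <= 1]. *)
Lemma weight_ratio (a b s C : R) k : 0 <= b -> b <= 2 * a -> 0 < s <= 1 -> 0 <= C ->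
  2 * b <= k%:R -> (0 < k)%N -> 0 <= 1 - 2 * a / k.+1%:R + C * k.+1%:R `^ (- (1 + s)) ->
  (k.+1%:R / k%:R) `^ b * (1 - 2 * a / k.+1%:R + C * k.+1%:R `^ (- (1 + s))) <=
  1 - (2 * a - b) / k.+1%:R
    + ((2 * b + 8 * b ^+ 2) * (1 + C) + C * (1 + b)) * k.+1%:R `^ (- (1 + s)).
Proof.
move=> b0 ba /andP[s0 s1] C0 bk k0.
have kp : 0 < k%:R :> R by rewrite ltr0n.
have Kp : 0 < k.+1%:R :> R by rewrite ltr0n.
set x := b / k%:R; have x0 : 0 <= x by rewrite divr_ge0.
have x2 : x <= 1 / 2 by rewrite /x ler_pdivrMr//; lra.
have Kk : k.+1%:R / k%:R = 1 + k%:R^-1 :> R.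
  by rewrite -natr1 mulrDl divff ?gt_eqF// mul1r.
have h1 : (k.+1%:R / k%:R) `^ b <= (1 - x)^-1.
  rewrite Kk /powR gt_eqF; last by rewrite addr_gt0// invr_gt0.
  apply: (@le_trans _ _ (expR x)).
    rewrite ler_expR /x; apply: ler_wpM2l => //; apply: le_ln1Dx.
    by apply: (@lt_trans _ _ 0); rewrite ?invr_gt0// ltrN10.
  rewrite -[expR x]invrK -expRN lef_pV2 ?posrE ?expR_gt0//; last by lra.
  by have := expR_ge1Dx (- x).
have h2 : (1 - x)^-1 <= 1 + x + 2 * x ^+ 2.
  rewrite -[leLHS]mul1r ler_pdivrMr; last by lra.
  have : 0 <= x ^+ 2 * (1 - 2 * x) by rewrite mulr_ge0 ?sqr_ge0//; lra.
  nra.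
set p := k.+1%:R `^ (- (1 + s)).
have p2 : k.+1%:R^-1 ^+ 2 <= p.
  have -> : k.+1%:R^-1 ^+ 2 = k.+1%:R `^ (- (1 + 1)) :> R.
    by rewrite opprD natpowD// natpow_N1 expr2.
  by apply: natpow_mono => //; lra.
have p1 : p <= 1 by apply: natpow_le1 => //; lra.
have p0 : 0 <= p by exact: powR_ge0.
set K1 : R := k.+1%:R^-1 in p2 *.
have K10 : 0 < K1 by rewrite invr_gt0.
have K11 : K1 <= 1 by rewrite invf_le1 ?ler1n.
have kK : k%:R^-1 <= 2 * K1.
  rewrite /K1 -(invrK 2) -invfM lef_pV2 ?posrE ?mulr_gt0 ?invr_gt0//.
  rewrite mulrC ler_pdivrMr//; have : 1 <= k%:R :> R by rewrite ler1n.
  rewrite -natr1; lra.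
have kK' : k%:R^-1 = K1 + K1 * k%:R^-1.
  by rewrite /K1 -natr1; field; rewrite natr1 !gt_eqF.
have xle : x <= b * K1 + 2 * b * K1 ^+ 2.
  rewrite /x kK' mulrDr lerD2l -mulrA; have : b * (K1 * k%:R^-1) <= b * (K1 * (2 * K1)).
    by do 2 apply: ler_wpM2l => //; exact: ltW.
  nra.
have xle2 : x ^+ 2 <= 4 * b ^+ 2 * K1 ^+ 2.
  have x3 : x <= 2 * b * K1 by rewrite /x; have := ler_wpM2l b0 kK; lra.
  have -> : 4 * b ^+ 2 * K1 ^+ 2 = (2 * b * K1) ^+ 2 by ring.
  by rewrite lerXn2r ?nnegrE// !mulr_ge0// ltW.
set rho := 1 - 2 * a * K1 + C * p; move=> rho0.
have h3 : (k.+1%:R / k%:R) `^ b <= 1 + b * K1 + (2 * b + 8 * b ^+ 2) * p.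
  apply: (le_trans h1); apply: (le_trans h2).
  have : (2 * b + 8 * b ^+ 2) * K1 ^+ 2 <= (2 * b + 8 * b ^+ 2) * p.
    by apply: ler_wpM2l => //; rewrite addr_ge0 ?mulr_ge0// sqr_ge0.
  nra.
apply: (le_trans (ler_wpM2r rho0 h3)).
have rho1 : rho <= 1 + C.
  rewrite /rho; have : C * p <= C * 1 by exact: ler_wpM2l.
  have : 0 <= a * K1 by rewrite mulr_ge0 ?(ltW K10)//; lra.
  lra.
set c := 2 * b + 8 * b ^+ 2; have c0 : 0 <= c by rewrite addr_ge0 ?mulr_ge0// sqr_ge0.
have e1 : c * p * rho <= c * p * (1 + C) by apply: ler_wpM2l => //; exact: mulr_ge0.
have e2 : 0 <= a * b * K1 ^+ 2 by rewrite !mulr_ge0 ?sqr_ge0//; lra.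
have e3 : C * p * (b * K1) <= C * p * (b * 1).
  by apply: ler_wpM2l; [exact: mulr_ge0|exact: ler_wpM2l].
have -> : (1 + b * K1 + c * p) * rho = (1 + b * K1) * rho + c * p * rho by ring.
have -> : (1 + b * K1) * rho =
    1 - (2 * a - b) * K1 + C * p + C * p * (b * K1) - 2 * (a * b * K1 ^+ 2).
  by rewrite /rho; ring.
have -> : (c * (1 + C) + C * (1 + b)) * p = c * p * (1 + C) + C * p * (b * 1) + C * p by ring.
lra.
Qed.

Lemma power_interp (r y : R) : 1 < r -> 0 <= y -> y `^ (r - 1) <= y `^ r + 1.
Proof.
move=> r1 y0; have [y1|y1] := leP y 1.
  apply: (@le_trans _ _ 1); last by rewrite lerDr powR_ge0.
  have := @ge0_ler_powR R (r - 1); rewrite subr_ge0 (ltW r1) => /(_ isT y 1).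
  by rewrite !nnegrE powR1; apply.
by apply: (@le_trans _ _ (y `^ r)); [apply: ler_powR; lra|rewrite lerDl].
Qed.

(** Young's inequality in elementary form: when [c <= h y] the first summand dominates, and
    otherwise [y < c/h] makes the second one dominate. *)
Lemma power_young (r y c h : R) : 1 < r -> 0 <= y -> 0 <= c -> 0 < h ->
  y `^ (r - 1) * c <= h * y `^ r + c `^ r * h `^ (- (r - 1)).
Proof.
move=> r1 y0 c0 h0; have r0 : 0 < r by lra.
have n1 : 0 <= h * y `^ r by rewrite mulr_ge0 ?powR_ge0// ltW.
have n2 : 0 <= c `^ r * h `^ (- (r - 1)) by rewrite mulr_ge0 ?powR_ge0.
have [chy|hyc] := leP c (h * y).
  apply: (@le_trans _ _ (h * y `^ r)); last by rewrite lerDl.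
  apply: (@le_trans _ _ (y `^ (r - 1) * (h * y))); first by rewrite ler_wpM2l ?powR_ge0.
  by rewrite mulrCA [_ * y]mulrC mulr_powRB1.
apply: (@le_trans _ _ (c `^ r * h `^ (- (r - 1)))); last by rewrite lerDr.
have yc : y <= c / h by rewrite ler_pdivlMr// mulrC ltW.
apply: (@le_trans _ _ ((c / h) `^ (r - 1) * c)).
  apply: ler_wpM2r => //; apply: ge0_ler_powR; rewrite ?nnegrE ?divr_ge0 ?(ltW h0)//; lra.
rewrite powRM ?invr_ge0 ?(ltW h0)// -powR_inv1 ?(ltW h0)// -powRrM mulN1r.
by rewrite mulrAC [_ * c]mulrC mulr_powRB1.
Qed.

(** The surplus [h] of the contraction may be spent on the term with [y^(r-1)]; what it does not
    cover is measured by [t] and joins the perturbation. *)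
Lemma weight_step_scalar (r q h p C y Kn tau sg t : R) : 1 < r <= 2 -> 0 <= q ->
  q <= 1 - h + C * p -> 0 <= h -> 0 <= p <= 1 -> 0 <= C -> 0 <= y -> 0 <= Kn ->
  0 <= tau -> 0 <= sg ->
  y `^ (r - 1) * (Kn * (1 + C) * tau) <= h * y `^ r + t * (y `^ r + 1) ->
  (q * y) `^ r + Kn * ((q * y) `^ (r - 1) * tau) + Kn * sg + 1 <=
  (1 + ((2 * C + C ^+ 2) * p + t + Kn * sg)) * (y `^ r + 1).
Proof.
move=> /andP[r1 r2] q0 qb h0 /andP[p0 p1] C0 y0 Kn0 tau0 sg0 Ht.
have Cp : 0 <= C * p by exact: mulr_ge0.
have Cp1 : C * p <= C * 1 by exact: ler_wpM2l.
have qm : q <= 1 + C * p by lra.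
have qr1 : q `^ (r - 1) <= 1 + C * p.
  apply: (@le_trans _ _ ((1 + C * p) `^ (r - 1))).
    by apply: ge0_ler_powR; rewrite ?nnegrE//; lra.
  by apply: ler1_powR; lra.
have qr : q `^ r <= 1 - h + (2 * C + C ^+ 2) * p.
  rewrite -(@mulr_powRB1 _ q r) //; last by lra.
  apply: (@le_trans _ _ (q * (1 + C * p))); first exact: ler_wpM2l.
  apply: (@le_trans _ _ ((1 - h + C * p) * (1 + C * p))); first by apply: ler_wpM2r => //; lra.
  have : C * p * (C * p) <= C * p * C by apply: ler_wpM2l => //; lra.
  have : 0 <= h * (C * p) by exact: mulr_ge0.
  nra.
rewrite !powRM//.
have yr0 := powR_ge0 y r; have yr10 := powR_ge0 y (r - 1).
have e1 : q `^ r * y `^ r <= (1 - h + (2 * C + C ^+ 2) * p) * y `^ r by exact: ler_wpM2r.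
have e2 : Kn * (q `^ (r - 1) * y `^ (r - 1) * tau) <= y `^ (r - 1) * (Kn * (1 + C) * tau).
  have -> : Kn * (q `^ (r - 1) * y `^ (r - 1) * tau) =
    q `^ (r - 1) * (Kn * tau * y `^ (r - 1)) by ring.
  have -> : y `^ (r - 1) * (Kn * (1 + C) * tau) = (1 + C) * (Kn * tau * y `^ (r - 1)) by ring.
  by apply: ler_wpM2r; [rewrite !mulr_ge0|lra].
have e3 : 0 <= Kn * sg * y `^ r by rewrite !mulr_ge0.
have e4 : 0 <= (2 * C + C ^+ 2) * p.
  by rewrite mulr_ge0// addr_ge0 ?mulr_ge0 ?sqr_ge0.
nra.
Qed.

(** There are two ways to handle the variance input [tau]. If it is summable, it goes into [eps]. If
    it is only [O(1/(K ln K))], the strict surplus [(2a - b)/K] and [power_young] leave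
    [1/(K (ln K)^r)], which is summable because [r > 1]. *)
Lemma weights_exist (r a b s C Kn : R) (ell tau sig : nat -> R) (k1 : nat) :
  1 < r <= 2 -> 0 <= b -> b <= 2 * a -> 0 < s <= 1 -> 0 <= C -> 0 <= Kn ->
  (forall k, (1 < k)%N -> 0 < ell k /\ ell k.+1 <= ell k) ->
  (forall K, (1 < K)%N -> 0 <= tau K) -> (forall K, (1 < K)%N -> 0 <= sig K) ->
  ((forall k0, (1 < k0)%N -> sum_bounded (fun j => tau (k0 + j.+1)%N)) \/
   (b < 2 * a /\ exists2 c, 0 <= c & forall K, (1 < K)%N -> tau K <= c / (K%:R * ln K%:R))) ->
  (forall k0, (1 < k0)%N -> sum_bounded (fun j => sig (k0 + j.+1)%N)) ->
  exists k0, [/\ (k1 <= k0)%N, (1 < k0)%N,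
    forall j, 0 <= contraction a C s (k0 + j.+1) &
    exists (eps : nat -> R) (M : R), [/\ forall j, 0 <= eps j,
      forall n, \prod_(j < n) (1 + eps j) <= M &
      forall j y tt ss q, 0 <= y -> 0 <= tt <= tau (k0 + j.+1)%N -> 0 <= ss <= sig (k0 + j.+1)%N ->
        q = weight b ell (k0 + j.+1) * contraction a C s (k0 + j.+1)
              / weight b ell (k0 + j) ->
        ((q * y) `^ r + Kn * ((q * y) `^ (r - 1) * tt) + Kn * ss + 1
        <= (1 + eps j) * (y `^ r + 1))]].
Proof.
move=> r12 b0 ba s01 C0 Kn0 ellP tau0 sig0 tauP sigP.
have /andP[r1 r2] := r12; have /andP[s0 s1] := s01.
have a0 : 0 <= a by lra.
(* [k0 >= 2b + 2a]: the part [2b] is what [weight_ratio] asks for, the part [2a] keeps the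
   contraction factor nonnegative. *)
pose k0 := (k1 + 2 + Num.truncn (2 * b + 2 * a)).+1.
have k0gt1 : (1 < k0)%N by rewrite /k0 addn2.
have k0b : 2 * b + 2 * a <= k0%:R.
  apply: ltW; apply: (lt_le_trans (truncnS_gt _)).
  by rewrite ler_nat /k0 ltnS leq_addl.
have Kj j : k0%:R <= (k0 + j.+1)%:R :> R by rewrite ler_nat leq_addr.
have Kp j : 0 < (k0 + j.+1)%:R :> R by rewrite ltr0n addnS.
have rho0 j : 0 <= contraction a C s (k0 + j.+1).
  rewrite /contraction addr_ge0 ?mulr_ge0 ?powR_ge0// subr_ge0 ler_pdivrMr// mul1r.
  by apply: le_trans (Kj j); lra.
exists k0; split => //; first by rewrite /k0 -addnS -addnA leq_addr.
pose C1 := (2 * b + 8 * b ^+ 2) * (1 + C) + C * (1 + b).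
have C10 : 0 <= C1.
  by rewrite !addr_ge0// !mulr_ge0// ?addr_ge0 ?mulr_ge0 ?sqr_ge0.
have [T [T0 TS TE]] : exists T : nat -> R, [/\ forall j, 0 <= T j, sum_bounded T &
   forall j y tt, 0 <= y -> 0 <= tt <= tau (k0 + j.+1)%N ->
     y `^ (r - 1) * (Kn * (1 + C1) * tt) <=
     (2 * a - b) / (k0 + j.+1)%:R * y `^ r + T j * (y `^ r + 1)].
  have gt1 j : (1 < k0 + j.+1)%N by rewrite ltn_addr.
  have c0 : 0 <= Kn * (1 + C1) by rewrite mulr_ge0// addr_ge0.
  case: tauP => [tauS|[ba' [c cge0 tauc]]].
    exists (fun j => Kn * (1 + C1) * tau (k0 + j.+1)%N); split.
    - by move=> j; rewrite mulr_ge0// tau0.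
    - by apply: sum_boundedZ => //; exact: tauS.
    - move=> j y tt y0 /andP[t0 t1].
      have : y `^ (r - 1) * (Kn * (1 + C1) * tt) <=
             (y `^ r + 1) * (Kn * (1 + C1) * tau (k0 + j.+1)%N).
        by apply: ler_pM; [exact: powR_ge0|exact: mulr_ge0|exact: power_interp|exact: ler_wpM2l].
      have : 0 <= (2 * a - b) / (k0 + j.+1)%:R * y `^ r.
        by rewrite !mulr_ge0 ?invr_ge0 ?powR_ge0//; lra.
      rewrite [_ * (y `^ r + 1)]mulrC; lra.
  pose h := 2 * a - b; have h0 : 0 < h by rewrite /h; lra.
  have [c2 c20 c2E] : exists2 c2 : R, 0 <= c2 & c2 = (Kn * (1 + C1) * c) `^ r * h `^ (- (r - 1)).
    by eexists; last reflexivity; rewrite mulr_ge0 ?powR_ge0.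
  exists (fun j => c2 * ((k0 + j.+1)%:R^-1 * ln (k0 + j.+1)%:R `^ (- r))); split.
  - by move=> j; rewrite !mulr_ge0// ?powR_ge0 ?invr_ge0.
  - by apply: sum_boundedZ => //; exact: sum_bounded_ln.
  move=> j y tt y0 /andP[t0 t1]; set K := (k0 + j.+1)%N.
  have lnK : 0 < ln K%:R :> R by apply: ln_nat_gt0; exact: gt1.
  have hK : 0 < h / K%:R by rewrite divr_gt0// Kp.
  have ct : Kn * (1 + C1) * tt <= Kn * (1 + C1) * c / (K%:R * ln K%:R).
    by rewrite -[leRHS]mulrA; apply: ler_wpM2l => //; apply: (le_trans t1); exact: tauc.
  have ct0 : 0 <= Kn * (1 + C1) * tt by rewrite mulr_ge0.
  apply: (le_trans (ler_wpM2l (powR_ge0 _ _) ct)).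
  set cc := Kn * (1 + C1) * c / (K%:R * ln K%:R).
  have cc0 : 0 <= cc by apply: le_trans ct.
  apply: (le_trans (power_young r1 y0 cc0 hK)); rewrite lerD2l.
  have -> : cc `^ r * (h / K%:R) `^ (- (r - 1)) = c2 * (K%:R^-1 * ln K%:R `^ (- r)).
    have ip (x y' : R) : 0 <= x -> x^-1 `^ y' = x `^ (- y').
      by move=> x0; rewrite -powR_inv1// -powRrM mulN1r.
    have E1 : cc `^ r = (Kn * (1 + C1) * c) `^ r * (K%:R `^ (- r) * ln K%:R `^ (- r)).
      rewrite /cc (powRM _ (mulr_ge0 c0 cge0)); last first.
        by rewrite invr_ge0 mulr_ge0 ?(ltW lnK).
      by rewrite ip ?mulr_ge0 ?(ltW lnK)// powRM ?(ltW lnK).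
    have E2 : (h / K%:R) `^ (- (r - 1)) = h `^ (- (r - 1)) * K%:R `^ (r - 1).
      by rewrite powRM ?invr_ge0 ?(ltW h0)// ip// opprK.
    rewrite E1 E2 -[K%:R^-1]natpow_N1.
    have -> : K%:R `^ (-1) = K%:R `^ (- r) * K%:R `^ (r - 1) :> R.
      by rewrite -natpowD; [congr (_ `^ _); lra|rewrite /K addnS].
    rewrite c2E; ring.
  rewrite -{1}[c2 * _]mulr1; apply: ler_wpM2l; last by rewrite lerDr powR_ge0.
  by rewrite !mulr_ge0// ?powR_ge0 ?invr_ge0.
pose p j : R := (k0 + j.+1)%:R `^ (- (1 + s)).
pose eps j := (2 * C1 + C1 ^+ 2) * p j + T j + Kn * sig (k0 + j.+1)%N.
have c10 : 0 <= 2 * C1 + C1 ^+ 2 by rewrite addr_ge0 ?mulr_ge0 ?sqr_ge0.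
have eps0 j : 0 <= eps j.
  rewrite !addr_ge0 ?mulr_ge0 ?powR_ge0//; apply: sig0; by rewrite ltn_addr.
have epsS : sum_bounded eps.
  apply: sum_boundedD; last by apply: sum_boundedZ => //; exact: sigP.
  apply: sum_boundedD => //; apply: sum_boundedZ => //.
  by apply: sum_bounded_pow => //; exact: ltnW.
have [M HM] := prod_1D_bounded eps0 epsS.
exists eps, M; split => // j y tt ss q y0 tt01 /andP[ss0 ss1] qE.
have om0 k : 0 < weight b ell (k0 + k).
  rewrite /weight mulr_gt0//; first by rewrite powR_gt0// ltr0n addSn.
  by have [] := ellP (k0 + k)%N (ltn_addr _ k0gt1).
have q0 : 0 <= q.
  rewrite qE; apply: divr_ge0; last exact: (ltW (om0 j)).
  by apply: mulr_ge0; [exact: (ltW (om0 j.+1))|exact: rho0].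
have KE : (k0 + j.+1)%:R = (k0 + j).+1%:R :> R by rewrite addnS.
have k0jp : 0 < (k0 + j)%:R :> R by rewrite ltr0n addSn.
have qb : q <= 1 - (2 * a - b) / (k0 + j.+1)%:R + C1 * p j.
  have := @weight_ratio a b s C (k0 + j) b0 ba s01 C0.
  rewrite -KE => H; apply: le_trans (H _ _ (rho0 j)); last 2 first.
  - apply: (@le_trans _ _ k0%:R); first by lra.
    by rewrite ler_nat leq_addr.
  - by rewrite addSn.
  rewrite qE mulrAC; apply: ler_wpM2r; first exact: rho0.
  rewrite /weight; have [e1 e2] := ellP (k0 + j)%N (ltn_addr _ k0gt1).
  rewrite ler_pdivrMr; last exact: (om0 j).
  rewrite mulrA -powRM ?divr_ge0// divfK ?gt_eqF//.
  by apply: ler_wpM2l; [exact: powR_ge0|rewrite addnS].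
have p01 : 0 <= p j <= 1.
  by rewrite powR_ge0/=; apply: natpow_le1; [rewrite addSn|lra].
have h0 : 0 <= (2 * a - b) / (k0 + j.+1)%:R by rewrite divr_ge0//; lra.
have /andP[tt0 tt1] := tt01.
have := weight_step_scalar r12 q0 qb h0 p01 C10 y0 Kn0 tt0 ss0 (TE j y tt y0 tt01).
move/le_trans; apply; apply: ler_wpM2r; first by rewrite addr_ge0 ?powR_ge0.
rewrite lerD2l /eps lerD2l; exact: ler_wpM2l.
Qed.

End Weights.

(** * Window averages *)

Section Window.
Variable R : realType.

Definition window (p : nat) (f : nat -> R) (k : nat) : R :=
  \sum_(s < p) (p - s)%:R / p%:R * f (k + s.+1)%N.

(* The weights are chosen so that replacing [f k.+1] by its average over the
   next [p] values costs exactly a telescoping term. *)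
Lemma windowS p (f : nat -> R) k : (0 < p)%N ->
  window p f k.+1 - window p f k = p%:R^-1 * \sum_(s < p) f (k.+1 + s.+1)%N - f k.+1.
Proof.
move=> p0; have pn0 : p%:R != 0 :> R by rewrite pnatr_eq0 -lt0n.
have -> : window p f k = f k.+1 + \sum_(s < p) (p.-1 - s)%:R / p%:R * f (k.+1 + s.+1)%N.
  rewrite /window; case: p p0 pn0 => // p _ pn0.
  rewrite big_ord_recl big_ord_recr /= subn0 subnn mul0r mul0r addr0 divff// mul1r addn1.
  by congr (_ + _); apply: eq_bigr => s _; rewrite /bump /= add1n subSS addSn !addnS.
have -> : window p f k.+1 = \sum_(s < p) ((p.-1 - s)%:R / p%:R * f (k.+1 + s.+1)%N
    + p%:R^-1 * f (k.+1 + s.+1)%N).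
  apply: eq_bigr => s _; rewrite -mulrDl; congr (_ * _).
  have -> : (p - s)%N = (p.-1 - s).+1.
    case: p s p0 pn0 => [[]//|p] s _ _ /=; rewrite subSn//.
    by rewrite -ltnS ltn_ord.
  by rewrite -natr1 mulrDl mul1r.
rewrite big_split/= mulr_sumr; lra.
Qed.

Lemma window_le p f k C : (0 < p)%N -> (forall j, (0 < j)%N -> 0 <= f j <= C) ->
  window p f k <= p%:R * C.
Proof.
move=> p0 fC; apply: (@le_trans _ _ (\sum_(s < p) C)).
  apply: ler_sum => s _; have /andP[f0 f1] := fC (k + s.+1)%N (ltn_addl _ (ltn0Sn _)).
  apply: (@le_trans _ _ (1 * f (k + s.+1)%N)); last by rewrite mul1r.
  by apply: ler_wpM2r => //; rewrite ler_pdivrMr ?ltr0n// mul1r ler_nat leq_subr.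
by rewrite sumr_const card_ord mulr_natl.
Qed.

(** Any [n] consecutive times visit each coordinate exactly once. *)
Lemma sum_modn_shift n c (F : nat -> R) : (0 < n)%N ->
  \sum_(s < n) F ((c + s) %% n)%N = \sum_(l < n) F l.
Proof.
move=> n0; elim: c => [|c IH].
  by apply: eq_bigr => s _; rewrite add0n modn_small.
rewrite -IH; case: n n0 {IH} => // n _.
rewrite big_ord_recr big_ord_recl/= addn0 addSnnS modnDr addrC; congr (_ + _).
by apply: eq_bigr => s _; rewrite /bump/= add1n addSnnS.
Qed.

End Window.

(** * The Lyapunov function and its contraction *)

Section Forms.
Variables (R : realType) (N n : nat) (m : 'I_N -> nat).
Variable aw : 'I_N -> 'I_N -> R.
Variable H : forall i : 'I_N, nat -> 'M[R]_(m i, n).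
Hypothesis n_gt0 : (0 < n)%N.
Hypothesis N_gt1 : (1 < N)%N.
Hypothesis aw_ge0 : forall i j, 0 <= aw i j.
Hypothesis aw_sym : forall i j, aw i j = aw j i.
Variables (Hbar delta b : R) (p : nat).
Hypothesis Hbar_gt0 : 0 < Hbar.
Hypothesis H_bnd : forall i k, (0 < k)%N -> opnorm_le (H i k) Hbar.
Hypothesis p_gt0 : (0 < p)%N.
Hypothesis delta_gt0 : 0 < delta.
Hypothesis b_gt0 : 0 < b.
Hypothesis PE : forall k, (0 < k)%N ->
     loewner_ge (p%:R^-1 *: \sum_(k <= t < k + p) \sum_(i < N) (H i t)^T *m H i t)
                (delta%:M).
Hypothesis conn : \rank (laplacian aw) = N.-1.
Local Notation E := 'M[R]_(N, n).
Local Notation lam2 := (lambda2 (laplacian aw)).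

Implicit Types x y : E.

Definition rowv (x : E) (i : 'I_N) : 'cV[R]_n := (row i x)^T.

Lemma rowvE x i l : rowv x i l 0 = x i l.
Proof. by rewrite !mxE. Qed.

Lemma rowvD c x y i : rowv (c *: x + y) i = c *: rowv x i + rowv y i.
Proof. by apply/colP => l; rewrite !mxE. Qed.

Definition tcoord (k : nat) : 'I_n := Ordinal (ltn_pmod k.-1 n_gt0).

Lemma phiE (k : nat) (v : 'cV[R]_n) : ((phi R n k)^T *m v) 0 0 = v (tcoord k) 0.
Proof.
rewrite mxE (bigD1 (tcoord k))//= !mxE eqxx mul1r big1 ?addr0// => l lk.
by rewrite !mxE; case: eqP => [e|]; [case/eqP: lk; exact: val_inj|rewrite mul0r].
Qed.

Definition inner (x y : E) : R := \sum_i \sum_l x i l * y i l.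

Definition Hform (k : nat) (x y : E) : R :=
  \sum_i \sum_l (H i k *m rowv x i) l 0 * (H i k *m rowv y i) l 0.

(** Laplacian form of the coordinate exchanged at time [k]; the weight is halved because ordered
    pairs count each edge twice. *)
Definition Pform (k : nat) (x y : E) : R :=
  \sum_i \sum_j aw i j / 2 *
    ((x i (tcoord k) - x j (tcoord k)) * (y i (tcoord k) - y j (tcoord k))).

Lemma inner_psd : psd_form inner.
Proof.
apply: psd_form_sum => i; apply: psd_form_sum => l.
by apply: psd_form_sq => c x y; rewrite !mxE.
Qed.

Lemma Hform_psd k : psd_form (Hform k).
Proof.
apply: psd_form_sum => i; apply: psd_form_sum => l.
by apply: psd_form_sq => c x y; rewrite rowvD mulmxDr -scalemxAr !mxE.
Qed.

Lemma Pform_psd k : psd_form (Pform k).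
Proof.
apply: psd_form_sum => i; apply: psd_form_sum => j.
apply: psd_formZ; first by rewrite divr_ge0.
by apply: psd_form_sq => c x y; rewrite !mxE; ring.
Qed.

Lemma innerE x : inner x x = \sum_i \sum_l x i l ^+ 2.
Proof. by apply: eq_bigr => i _; apply: eq_bigr => l _; rewrite expr2. Qed.

Lemma opnorm_sq q (M : 'M[R]_(q, n)) (v : 'cV[R]_n) : opnorm_le M Hbar ->
  \sum_l (M *m v) l 0 ^+ 2 <= Hbar ^+ 2 * \sum_l v l 0 ^+ 2.
Proof.
move=> /(_ v); rewrite /enorm => h.
have s0 (k : nat) (u : 'cV[R]_k) : 0 <= \sum_l u l 0 ^+ 2.
  by apply: sumr_ge0 => l _; exact: sqr_ge0.
rewrite -[leLHS]sqr_sqrtr// -[X in _ * X]sqr_sqrtr// -exprMn.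
by rewrite lerXn2r ?nnegrE ?mulr_ge0 ?sqrtr_ge0// ltW.
Qed.

Lemma Hform_le k x : (0 < k)%N -> Hform k x x <= Hbar ^+ 2 * inner x x.
Proof.
move=> k0; rewrite innerE mulr_sumr; apply: ler_sum => i _.
have := opnorm_sq (rowv x i) (H_bnd i k0).
under eq_bigr do rewrite expr2.
by under [X in _ <= _ * X]eq_bigr do rewrite rowvE.
Qed.

Definition Pbound : R := \sum_i \sum_j 2 * aw i j.

Lemma Pbound_ge0 : 0 <= Pbound.
Proof. by do 2 (apply: sumr_ge0 => ? _); rewrite mulr_ge0. Qed.

Lemma coord_le_inner x i l : x i l ^+ 2 <= inner x x.
Proof.
rewrite innerE (bigD1 i)//= (bigD1 l)//= -addrA lerDl addr_ge0//.
  by apply: sumr_ge0 => ? _; exact: sqr_ge0.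
by do 2 (apply: sumr_ge0 => ? _); exact: sqr_ge0.
Qed.

Lemma Pform_le k x : Pform k x x <= Pbound * inner x x.
Proof.
rewrite mulr_suml; apply: ler_sum => i _; rewrite mulr_suml; apply: ler_sum => j _.
have -> : 2 * aw i j * inner x x = aw i j / 2 * (4 * inner x x) by field.
apply: ler_wpM2l; first by rewrite divr_ge0.
have := coord_le_inner x i (tcoord k); have := coord_le_inner x j (tcoord k).
move: (x i _) (x j _) => u v h1 h2; have := sqr_ge0 (u + v); nra.
Qed.

Lemma PE_sum k (v : 'cV[R]_n) : (0 < k)%N ->
  delta * \sum_l v l 0 ^+ 2 <=
  p%:R^-1 * \sum_(s < p) \sum_i \sum_l (H i (k + s)%N *m v) l 0 ^+ 2.
Proof.
move=> k0; have := PE k0 v; rewrite mulmxBr mulmxBl mxE.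
have -> : (v^T *m (p%:R^-1 *: \sum_(k <= t < k + p) \sum_(i < N) (H i t)^T *m H i t) *m v) 0 0
  = p%:R^-1 * \sum_(s < p) \sum_i \sum_l (H i (k + s)%N *m v) l 0 ^+ 2.
  rewrite -scalemxAr -scalemxAl mxE; congr (_ * _).
  rewrite -{1}[k]add0n big_addn addnC addnK big_mkord.
  rewrite mulmx_sumr mulmx_suml summxE; apply: eq_bigr => s _.
  rewrite mulmx_sumr mulmx_suml summxE; apply: eq_bigr => i _.
  rewrite mulmxA -trmx_mul -mulmxA mxE; apply: eq_bigr => l _.
  by rewrite mxE expr2 addnC.
have -> : ((- (v^T *m delta%:M *m v)) 0 0) = - (delta * \sum_l v l 0 ^+ 2).
  rewrite mxE; congr (- _); rewrite -mulmxA mul_scalar_mx -scalemxAr mxE; congr (_ * _).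
  by rewrite mxE; apply: eq_bigr => l _; rewrite mxE expr2.
by rewrite subr_ge0.
Qed.

(** Excitation tested on one basis vector. This is what keeps [rate] below the share of the
    consensus term in [rate_avg]. *)
Lemma delta_le : delta <= N%:R * Hbar ^+ 2.
Proof.
pose v : 'cV[R]_n := \col_l (l == tcoord 1)%:R.
have v1 : \sum_l v l 0 ^+ 2 = 1.
  rewrite (bigD1 (tcoord 1))//= !mxE eqxx expr1n big1 ?addr0// => l /negPf ll.
  by rewrite !mxE ll expr0n.
have := @PE_sum 1 v isT; rewrite v1 mulr1 => /le_trans; apply.
rewrite mulrC ler_pdivrMr ?ltr0n//.
apply: (@le_trans _ _ (\sum_(s < p) \sum_(i < N) Hbar ^+ 2)).
  apply: ler_sum => s _; apply: ler_sum => i _.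
  have := @opnorm_sq _ (H i (1 + s)%N) v (@H_bnd i (1 + s)%N isT).
  by rewrite v1 mulr1.
by rewrite !sumr_const !card_ord -[_ *+ p]mulr_natl -[_ *+ N]mulr_natl mulrC.
Qed.

Definition Havg (k : nat) (x : E) : R := p%:R^-1 * \sum_(s < p) Hform (k + s.+1) x x.
Definition Pavg (k : nat) (x : E) : R := n%:R^-1 * \sum_(s < n) Pform (k + s.+1) x x.

Definition mean (x : E) : 'cV[R]_n := \col_l (N%:R^-1 * \sum_i x i l).
Definition dev (x : E) : R := \sum_i \sum_l (x i l - mean x l 0) ^+ 2.

Lemma dev_ge0 x : 0 <= dev x.
Proof. by do 2 (apply: sumr_ge0 => ? _); exact: sqr_ge0. Qed.

Lemma inner_mean x : inner x x = N%:R * \sum_l mean x l 0 ^+ 2 + dev x.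
Proof.
have Nn0 : N%:R != 0 :> R by rewrite pnatr_eq0 -lt0n ltnW.
rewrite innerE /dev exchange_big [X in _ + X]exchange_big/= mulr_sumr -big_split/=.
apply: eq_bigr => l _; set c := mean x l 0.
have cE : \sum_i x i l = N%:R * c by rewrite /c mxE mulVKf.
have -> : \sum_i (x i l - c) ^+ 2 = \sum_i x i l ^+ 2 - 2 * c * \sum_i x i l + N%:R * c ^+ 2.
  transitivity (\sum_i (x i l ^+ 2 - 2 * c * x i l + c ^+ 2)).
    by apply: eq_bigr => i _; ring.
  by rewrite big_split/= sumrB -mulr_sumr sumr_const card_ord [N%:R * _]mulr_natl.
rewrite cE; ring.
Qed.

(** Over [n] consecutive times every coordinate is exchanged once, so the average is [1/n] times the
    Laplacian form summed over the coordinates. Subtracting the mean leaves the differences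
    unchanged and makes the spectral gap applicable. *)
Lemma Pavg_ge k x : lam2 / n%:R * dev x <= Pavg k x.
Proof.
have Nn0 : N%:R != 0 :> R by rewrite pnatr_eq0 -lt0n ltnW.
have [lam0 gap] := laplacian_spectral_gap aw_ge0 aw_sym N_gt1 conn.
rewrite /Pavg mulrAC mulrC; apply: ler_wpM2l; first by rewrite invr_ge0.
pose F (l : nat) : R := if insub l is Some l' then
  (\sum_i \sum_j aw i j * (x i l' - x j l') ^+ 2) / 2 else 0.
have -> : \sum_(s < n) Pform (k + s.+1) x x = \sum_(l < n) F l.
  rewrite -(@sum_modn_shift _ n k F n_gt0); apply: eq_bigr => s _.
  rewrite /F insubT ?ltn_pmod// => hl; rewrite mulr_suml; apply: eq_bigr => i _.
  rewrite mulr_suml; apply: eq_bigr => j _.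
  have -> : tcoord (k + s.+1) = Ordinal hl by apply: val_inj; rewrite /= addnS.
  by rewrite /=; field.
rewrite /dev exchange_big/= mulr_sumr; apply: ler_sum => l _.
rewrite /F valK; set c := mean x l 0.
have cE : \sum_i x i l = N%:R * c by rewrite /c mxE mulVKf.
have := gap (fun i => x i l - c).
rewrite sumrB cE sumr_const card_ord mulr_natl subrr => /(_ erefl).
move/le_trans; apply; rewrite le_eqVlt; apply/orP; left; apply/eqP; congr (_ / _).
by apply: eq_bigr => i _; apply: eq_bigr => j _; congr (_ * _ ^+ _); ring.
Qed.

(* [|u + z|^2 >= (1 - c) |u|^2 - (1/c - 1) |z|^2] separates the consensus part from the
   deviations. *)
Lemma Havg_ge k x c : 0 < c <= 1 ->
  (1 - c) * delta * \sum_l mean x l 0 ^+ 2 - (c^-1 - 1) * Hbar ^+ 2 * dev x <= Havg k x.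
Proof.
move=> /andP[c0 c1]; set u := mean x.
pose zz i : 'cV[R]_n := rowv x i - u.
have step j : (0 < j)%N -> (1 - c) * (\sum_i \sum_l (H i j *m u) l 0 ^+ 2)
    - (c^-1 - 1) * Hbar ^+ 2 * dev x <= Hform j x x.
  move=> j0; rewrite /dev !mulr_sumr -sumrB; apply: ler_sum => i _.
  have zE : \sum_l (x i l - u l 0) ^+ 2 = \sum_l zz i l 0 ^+ 2.
    by apply: eq_bigr => l _; rewrite !mxE.
  have c1' : 0 <= c^-1 - 1 by rewrite subr_ge0 invf_ge1.
  apply: (@le_trans _ _ ((1 - c) * \sum_l (H i j *m u) l 0 ^+ 2 -
     (c^-1 - 1) * \sum_l (H i j *m zz i) l 0 ^+ 2)).
    rewrite lerD2l lerN2 zE -[leRHS]mulrA; apply: ler_wpM2l => //.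
    exact: opnorm_sq (H_bnd i j0).
  rewrite !mulr_sumr -sumrB; apply: ler_sum => l _.
  have -> : (H i j *m rowv x i) l 0 = (H i j *m u) l 0 + (H i j *m zz i) l 0.
    by rewrite -[rowv x i](subrK u) addrC mulmxDr mxE.
  move: ((H i j *m u) l 0) ((H i j *m zz i) l 0) => s t.
  rewrite -subr_ge0.
  have -> : (s + t) * (s + t) - ((1 - c) * s ^+ 2 - (c^-1 - 1) * t ^+ 2) =
     c * (s + c^-1 * t) ^+ 2 by field; rewrite gt_eqF.
  by rewrite mulr_ge0 ?sqr_ge0// ltW.
have pe := @PE_sum k.+1 u isT.
have pp : 0 < p%:R :> R by rewrite ltr0n.
rewrite /Havg.
apply: (@le_trans _ _ (p%:R^-1 * \sum_(s < p) ((1 - c) * (\sum_i \sum_l (H i (k.+1 + s)%N *m u) l 0 ^+ 2)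
    - (c^-1 - 1) * Hbar ^+ 2 * dev x))).
  rewrite sumrB -mulr_sumr sumr_const card_ord mulrBr -[X in _ <= _ - _ * X]mulr_natl.
  rewrite [X in _ <= _ - X]mulrA mulVf ?gt_eqF// mul1r lerD2r.
  rewrite [leRHS]mulrCA -[leLHS]mulrA; apply: ler_wpM2l; first by lra.
  exact: pe.
apply: ler_wpM2l; first by rewrite invr_ge0 ltW.
by apply: ler_sum => s _; rewrite addSnnS; apply: step; rewrite addnS.
Qed.

(** At [kap = m'] this is the constant [a] of a network with critical edges, those with
    [nu + gam = 1]; as [kap] grows it tends to [delta * b / N], the constant without them. *)
Definition rate (kap : R) : R :=
  delta * lam2 * b * kap / (2 * N%:R * n%:R * Hbar ^+ 2 * b + N%:R * lam2 * kap).

Lemma rate_avg k x kap : 0 <= kap ->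
  rate kap * inner x x <= b * Havg k x + kap * Pavg k x.
Proof.
move=> kap0.
have [lam0 _] := laplacian_spectral_gap aw_ge0 aw_sym N_gt1 conn.
have Np : 0 < N%:R :> R by rewrite ltr0n ltnW.
have np : 0 < n%:R :> R by rewrite ltr0n.
set mu := lam2 * kap; have mu0 : 0 <= mu by rewrite mulr_ge0// ltW.
set q := 2 * n%:R * Hbar ^+ 2 * b.
have q0 : 0 < q by rewrite !mulr_gt0// exprn_gt0.
have den0 : 0 < q + mu by lra.
have rE : rate kap = delta * b * mu / (N%:R * (q + mu)).
  by rewrite /rate /mu /q; congr (_ / _); ring.
(* This [c] balances the two forms: the loss on the deviations in [Havg_ge] becomes [mu/(2n)], half
   of the consensus gain [mu/n], and the other half is at least [rate kap]. *)
pose c := q / (q + mu).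
have c01 : 0 < c <= 1.
  by rewrite divr_gt0//= ler_pdivrMr// mul1r lerDl.
have cE1 : 1 - c = mu / (q + mu) by rewrite /c; field; rewrite gt_eqF.
have cE2 : c^-1 - 1 = mu / q by rewrite /c; field; rewrite !gt_eqF.
have h1 := Havg_ge k x c01; rewrite cE1 cE2 in h1.
have h2 := Pavg_ge k x.
rewrite inner_mean.
set A := \sum_l mean x l 0 ^+ 2 in h1 *; set Z := dev x in h1 h2 *.
have A0 : 0 <= A by apply: sumr_ge0 => l _; exact: sqr_ge0.
have Z0 : 0 <= Z by exact: dev_ge0.
have k1 := ler_wpM2l (ltW b_gt0) h1; have k2 := ler_wpM2l kap0 h2.
apply: le_trans (lerD k1 k2).
have rZ : rate kap <= mu / (2 * n%:R).
  rewrite rE ler_pdivrMr ?mulr_gt0//.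
  have -> : mu / (2 * n%:R) * (N%:R * (q + mu)) = mu * (N%:R * (q + mu) / (2 * n%:R)).
    by field; rewrite gt_eqF.
  rewrite [leLHS]mulrC; apply: ler_wpM2l => //.
  rewrite ler_pdivlMr ?mulr_gt0//.
  have d1 := ler_wpM2r (ltW (mulr_gt0 (mulr_gt0 b_gt0 (ltr0n R 2)) np)) delta_le.
  have : 0 <= N%:R * mu by rewrite mulr_ge0// ltW.
  by rewrite /q; nra.
have e1 : b * (mu / (q + mu) * delta * A) = rate kap * (N%:R * A).
  by rewrite rE; field; rewrite !gt_eqF.
have e2 : b * (mu / q * Hbar ^+ 2 * Z) = mu / (2 * n%:R) * Z.
  by rewrite /q; field; rewrite !gt_eqF.
have e3 : kap * (lam2 / n%:R * Z) = mu / n%:R * Z by rewrite /mu; field; rewrite gt_eqF.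
have e4 : mu / n%:R * Z = mu / (2 * n%:R) * Z + mu / (2 * n%:R) * Z by field; rewrite gt_eqF.
have e5 := ler_wpM2r Z0 rZ.
rewrite mulrBr e1 e2 e3 e4; lra.
Qed.

Variables (kap e0 : R).
Hypothesis kap_ge0 : 0 <= kap.
Hypothesis e0_range : 0 <= e0 <= 4^-1.

(** Coupling strength guaranteed at time [K]. The exponent [e0] is 0 when some edge may decay like
    [1/K], and positive when every edge decays more slowly. *)
Definition coupling (K : nat) : R := kap * K%:R `^ (- (1 - e0)).

Definition Hwin (K : nat) x y : R :=
  \sum_(s < p) (p - s)%:R / p%:R * Hform (K + s.+1) x y.
Definition Pwin (K : nat) x y : R :=
  \sum_(s < n) (n - s)%:R / n%:R * Pform (K + s.+1) x y.
Definition corr (K : nat) x y : R := b / K%:R * Hwin K x y + coupling K * Pwin K x y.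
Definition lyap (K : nat) x y : R := inner x y - 2 * corr K x y.

Definition corr_bound : R := b * (p%:R * Hbar ^+ 2) + kap * (n%:R * Pbound).

Lemma coupling_ge0 K : 0 <= coupling K.
Proof. by rewrite mulr_ge0 ?powR_ge0. Qed.

Lemma corr_bound_ge0 : 0 <= corr_bound.
Proof.
by rewrite addr_ge0// !mulr_ge0 ?Pbound_ge0 ?sqr_ge0// ltW.
Qed.

Lemma Hwin_psd K : psd_form (Hwin K).
Proof.
apply: psd_form_sum => s; apply: psd_formZ; first by rewrite divr_ge0.
exact: Hform_psd.
Qed.

Lemma Pwin_psd K : psd_form (Pwin K).
Proof.
apply: psd_form_sum => s; apply: psd_formZ; first by rewrite divr_ge0.
exact: Pform_psd.
Qed.

Lemma corr_psd K : psd_form (corr K).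
Proof.
apply: psd_formD; apply: psd_formZ; [|exact: Hwin_psd|exact: coupling_ge0|exact: Pwin_psd].
by rewrite divr_ge0// ltW.
Qed.

Lemma inner_ge0 x : 0 <= inner x x.
Proof. exact: (psd_ge0 x inner_psd). Qed.

Lemma Hwin_le K x : Hwin K x x <= p%:R * Hbar ^+ 2 * inner x x.
Proof.
rewrite -mulrA; apply: (@window_le _ p (fun j => Hform j x x)) => // j j0.
by rewrite (psd_ge0 x (Hform_psd j)) Hform_le.
Qed.

Lemma Pwin_le K x : Pwin K x x <= n%:R * Pbound * inner x x.
Proof.
rewrite -mulrA; apply: (@window_le _ n (fun j => Pform j x x)) => // j j0.
by rewrite (psd_ge0 x (Pform_psd j)) Pform_le.
Qed.

Lemma corr_sum_le K x : b * Hwin K x x + kap * Pwin K x x <= corr_bound * inner x x.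
Proof.
rewrite mulrDl -[b * _ * _]mulrA -[kap * _ * _]mulrA; apply: lerD; apply: ler_wpM2l => //.
- exact: ltW.
- exact: Hwin_le.
- exact: Pwin_le.
Qed.

Lemma corr_le K x : (0 < K)%N ->
  corr K x x <= corr_bound * K%:R `^ (- (1 - e0)) * inner x x.
Proof.
move=> K0; rewrite mulrAC.
apply: le_trans (ler_wpM2r (powR_ge0 _ _) (corr_sum_le K x)).
rewrite mulrDl; apply: lerD; last by rewrite /coupling mulrAC.
rewrite [leRHS]mulrAC; apply: ler_wpM2r; first exact: (psd_ge0 x (Hwin_psd K)).
apply: ler_wpM2l; first exact: ltW.
by rewrite -natpow_N1; apply: natpow_mono => //; have := e0_range; lra.
Qed.

Lemma lyap_le K x : lyap K x x <= inner x x.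
Proof. by rewrite lerBlDr lerDl mulr_ge0// (psd_ge0 x (corr_psd K)). Qed.

Lemma lyap_ge K x : (0 < K)%N -> corr_bound * K%:R `^ (- (1 - e0)) <= 4^-1 ->
  inner x x <= 2 * lyap K x x.
Proof.
move=> K0 hK; have := ler_wpM2r (inner_ge0 x) hK.
move=> /(le_trans (corr_le x K0)); rewrite /lyap; lra.
Qed.

Lemma lyap_psd K : (0 < K)%N -> corr_bound * K%:R `^ (- (1 - e0)) <= 4^-1 ->
  psd_form (lyap K).
Proof.
move=> K0 hK; have [s1 l1 p1] := inner_psd; have [s2 l2 p2] := corr_psd K.
split => [x y|c x y z|x]; first by rewrite /lyap s1 s2.
  by rewrite /lyap l1 l2; ring.
by have := lyap_ge x K0 hK; have := inner_ge0 x; lra.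
Qed.

Lemma coupling_diff k : (0 < k)%N ->
  0 <= coupling k - coupling k.+1 <= 2 * kap * k.+1%:R `^ (- (2 - e0)).
Proof.
move=> k0; have /andP[e00 e01] := e0_range; rewrite -mulrBr.
have kp : 0 < k%:R :> R by rewrite ltr0n.
have Kp : 0 < k.+1%:R :> R by rewrite ltr0n.
set t := 1 - e0; have t0 : 0 <= t by rewrite /t; lra.
have t1 : t <= 1 by rewrite /t; lra.
set A := k%:R `^ (- t); set B := k.+1%:R `^ (- t).
have B0 : 0 <= B by exact: powR_ge0.
have BA : B <= A.
  rewrite /A /B !powRN lef_pV2 ?posrE ?powR_gt0//.
  by rewrite ge0_ler_powR ?nnegrE// ler_nat.
have AB : A <= B * (1 + k%:R^-1).
  have -> : A = B * (k.+1%:R / k%:R) `^ t.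
    rewrite /A /B powRM ?invr_ge0// mulrA -powRD ?addNr ?powRr0 ?mul1r.
      by rewrite -powR_inv1// -powRrM mulN1r.
    by apply/implyP => _; rewrite gt_eqF.
  apply: ler_wpM2l => //.
  have -> : 1 + k%:R^-1 = k.+1%:R / k%:R :> R.
    by rewrite -natr1 mulrDl divff ?gt_eqF// mul1r.
  by apply: ler1_powR => //; rewrite ler_pdivlMr// mul1r ler_nat.
have BK : B * (2 * k.+1%:R^-1) = 2 * k.+1%:R `^ (- (2 - e0)).
  have -> : - (2 - e0) = - t + (- 1) by rewrite /t; lra.
  by rewrite natpowD// natpow_N1 /B; ring.
have kK : k%:R^-1 <= 2 * k.+1%:R^-1 :> R.
  rewrite -(invrK 2) -invfM lef_pV2 ?posrE ?mulr_gt0 ?invr_gt0//.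
  rewrite mulrC ler_pdivrMr//; have : 1 <= k%:R :> R by rewrite ler1n.
  rewrite -natr1; lra.
apply/andP; split; first by rewrite mulr_ge0 ?subr_ge0.
rewrite [2 * kap]mulrC -mulrA; apply: ler_wpM2l => //; rewrite -BK.
rewrite mulrDr mulr1 in AB; rewrite lerBlDl; apply: (le_trans AB); rewrite lerD2l; exact: ler_wpM2l.
Qed.

(** By [windowS] the change of the correction trades the forms at time [k+1], which the drift
    provides, for their window averages, to which [rate_avg] applies. [er] is a defect of the
    coupling, [F1] the relative size of the drift, [df] a defect of the rate; each yields an error
    term. *)
Lemma lyap_step k x f er F1 a df : (0 < k)%N -> 0 <= er -> 0 <= F1 ->
  inner x f <= - (b / k.+1%:R * Hform k.+1 x x) - (coupling k.+1 - er) * Pform k.+1 x x ->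
  inner f f <= F1 ^+ 2 * inner x x ->
  a - df <= rate (k.+1%:R * coupling k.+1) ->
  lyap k.+1 (x + f) (x + f) <= lyap k x x - 2 * a / k.+1%:R * inner x x
    + (2 * er * Pbound + F1 ^+ 2 + 4 * (corr_bound * k.+1%:R `^ (- (1 - e0))) * F1
       + 4 * corr_bound * k.+1%:R `^ (- (2 - e0)) + 2 * df / k.+1%:R) * inner x x.
Proof.
move=> k0 er0 F10 Hd Hf Hr.
have Kp : 0 < k.+1%:R :> R by rewrite ltr0n.
have kp : 0 < k%:R :> R by rewrite ltr0n.
set J := inner x x in Hf *; have J0 : 0 <= J by exact: inner_ge0.
set Lk := corr_bound * k.+1%:R `^ (- (1 - e0)).
have Lk0 : 0 <= Lk by rewrite mulr_ge0 ?corr_bound_ge0 ?powR_ge0.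
have c0 := coupling_ge0 k.+1.
(* Cauchy-Schwarz for the form [corr k.+1] itself, after squaring. *)
have cross : - corr k.+1 x f <= Lk * F1 * J.
  have LFJ : 0 <= Lk * F1 * J by apply: mulr_ge0 => //; exact: mulr_ge0.
  have h : `|corr k.+1 x f| <= Lk * F1 * J.
    rewrite -(@ler_pXn2r _ 2) ?nnegrE ?LFJ// real_normK ?num_real//.
    apply: (le_trans (psd_cauchy x f (corr_psd k.+1))).
    have -> : (Lk * F1 * J) ^+ 2 = (Lk * J) * (Lk * (F1 ^+ 2 * J)) by ring.
    apply: ler_pM; [exact: (psd_ge0 x (corr_psd _))|exact: (psd_ge0 f (corr_psd _))| |].
      exact: corr_le.
    by apply: (le_trans (corr_le f (ltn0Sn k))); exact: ler_wpM2l.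
  by apply: le_trans h; rewrite -normrN ler_norm.
have corrf := psd_ge0 f (corr_psd k.+1).
have Pl := Pform_le k.+1 x; rewrite -/J in Pl.
have erP : er * Pform k.+1 x x <= er * (Pbound * J) by exact: ler_wpM2l.
have tH : Hwin k.+1 x x - Hwin k x x = Havg k.+1 x - Hform k.+1 x x.
  exact: (@windowS _ p (fun j => Hform j x x) k p_gt0).
have tP : Pwin k.+1 x x - Pwin k x x = Pavg k.+1 x - Pform k.+1 x x.
  exact: (@windowS _ n (fun j => Pform j x x) k n_gt0).
have avg := rate_avg k.+1 x (mulr_ge0 (ltW Kp) c0); rewrite -/J in avg.
have avg' : (a - df) / k.+1%:R * J <= b / k.+1%:R * Havg k.+1 x + coupling k.+1 * Pavg k.+1 x.
  have -> : b / k.+1%:R * Havg k.+1 x + coupling k.+1 * Pavg k.+1 x =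
    k.+1%:R^-1 * (b * Havg k.+1 x + k.+1%:R * coupling k.+1 * Pavg k.+1 x).
    by field; rewrite gt_eqF.
  rewrite mulrAC mulrC; apply: ler_wpM2l; first by rewrite invr_ge0 ltW.
  by apply: le_trans avg; exact: ler_wpM2r.
have bd : b / k%:R - b / k.+1%:R <= 2 * b * k.+1%:R `^ (- (2 - e0)).
  have -> : b / k%:R - b / k.+1%:R = b * (k%:R^-1 * k.+1%:R^-1).
    by rewrite -natr1; field; rewrite natr1 !gt_eqF.
  rewrite [2 * b]mulrC -mulrA; apply: ler_wpM2l; first exact: ltW.
  have kK : k%:R^-1 <= 2 * k.+1%:R^-1 :> R.
    rewrite -(invrK 2) -invfM lef_pV2 ?posrE ?mulr_gt0 ?invr_gt0//.
    rewrite mulrC ler_pdivrMr//; have : 1 <= k%:R :> R by rewrite ler1n.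
    rewrite -natr1; lra.
  apply: (@le_trans _ _ (2 * k.+1%:R^-1 * k.+1%:R^-1)).
    by apply: ler_wpM2r => //; rewrite invr_ge0 ltW.
  rewrite -mulrA; apply: ler_wpM2l => //; rewrite -natpow_N1 -natpowD//.
  by apply: natpow_mono => //; have := e0_range; lra.
have /andP[_ cd] := coupling_diff k0.
have Hk0 := psd_ge0 x (Hwin_psd k); have Pk0 := psd_ge0 x (Pwin_psd k).
have cs := corr_sum_le k x; rewrite -/J in cs.
set p2 := k.+1%:R `^ (- (2 - e0)) in bd cd *.
have p20 : 0 <= p2 by exact: powR_ge0.
have err : (b / k%:R - b / k.+1%:R) * Hwin k x x
    + (coupling k - coupling k.+1) * Pwin k x x <= 2 * corr_bound * p2 * J.
  apply: (@le_trans _ _ (2 * p2 * (b * Hwin k x x + kap * Pwin k x x))).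
    apply: (le_trans (lerD (ler_wpM2r Hk0 bd) (ler_wpM2r Pk0 cd))).
    by rewrite le_eqVlt; apply/orP; left; apply/eqP; ring.
  have -> : 2 * corr_bound * p2 * J = 2 * p2 * (corr_bound * J) by ring.
  by apply: ler_wpM2l => //; exact: mulr_ge0.
rewrite /lyap (psd_sqrD _ _ inner_psd) (psd_sqrD _ _ (corr_psd _)) -/J.
have cK1 : corr k.+1 x x + b / k.+1%:R * Hform k.+1 x x + coupling k.+1 * Pform k.+1 x x
   = b / k.+1%:R * Hwin k x x + coupling k.+1 * Pwin k x x
     + (b / k.+1%:R * Havg k.+1 x + coupling k.+1 * Pavg k.+1 x).
  have -> : Hwin k x x = Hwin k.+1 x x - Havg k.+1 x + Hform k.+1 x x by lra.
  have -> : Pwin k x x = Pwin k.+1 x x - Pavg k.+1 x + Pform k.+1 x x by lra.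
  by rewrite /corr; ring.
have cK : corr k x x = b / k%:R * Hwin k x x + coupling k * Pwin k x x by [].
have -> : 2 * a / k.+1%:R * J = 2 * (a / k.+1%:R * J) by rewrite !mulrA.
have -> : (2 * er * Pbound + F1 ^+ 2 + 4 * Lk * F1 + 4 * corr_bound * p2 + 2 * df / k.+1%:R) * J
  = 2 * (er * (Pbound * J)) + F1 ^+ 2 * J + 4 * (Lk * F1 * J) + 2 * (2 * corr_bound * p2 * J)
    + 2 * (df / k.+1%:R * J) by ring.
have -> : (a / k.+1%:R * J) = (a - df) / k.+1%:R * J + df / k.+1%:R * J by ring.
rewrite mulrBl in Hd.
have err' : b / k%:R * Hwin k x x + coupling k * Pwin k x x <=
   b / k.+1%:R * Hwin k x x + coupling k.+1 * Pwin k x x + 2 * corr_bound * p2 * J.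
  by move: err; rewrite !mulrBl; move: (_ * Hwin k x x) (_ * Hwin k x x)
    (_ * Pwin k x x) (_ * Pwin k x x) => *; lra.
rewrite -cK in err'.
move: (b / k.+1%:R * Hform k.+1 x x) (coupling k.+1 * Pform k.+1 x x) (er * Pform k.+1 x x)
  Hd cK1 erP => t1 t2 t3 Hd cK1 erP.
move: (b / k.+1%:R * Hwin k x x + coupling k.+1 * Pwin k x x)
  (b / k.+1%:R * Havg k.+1 x + coupling k.+1 * Pavg k.+1 x) cK1 err' avg' => t4 t5 cK1 err' avg'.
move: ((a - df) / k.+1%:R * J) (df / k.+1%:R * J) (er * (Pbound * J)) (F1 ^+ 2 * J)
  (Lk * F1 * J) (2 * corr_bound * p2 * J) erP Hf cross err' avg' => *.
lra.
Qed.

(** All errors are brought to order [K^-(1+s)]. The squared drift needs [1 + s <= 2g]; the cross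
    term, of order [K^-(1-e0+g)], is small enough because [e0] and [s] are at most 1/4. The outer
    factor 2 comes from [inner <= 2 lyap]. *)
Lemma lyap_contract (a F g s Cer Cdf : R) k x f : (0 < k)%N ->
  0 <= a -> 0 <= F -> 0 < s <= 4^-1 -> 1 + s <= 2 * g -> 0 <= Cer -> 0 <= Cdf ->
  corr_bound * k%:R `^ (- (1 - e0)) <= 4^-1 ->
  inner x f <= - (b / k.+1%:R * Hform k.+1 x x)
    - (coupling k.+1 - Cer * k.+1%:R `^ (- (1 + s))) * Pform k.+1 x x ->
  inner f f <= (F * k.+1%:R `^ (- g)) ^+ 2 * inner x x ->
  a - Cdf * k.+1%:R `^ (- s) <= rate (k.+1%:R * coupling k.+1) ->
  lyap k.+1 (x + f) (x + f) <=
  contraction a (2 * (2 * Cer * Pbound + F ^+ 2 + 4 * corr_bound * F + 4 * corr_bound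
     + 2 * Cdf)) s k.+1 * lyap k x x.
Proof.
move=> k0 a0 F0 /andP[s0 s1] sg Cer0 Cdf0 hk Hd Hf Hr.
have /andP[e00 e01] := e0_range.
have cb0 := corr_bound_ge0; have Pb0 := Pbound_ge0.
set K := k.+1; set q : R := K%:R `^ (- (1 + s)).
have q0 : 0 <= q by exact: powR_ge0.
have Kp : 0 < K%:R :> R by rewrite ltr0n.
have er0 : 0 <= Cer * q by rewrite mulr_ge0.
have F10 : 0 <= F * K%:R `^ (- g) by rewrite mulr_ge0 ?powR_ge0.
have st := lyap_step k0 er0 F10 Hd Hf Hr.
have J0 := inner_ge0 x.
have LJ := lyap_le k x; have JL := lyap_ge x k0 hk.
have L0 : 0 <= lyap k x x by lra.
have e1 : (F * K%:R `^ (- g)) ^+ 2 <= F ^+ 2 * q.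
  rewrite exprMn; apply: ler_wpM2l; first exact: sqr_ge0.
  by rewrite expr2 -natpowD//; apply: natpow_mono => //; lra.
have e2 : corr_bound * K%:R `^ (- (1 - e0)) * (F * K%:R `^ (- g)) <= corr_bound * F * q.
  rewrite mulrACA; apply: ler_wpM2l; first exact: mulr_ge0.
  by rewrite -natpowD//; apply: natpow_mono => //; lra.
have e3 : K%:R `^ (- (2 - e0)) <= q by apply: natpow_mono => //; lra.
have e4 : K%:R `^ (- s) / K%:R = q.
  by rewrite -natpow_N1 -natpowD// /q; congr (_ `^ _); lra.
have tot : 2 * (Cer * q) * Pbound + (F * K%:R `^ (- g)) ^+ 2
    + 4 * (corr_bound * K%:R `^ (- (1 - e0))) * (F * K%:R `^ (- g))
    + 4 * corr_bound * K%:R `^ (- (2 - e0)) + 2 * (Cdf * K%:R `^ (- s)) / K%:R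
   <= (2 * Cer * Pbound + F ^+ 2 + 4 * corr_bound * F + 4 * corr_bound + 2 * Cdf) * q.
  have -> : 2 * (Cdf * K%:R `^ (- s)) / K%:R = 2 * Cdf * q by rewrite -e4; ring.
  have -> : 2 * (Cer * q) * Pbound = 2 * Cer * Pbound * q by ring.
  have -> : 4 * (corr_bound * K%:R `^ (- (1 - e0))) * (F * K%:R `^ (- g)) =
    4 * (corr_bound * K%:R `^ (- (1 - e0)) * (F * K%:R `^ (- g))) by ring.
  have e3' := ler_wpM2l cb0 e3.
  have -> : 4 * corr_bound * K%:R `^ (- (2 - e0)) = 4 * (corr_bound * K%:R `^ (- (2 - e0))).
    by ring.
  have -> : (2 * Cer * Pbound + F ^+ 2 + 4 * corr_bound * F + 4 * corr_bound + 2 * Cdf) * q =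
    2 * Cer * Pbound * q + F ^+ 2 * q + 4 * (corr_bound * F * q) + 4 * (corr_bound * q)
    + 2 * Cdf * q by ring.
  by do !apply: lerD => //; apply: ler_wpM2l.
set C := _ + 2 * Cdf in tot *.
have C0 : 0 <= C by rewrite /C !addr_ge0 ?mulr_ge0 ?sqr_ge0.
have t1 := ler_wpM2r J0 tot.
have t2 : C * q * inner x x <= C * q * (2 * lyap k x x).
  by apply: ler_wpM2l => //; exact: mulr_ge0.
have t3 : 2 * a / K%:R * lyap k x x <= 2 * a / K%:R * inner x x.
  by apply: ler_wpM2l => //; rewrite divr_ge0// mulr_ge0.
have -> : contraction a (2 * C) s K * lyap k x x =
  lyap k x x - 2 * a / K%:R * lyap k x x + C * q * (2 * lyap k x x).
  by rewrite /contraction -/q; ring.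
apply: (le_trans st); rewrite -/K.
move: (2 * a / K%:R * lyap k x x) (2 * a / K%:R * inner x x) (C * q * inner x x)
  (C * q * (2 * lyap k x x)) t1 t2 t3 => u1 u2 u3 u4.
move: (_ * inner x x) => u5 t1 t2 t3; lra.
Qed.

End Forms.

(** * The quantizer: slope, Lipschitz constant and sending probability *)

Section Quantizer.
Variables (R : realType) (N : nat) (nu b : 'I_N -> 'I_N -> R) (i j : 'I_N).
Hypothesis b_gt0 : 0 < b i j.
Hypothesis nu_ge0 : 0 <= nu i j.
Variable k : nat.
Hypothesis k_gt0 : (0 < k)%N.
Local Notation C := (Cthr nu b i j k).
Local Notation G := (Gfun nu b i j k).

Lemma Cthr_ge0 : 0 <= C.
Proof. by rewrite !mulr_ge0 ?ln_ge0 ?ler1n// ltW. Qed.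

(** The logarithmic threshold shifts the argument by [nu ln k], which multiplies the exponential
    tail by [k^(-nu)]. *)
Lemma expR_Cthr (y : R) : expR ((y - C) / b i j) = k%:R `^ (- nu i j) * expR (y / b i j).
Proof.
rewrite /powR gt_eqF ?ltr0n// -expRD; congr expR.
by rewrite /Cthr; field; rewrite gt_eqF.
Qed.

(** Each of the two terms of [G] contributes half of the slope; their arguments stay within
    [(K + C)/b], where the density is at least [k^(-nu) exp(-K/b)/2]. *)
Lemma Gfun_lower (K x y : R) : y <= x -> `|x| <= K -> `|y| <= K ->
  k%:R `^ (- nu i j) * (expR (- K / b i j) / b i j) * (x - y) <= G x - G y.
Proof.
move=> yx xK yK; have C0 := Cthr_ge0.
have aux u : `|u| <= K -> `|(u - C) / b i j| <= (K + C) / b i j.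
  move=> uK; rewrite normrM [X in _ * X]ger0_norm ?invr_ge0 ?(ltW b_gt0)//.
  rewrite ler_pM2r ?invr_gt0//; apply: (le_trans (ler_normB _ _)).
  by rewrite (ger0_norm C0) lerD2r.
have h1 := @lapF_incr_ge R ((x - C) / b i j) ((y - C) / b i j) ((K + C) / b i j).
have h2 := @lapF_incr_ge R ((- y - C) / b i j) ((- x - C) / b i j) ((K + C) / b i j).
have := h1 _ (aux _ xK) (aux _ yK); rewrite ler_pM2r ?invr_gt0// lerD2r => /(_ yx) {}h1.
have := h2 _ (aux _ _) (aux _ _); rewrite ler_pM2r ?invr_gt0// lerD2r lerN2 !normrN.
move=> /(_ yx yK xK) {}h2.
have eE : expR (- ((K + C) / b i j)) = k%:R `^ (- nu i j) * expR (- K / b i j).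
  by rewrite -expR_Cthr; congr expR; rewrite -mulNr opprD.
rewrite eE in h1 h2; rewrite /Gfun.
have -> : k%:R `^ (- nu i j) * (expR (- K / b i j) / b i j) * (x - y) =
  k%:R `^ (- nu i j) * expR (- K / b i j) / 2 * ((x - C) / b i j - (y - C) / b i j) +
  k%:R `^ (- nu i j) * expR (- K / b i j) / 2 * ((- y - C) / b i j - (- x - C) / b i j).
  by field; rewrite gt_eqF.
lra.
Qed.

Lemma Gfun_lip (x y : R) : `|G x - G y| <= `|x - y| / b i j.
Proof.
have -> : G x - G y = (lapF ((x - C) / b i j) - lapF ((y - C) / b i j)) +
   (lapF ((- y - C) / b i j) - lapF ((- x - C) / b i j)) by rewrite /Gfun; ring.
apply: (le_trans (ler_normD _ _)).
have := lapF_lipschitz ((x - C) / b i j) ((y - C) / b i j).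
have := lapF_lipschitz ((- y - C) / b i j) ((- x - C) / b i j).
have -> : (- y - C) / b i j - (- x - C) / b i j = (x - y) / b i j by field; rewrite gt_eqF.
have -> : (x - C) / b i j - (y - C) / b i j = (x - y) / b i j by field; rewrite gt_eqF.
rewrite normrM [`|(b i j)^-1|]ger0_norm ?invr_ge0 ?(ltW b_gt0)//; lra.
Qed.

Lemma trigger_prob_le (x : R) : lapF ((x - C) / b i j) + lapF ((- x - C) / b i j) <=
  k%:R `^ (- nu i j) * expR (`|x| / b i j).
Proof.
have := lapF_le_expR ((x - C) / b i j); have := lapF_le_expR ((- x - C) / b i j).
rewrite !expR_Cthr.
have h (u : R) : u <= `|x| -> k%:R `^ (- nu i j) * expR (u / b i j) <=
    k%:R `^ (- nu i j) * expR (`|x| / b i j).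
  move=> ux; apply: ler_wpM2l; first exact: powR_ge0.
  by rewrite ler_expR ler_pM2r ?invr_gt0.
have h1 := h x (ler_norm _); have h2 : - x <= `|x| by rewrite -normrN ler_norm.
have h3 := h _ h2; lra.
Qed.

Lemma trigger_prob_le2 (x : R) : lapF ((x - C) / b i j) + lapF ((- x - C) / b i j) <= 2.
Proof.
have := lapF_le1 ((x - C) / b i j); have := lapF_le1 ((- x - C) / b i j); lra.
Qed.

Lemma Gfun_norm_le1 (x : R) : `|G x| <= 1.
Proof.
have := lapF_le1 ((x - C) / b i j); have := lapF_le1 ((- x - C) / b i j).
have := lapF_ge0 ((x - C) / b i j); have := lapF_ge0 ((- x - C) / b i j).
by rewrite ler_norml /Gfun; lra.
Qed.

End Quantizer.

(** * The error recursion *)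

Section Dynamics.
Variables (R : realType) (N n : nat) (m : 'I_N -> nat).
Variables (aw nu b alpha1 gam : 'I_N -> 'I_N -> R) (beta1 : 'I_N -> R).
Variable H : forall i : 'I_N, nat -> 'M[R]_(m i, n).
Variables (theta : 'cV[R]_n) (theta0 : 'I_N -> 'cV[R]_n).
Hypothesis n_gt0 : (0 < n)%N.
Hypothesis aw_ge0 : forall i j, 0 <= aw i j.
Hypothesis aw_sym : forall i j, aw i j = aw j i.
Variable Hbar : R.
Hypothesis Hbar_gt0 : 0 < Hbar.
Hypothesis H_bnd : forall i k, (0 < k)%N -> opnorm_le (H i k) Hbar.
Hypothesis nu_ge0 : forall i j, 0 < aw i j -> 0 <= nu i j.
Hypothesis nu_sym : forall i j, 0 < aw i j -> nu i j = nu j i.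
Hypothesis b_gt0 : forall i j, 0 < aw i j -> 0 < b i j.
Hypothesis b_sym : forall i j, 0 < aw i j -> b i j = b j i.
Hypothesis alpha1_gt0 : forall i j, 0 < aw i j -> 0 < alpha1 i j.
Hypothesis alpha1_sym : forall i j, 0 < aw i j -> alpha1 i j = alpha1 j i.
Hypothesis beta1_gt0 : forall i, 0 < beta1 i.
Hypothesis gam_sym : forall i j, 0 < aw i j -> gam i j = gam j i.
Variable bmin : R.
Hypothesis bmin_le : forall i, bmin <= beta1 i.
Variable g0 : R.
Hypothesis g0_range : 0 <= g0 <= 1.
Hypothesis g0_le : forall i j, 0 < aw i j -> g0 <= gam i j.

Local Notation alpha := (fun i j (k : nat) => alpha1 i j / (k%:R `^ gam i j)).
Local Notation beta := (fun i (k : nat) => beta1 i / k%:R).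
Local Notation E := 'M[R]_(N, n).
Local Notation tc := (tcoord n_gt0).
Local Notation G := (Gfun nu b).

Lemma Gfun_sym i j k x : 0 < aw i j -> G i j k x = G j i k x.
Proof. by move=> a0; rewrite /Gfun /Cthr nu_sym// b_sym. Qed.

(* row [i] of [x] is the estimation error of sensor [i] *)
Definition exchange (K : nat) (x : E) (i : 'I_N) : R :=
  \sum_(j < N | 0 < aw i j) alpha i j K * aw i j *
    (G i j K (x j (tc K) + theta (tc K) 0) - G i j K (x i (tc K) + theta (tc K) 0)).

Definition drift (K : nat) (x : E) : E :=
  \matrix_(i, l) ((l == tc K)%:R * exchange K x i
    - beta i K * ((H i K)^T *m (H i K *m rowv x i)) l 0).

(** Indices of the scalar noises: a pair (receiver, sender), or one coordinate of the observation
    noise of one sensor. Pairs that are not edges get gain 0. *)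
Local Notation J := (('I_N * 'I_N) + {i : 'I_N & 'I_(m i)})%type.

Definition gain (q : J) (K : nat) : E :=
  match q with
  | inl (i, j) => (if 0 < aw i j then alpha i j K * aw i j else 0) *: delta_mx i (tc K)
  | inr q' => \matrix_(i', l) ((i' == projT1 q')%:R *
                (beta (projT1 q') K * H (projT1 q') K (projT2 q') l))
  end.

Section Path.
Variables (w : forall i : 'I_N, nat -> 'cV[R]_(m i)) (dn : 'I_N -> nat -> R).
Local Notation est := (SC_est aw nu b alpha beta H theta theta0 w dn).

Definition err (k : nat) : E := \matrix_(i, l) (est k i l 0 - theta l 0).

(** A received message is centred by [G] at the state of the sender [j], its conditional mean given
    the past. The index [k] refers to the noise entering at step [k+1]. *)
Definition noise (q : J) (k : nat) : R :=
  match q with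
  | inl (i, j) => if 0 < aw i j then shat nu b dn (est k) j i k.+1
        - G j i k.+1 (err k j (tc k.+1) + theta (tc k.+1) 0) else 0
  | inr q' => w (projT1 q') k.+1 (projT2 q') 0
  end.

Lemma xval_err k i : xval (est k) k.+1 i = err k i (tc k.+1) + theta (tc k.+1) 0.
Proof. by rewrite /xval (phiE n_gt0) mxE subrK. Qed.

Lemma noise_exchange k i l :
  (\sum_(p : 'I_N * 'I_N) noise (inl p) k *: gain (inl p) k.+1) i l =
  (l == tc k.+1)%:R * \sum_(j < N | 0 < aw i j) alpha i j k.+1 * aw i j *
      (shat nu b dn (est k) j i k.+1 - G i j k.+1 (err k j (tc k.+1) + theta (tc k.+1) 0)).
Proof.
pose F i' j := (noise (inl (i', j)) k *: gain (inl (i', j)) k.+1) i l.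
rewrite summxE (eq_bigr (fun p => F p.1 p.2)); last by case.
rewrite -(pair_bigA _ F)/= /F.
rewrite (bigD1 i)//= [X in _ + X]big1 ?addr0; last first.
  move=> i' /negPf ii'; apply: big1 => j _.
  by rewrite !mxE [i == _]eq_sym ii' !mulr0.
rewrite mulr_sumr [RHS]big_mkcond; apply: eq_bigr => j _.
rewrite !mxE eqxx /=; case: ifPn => a0; last by rewrite mul0r.
by rewrite (Gfun_sym _ _ a0); ring.
Qed.

Lemma noise_obs k i l :
  (\sum_(q : {i : 'I_N & 'I_(m i)}) noise (inr q) k *: gain (inr q) k.+1) i l =
  beta i k.+1 * ((H i k.+1)^T *m w i k.+1) l 0.
Proof.
pose F i' q := (noise (inr (existT _ i' q)) k *: gain (inr (existT _ i' q)) k.+1) i l.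
rewrite summxE (eq_bigr (fun p => F (tag p) (tagged p))); last by case.
rewrite -(sig_big_dep xpredT (fun _ _ => true) F)/= /F.
rewrite (bigD1 i)//= [X in _ + X]big1 ?addr0; last first.
  move=> i' /negPf ii'; apply: big1 => q _.
  by rewrite !mxE /= [i == _]eq_sym ii' mul0r mulr0.
rewrite mxE mulr_sumr; apply: eq_bigr => q _.
by rewrite !mxE /= eqxx mul1r; ring.
Qed.

(** The receiver subtracts [G] at its own state; adding and subtracting [G] at the state of the
    sender splits the update into [exchange] and a centred noise. The functions [G] of the two
    directions agree by symmetry of [nu] and [b]. *)
Lemma err_step k : err k.+1 = err k + drift k.+1 (err k) + \sum_q noise q k *: gain q k.+1.
Proof.
rewrite big_sumType/=; apply/matrixP => i l.
have addE (r c : nat) (A B : 'M[R]_(r, c)) i' j' : (A + B) i' j' = A i' j' + B i' j'.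
  by rewrite mxE.
have scaleE (r c : nat) s (A : 'M[R]_(r, c)) i' j' : (s *: A) i' j' = s * A i' j'.
  by rewrite mxE.
rewrite [RHS]addE [X in _ = X + _]addE [X in _ = _ + X]addE noise_exchange noise_obs.
rewrite [err k.+1 i l]mxE [err k i l]mxE [drift _ _ i l]mxE.
set K := k.+1; rewrite [est K]/= -/K; set e := est k.
have rE : e i - theta = rowv (err k) i by apply/colP => l'; rewrite !mxE.
have yE : yobs H theta w i K - H i K *m e i = w i K - H i K *m rowv (err k) i.
  by rewrite /yobs -rE mulmxBr; apply/colP => l'; rewrite !mxE; ring.
have lE : phi R n K l 0 = (l == tc K)%:R by rewrite mxE.
rewrite /SC_step !addE !scaleE lE yE mulmxBr addE [(- _ : 'cV_n) l 0]mxE.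
have -> : \sum_(j < N | 0 < aw i j) alpha i j K * aw i j *
     (shat nu b dn e j i K - G i j K (xval e K i)) =
  exchange K (err k) i + \sum_(j < N | 0 < aw i j) alpha i j K * aw i j *
      (shat nu b dn e j i K - G i j K (err k j (tc K) + theta (tc K) 0)).
  rewrite -big_split/=; apply: eq_bigr => j a0; rewrite /e xval_err -/K; ring.
ring.
Qed.

End Path.

(** Averaging the consensus sum with its copy in which [i] and [j] are exchanged turns
    [X i * (G (Y j) - G (Y i))] into minus half of [(X i - X j) * (G (Y i) - G (Y j))], to which the
    hypothesis applies edge by edge. *)
Lemma inner_drift K (x : E) (c : R) : (0 < K)%N ->
  (forall i j, 0 < aw i j ->
     c * (x i (tc K) - x j (tc K)) ^+ 2 <= alpha i j K * ((x i (tc K) - x j (tc K)) *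
       (G i j K (x i (tc K) + theta (tc K) 0) - G i j K (x j (tc K) + theta (tc K) 0)))) ->
  inner x (drift K x) <= - (bmin / K%:R * Hform H K x x) - c * Pform aw n_gt0 K x x.
Proof.
move=> K0 Hc; have Kp : 0 < K%:R :> R by rewrite ltr0n.
have -> : inner x (drift K x) = \sum_i x i (tc K) * exchange K x i
    - \sum_i beta i K * \sum_l (H i K *m rowv x i) l 0 ^+ 2.
  rewrite -sumrB; apply: eq_bigr => i _.
  have -> : \sum_l x i l * drift K x i l =
     \sum_l (x i l * ((l == tc K)%:R * exchange K x i)
            - beta i K * (x i l * ((H i K)^T *m (H i K *m rowv x i)) l 0)).
    apply: eq_bigr => l _; rewrite [drift K x i l]mxE; ring.
  rewrite sumrB -mulr_sumr; congr (_ - _ * _).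
    rewrite (bigD1 (tc K))//= eqxx mul1r big1 ?addr0// => l /negPf ->.
    by rewrite mul0r mulr0.
  transitivity (((rowv x i)^T *m ((H i K)^T *m (H i K *m rowv x i))) 0 0).
    by rewrite mxE; apply: eq_bigr => l _; rewrite [in RHS]mxE rowvE.
  rewrite mulmxA -trmx_mul mxE; apply: eq_bigr => l _.
  by rewrite [(_ ^T) _ _]mxE expr2.
have T2 : bmin / K%:R * Hform H K x x <= \sum_i beta i K * \sum_l (H i K *m rowv x i) l 0 ^+ 2.
  rewrite mulr_sumr; apply: ler_sum => i _.
  have -> : \sum_l (H i K *m rowv x i) l 0 * (H i K *m rowv x i) l 0 =
    \sum_l (H i K *m rowv x i) l 0 ^+ 2 by apply: eq_bigr => l _; rewrite expr2.
  apply: ler_wpM2r; first by apply: sumr_ge0 => l _; exact: sqr_ge0.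
  by rewrite ler_pM2r ?invr_gt0.
pose cc i j := if 0 < aw i j then alpha i j K * aw i j else 0.
pose X i := x i (tc K); pose Y i := X i + theta (tc K) 0.
have ccs i j : cc i j = cc j i.
  by rewrite /cc (aw_sym j i); case: ifP => // a0; rewrite (alpha1_sym a0) (gam_sym a0).
have T1a : \sum_i x i (tc K) * exchange K x i =
    \sum_i \sum_j cc i j * (X i * (G i j K (Y j) - G i j K (Y i))).
  apply: eq_bigr => i _; rewrite /exchange big_mkcond mulr_sumr; apply: eq_bigr => j _.
  by rewrite /cc; case: ifP => _; rewrite ?mulr0 ?mul0r// /X /Y /X; ring.
have T1b : \sum_i \sum_j cc i j * (X i * (G i j K (Y j) - G i j K (Y i))) =
    \sum_i \sum_j cc i j * (X j * (G i j K (Y i) - G i j K (Y j))).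
  rewrite exchange_big/=; apply: eq_bigr => i _; apply: eq_bigr => j _.
  rewrite ccs /cc; case: ifP => a0; last by rewrite !mul0r.
  by rewrite !(Gfun_sym _ _ a0).
have T1c : 2 * (\sum_i \sum_j cc i j * (X i * (G i j K (Y j) - G i j K (Y i)))) <=
     - (2 * (c * Pform aw n_gt0 K x x)).
  rewrite mulr2n mulrDl mul1r [X in _ + X <= _]T1b -big_split/=.
  rewrite /Pform -[leRHS]mulrN; rewrite mulrN !mulr_sumr -sumrN.
  apply: ler_sum => i _; rewrite -big_split/= !mulr_sumr -sumrN; apply: ler_sum => j _.
  rewrite -/(X i) -/(X j) /cc; case: ifPn => a0; last first.
    have -> : aw i j = 0 by apply/eqP; rewrite eq_le aw_ge0 andbT leNgt.
    by rewrite !mul0r !mulr0 addr0 oppr0.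
  have := ler_wpM2l (ltW a0) (Hc i j a0); rewrite -/(X i) -/(X j) -/(Y i) -/(Y j) => h.
  have -> : alpha i j K * aw i j * (X i * (G i j K (Y j) - G i j K (Y i))) +
    alpha i j K * aw i j * (X j * (G i j K (Y i) - G i j K (Y j))) =
    - (aw i j * (alpha i j K * ((X i - X j) * (G i j K (Y i) - G i j K (Y j))))) by ring.
  have -> : 2 * (c * (aw i j / 2 * ((X i - X j) * (X i - X j)))) =
    aw i j * (c * (X i - X j) ^+ 2) by field.
  by rewrite lerN2.
rewrite T1a; lra.
Qed.

Local Notation sI x := (Num.sqrt (inner x x)).

Let sI_sqr (x : E) : sI x ^+ 2 = inner x x.
Proof. by rewrite sqr_sqrtr// (psd_ge0 x (inner_psd R N n)). Qed.

Lemma coord_le_sqrt (x : E) i l : `|x i l| <= sI x.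
Proof. by rewrite -sqrtr_sqr ler_sqrt ?(psd_ge0 x (inner_psd R N n))// coord_le_inner. Qed.

Lemma H_entry i k q l : (0 < k)%N -> `|H i k q l| <= Hbar.
Proof.
move=> k0; have := @opnorm_sq R n Hbar Hbar_gt0 _ (H i k) (delta_mx l 0) (H_bnd i k0).
have -> : \sum_l' (delta_mx l 0 : 'cV[R]_n) l' 0 ^+ 2 = 1.
  rewrite (bigD1 l)//= mxE !eqxx expr1n big1 ?addr0// => l' /negPf ll.
  by rewrite mxE ll expr0n.
rewrite mulr1 -colE => h.
rewrite -(@ler_pXn2r _ 2) ?nnegrE ?(ltW Hbar_gt0)// real_normK ?num_real//.
apply: le_trans h; rewrite (bigD1 q)//= mxE lerDl.
by apply: sumr_ge0 => ? _; exact: sqr_ge0.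
Qed.

Lemma Hx_entry i k (x : E) q : (0 < k)%N -> `|(H i k *m rowv x i) q 0| <= Hbar * sI x.
Proof.
move=> k0; have h := @opnorm_sq R n Hbar Hbar_gt0 _ (H i k) (rowv x i) (H_bnd i k0).
have Hs : 0 <= Hbar * sI x by rewrite mulr_ge0// ltW.
rewrite -(@ler_pXn2r _ 2) ?nnegrE// real_normK ?num_real// exprMn sI_sqr.
apply: (@le_trans _ _ (\sum_l (H i k *m rowv x i) l 0 ^+ 2)).
  by rewrite (bigD1 q)//= lerDl; apply: sumr_ge0 => ? _; exact: sqr_ge0.
apply: (le_trans h); apply: ler_wpM2l; first exact: sqr_ge0.
rewrite innerE (bigD1 i)//=; under eq_bigr do rewrite rowvE.
by rewrite lerDl; do 2 (apply: sumr_ge0 => ? _); exact: sqr_ge0.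
Qed.

(** Entrywise, from the Lipschitz constant [1/b] of [G] and the norm bound on [H]; every step size
    decays at least like [K^(-g0)]. *)
Lemma drift_bound : exists F : R, 0 <= F /\ forall K (x : E), (0 < K)%N ->
  inner (drift K x) (drift K x) <= (F * K%:R `^ (- g0)) ^+ 2 * inner x x.
Proof.
pose Fi i : R := (\sum_(j < N | 0 < aw i j) alpha1 i j * aw i j * (2 / b i j))
  + beta1 i * (m i)%:R * Hbar ^+ 2.
have Fi0 i : 0 <= Fi i.
  rewrite addr_ge0 ?mulr_ge0 ?(ltW Hbar_gt0) ?(ltW (beta1_gt0 _))//.
  apply: sumr_ge0 => j a0.
  by rewrite !mulr_ge0 ?invr_ge0 ?(ltW (alpha1_gt0 a0)) ?(ltW (b_gt0 a0)).
exists (Num.sqrt (\sum_(i < N) \sum_(l < n) (Fi i ^+ 2))); split; first exact: sqrtr_ge0.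
move=> K x K0; have Kp : 0 < K%:R :> R by rewrite ltr0n.
have /andP[g00 g01] := g0_range.
set P := K%:R `^ (- g0); have P0 : 0 <= P by exact: powR_ge0.
have entry i l : `|drift K x i l| <= Fi i * P * sI x.
  rewrite mxE; apply: (le_trans (ler_normB _ _)); rewrite /Fi !mulrDl; apply: lerD.
    apply: (@le_trans _ _ `|exchange K x i|).
      by rewrite normrM; case: (l == _); rewrite ?normr1 ?normr0 ?mul1r ?mul0r.
    apply: (le_trans (ler_norm_sum _ _ _)); rewrite !mulr_suml; apply: ler_sum => j a0.
    have bp := b_gt0 a0; have ap := alpha1_gt0 a0.
    rewrite normrM ger0_norm; last by rewrite !mulr_ge0 ?invr_ge0 ?powR_ge0// ltW.
    have -> : alpha1 i j * aw i j * (2 / b i j) * P * sI x =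
      (alpha1 i j * P * aw i j) * (2 * sI x / b i j) by ring.
    apply: ler_pM => //.
    - by rewrite !mulr_ge0 ?invr_ge0 ?powR_ge0// ltW.
    - apply: ler_wpM2r => //; apply: ler_wpM2l; first exact: ltW.
      rewrite -powRN; apply: natpow_mono => //; rewrite lerN2; exact: g0_le.
    - apply: (le_trans (Gfun_lip nu bp K _ _)); rewrite ler_pM2r ?invr_gt0//.
      have -> : x j (tc K) + theta (tc K) 0 - (x i (tc K) + theta (tc K) 0) =
        x j (tc K) - x i (tc K) by ring.
      apply: (le_trans (ler_normB _ _)).
      by have := coord_le_sqrt x j (tc K); have := coord_le_sqrt x i (tc K); lra.
  rewrite normrM ger0_norm; last by rewrite divr_ge0// ltW.
  have -> : beta1 i * (m i)%:R * Hbar ^+ 2 * P * sI x =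
    (beta1 i * P) * ((m i)%:R * (Hbar * (Hbar * sI x))) by ring.
  apply: ler_pM => //; first by rewrite divr_ge0// ltW.
    apply: ler_wpM2l; first exact: ltW.
    by rewrite -natpow_N1; apply: natpow_mono => //; rewrite lerN2.
  rewrite mxE; apply: (le_trans (ler_norm_sum _ _ _)).
  apply: (@le_trans _ _ (\sum_(q < m i) Hbar * (Hbar * sI x))).
    apply: ler_sum => q _; rewrite mxE normrM; apply: ler_pM => //.
      exact: H_entry.
    exact: Hx_entry.
  by rewrite sumr_const card_ord mulr_natl.
have S0 : 0 <= \sum_(i < N) \sum_(l < n) Fi i ^+ 2.
  by do 2 (apply: sumr_ge0 => ? _); exact: sqr_ge0.
rewrite innerE exprMn sqr_sqrtr// -mulrA mulr_suml; apply: ler_sum => i _.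
rewrite mulr_suml; apply: ler_sum => l _.
rewrite -sI_sqr -!exprMn -[leLHS]real_normK ?num_real//.
by rewrite lerXn2r ?nnegrE ?mulr_ge0// mulrA.
Qed.

Definition gain_bound (q : J) (K : nat) : R :=
  match q with
  | inl (i, j) => if 0 < aw i j then (alpha1 i j * aw i j) ^+ 2 * K%:R `^ (- (2 * gam i j)) else 0
  | inr q' => beta1 (projT1 q') ^+ 2 * (n%:R * Hbar ^+ 2) * K%:R `^ (- 2)
  end.

Lemma gain_le q K : (0 < K)%N -> inner (gain q K) (gain q K) <= gain_bound q K.
Proof.
move=> K0; have Kp : 0 < K%:R :> R by rewrite ltr0n.
rewrite innerE; case: q => [[i j]|[i q]] /=.
  rewrite (bigD1 i)//= [X in _ + X]big1 ?addr0; last first.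
    move=> i' /negPf ii; apply: big1 => l _.
    by rewrite !mxE ii mulr0 expr0n.
  rewrite (bigD1 (tc K))//= [X in _ + X]big1 ?addr0; last first.
    by move=> l /negPf ll; rewrite !mxE ll andbF mulr0 expr0n.
  rewrite !mxE !eqxx mulr1; case: ifP => // a0; last by rewrite expr0n.
  have -> : K%:R `^ (- (2 * gam i j)) = (K%:R `^ (- gam i j)) ^+ 2.
    by rewrite expr2 -natpowD//; congr (_ `^ _); ring.
  by rewrite -exprMn powRN mulrAC.
rewrite (bigD1 i)//= [X in _ + X]big1 ?addr0; last first.
  move=> i' /negPf ii; apply: big1 => l _.
  by rewrite !mxE /= ii mul0r expr0n.
have -> : K%:R `^ (- 2) = K%:R^-1 ^+ 2 :> R.
  by rewrite -natpow_N1 expr2 -natpowD//; congr (_ `^ _); ring.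
apply: (@le_trans _ _ (\sum_(l < n) (beta1 i / K%:R) ^+ 2 * Hbar ^+ 2)).
  apply: ler_sum => l _; rewrite !mxE /= eqxx mul1r exprMn.
  apply: ler_wpM2l; first exact: sqr_ge0.
  rewrite -real_normK ?num_real// lerXn2r ?nnegrE ?(ltW Hbar_gt0)//.
  exact: H_entry.
rewrite sumr_const card_ord -[leLHS]mulr_natl exprMn.
by rewrite le_eqVlt; apply/orP; left; apply/eqP; ring.
Qed.

End Dynamics.

(** * Measurability of the recursion *)

Section FormMeasurability.
Context {R : realType} {d : measure_display} {T : measurableType d}.
Variables (N n : nat) (m : 'I_N -> nat).
Variables (aw nu b alpha1 gam : 'I_N -> 'I_N -> R) (beta1 : 'I_N -> R).
Variable H : forall i : 'I_N, nat -> 'M[R]_(m i, n).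
Variable theta : 'cV[R]_n.
Hypothesis n_gt0 : (0 < n)%N.
Implicit Types X Y : T -> 'M[R]_(N, n).

(** Used with [T] carrying the sigma-algebra generated by [Gwd w dn k], where measurability means
    adaptedness. *)
Definition measurable_entries X := forall i l, measurable_fun setT (fun t => X t i l).

Lemma measurable_entriesD X Y : measurable_entries X -> measurable_entries Y ->
  measurable_entries (fun t => X t + Y t).
Proof.
move=> mX mY i l; rewrite (_ : (fun _ => _) = (fun t => X t i l + Y t i l)).
  exact: measurable_funD.
by apply/funext => t; rewrite mxE.
Qed.

Lemma inner_measurable X Y : measurable_entries X -> measurable_entries Y ->
  measurable_fun setT (fun t => inner (X t) (Y t)).
Proof.
by move=> mX mY; apply: measurable_sum => i; apply: measurable_sum => l; apply: measurable_funM.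
Qed.

Lemma rowv_mul_measurable X i k q : measurable_entries X ->
  measurable_fun setT (fun t => (H i k *m rowv (X t) i) q 0).
Proof.
move=> mX; rewrite (_ : (fun _ => _) = (fun t => \sum_l H i k q l * X t i l)).
  by apply: measurable_sum => l; apply: measurable_funM.
by apply/funext => t; rewrite mxE; apply: eq_bigr => l _; rewrite rowvE.
Qed.

Lemma lyap_measurable bm p kap e0 K X Y : measurable_entries X -> measurable_entries Y ->
  measurable_fun setT (fun t => lyap aw H n_gt0 bm p kap e0 K (X t) (Y t)).
Proof.
move=> mX mY; apply: measurable_funB; first exact: inner_measurable.
apply: measurable_funM => //; apply: measurable_funD; apply: measurable_funM => //;
  apply: measurable_sum => s; apply: measurable_funM => //; apply: measurable_sum => i;
  apply: measurable_sum => j.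
  by apply: measurable_funM; exact: rowv_mul_measurable.
by apply: measurable_funM => //; apply: measurable_funM; apply: measurable_funB.
Qed.

Lemma lapF_comp_measurable (f : T -> R) : measurable_fun setT f ->
  measurable_fun setT (fun t => lapF (f t)).
Proof. by move=> mf; apply: measurableT_comp => //; exact: measurable_lapF. Qed.

Lemma Gfun_measurable i j K (f : T -> R) : measurable_fun setT f ->
  measurable_fun setT (fun t => Gfun nu b i j K (f t)).
Proof.
move=> mf; apply: measurable_funB; apply: lapF_comp_measurable; apply: measurable_funM => //.
  exact: measurable_funB.
by apply: measurable_funB => //; exact: measurableT_comp.
Qed.

Lemma drift_measurable K X : measurable_entries X ->
  measurable_entries (fun t => drift aw nu b alpha1 gam beta1 H theta n_gt0 K (X t)).
Proof.
move=> mX i l; under eq_fun do rewrite mxE.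
apply: measurable_funB; apply: measurable_funM => //.
  rewrite /exchange; under eq_fun do rewrite big_mkcond.
  apply: measurable_sum => j; case: (0 < aw i j) => //; apply: measurable_funM => //.
  by apply: measurable_funB; apply: Gfun_measurable; apply: measurable_funD.
rewrite (_ : (fun _ => _) = (fun t => \sum_q (H i K)^T l q * (H i K *m rowv (X t) i) q 0)).
  by apply: measurable_sum => q; apply: measurable_funM => //; exact: rowv_mul_measurable.
by apply/funext => t; rewrite mxE.
Qed.

Lemma onebit_comp_measurable (C : R) (f : T -> R) : measurable_fun setT f ->
  measurable_fun setT (fun t => onebit C (f t)).
Proof.
move=> mf; apply: measurable_fun_ifT => //.
  by apply: measurable_fun_ltr => //; exact: measurableT_comp.
by apply: measurable_fun_ifT => //; exact: measurable_fun_ltr.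
Qed.

End FormMeasurability.

(** * Conditional moments of the innovations *)

Section NoiseMoments.
Context {R : realType} {d : measure_display} {T : measurableType d}.
Variable P : probability T R.
Variables (N n : nat) (m : 'I_N -> nat).
Variables (aw nu b alpha1 gam : 'I_N -> 'I_N -> R) (beta1 : 'I_N -> R).
Variable H : forall i : 'I_N, nat -> 'M[R]_(m i, n).
Variables (theta : 'cV[R]_n) (theta0 : 'I_N -> 'cV[R]_n).
Variable w : forall i : 'I_N, nat -> T -> 'cV[R]_(m i).
Variable dn : 'I_N -> nat -> T -> R.
Hypothesis n_gt0 : (0 < n)%N.
Hypothesis aw_sym : forall i j, aw i j = aw j i.
Hypothesis nu_ge0 : forall i j, 0 < aw i j -> 0 <= nu i j.
Hypothesis nu_sym : forall i j, 0 < aw i j -> nu i j = nu j i.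
Hypothesis b_gt0 : forall i j, 0 < aw i j -> 0 < b i j.
Hypothesis b_sym : forall i j, 0 < aw i j -> b i j = b j i.
Hypothesis w_meas : forall i k (l : 'I_(m i)), measurable_fun setT (fun t => w i k t l 0).
Hypothesis d_meas : forall i k, measurable_fun setT (dn i k).
Variable rho : R.
Hypothesis rho_gt2 : 2 < rho.
Hypothesis w_int : forall i k (l : 'I_(m i)), (0 < k)%N ->
  P.-integrable setT (fun t => (w i k t l 0)%:E).
Hypothesis w_mds : forall i k (l : 'I_(m i)) A, (0 < k)%N -> Fwd w dn k.-1 A ->
  (\int[P]_(t in A) (w i k t l 0)%:E = 0)%E.
Variable Z : 'I_N -> nat -> T -> \bar R.
Hypothesis w_mom : forall i k, (0 < k)%N ->
  cond_exp_nonneg P (Fw w k.-1) (fun t => (enorm (w i k t) `^ rho)%:E) (Z i k).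
Hypothesis d_lap : forall i k (B : set R), (0 < k)%N -> measurable B ->
  P (dn i k @^-1` B) = (\int[lebesgue_measure]_(x in B) (lap_density x)%:E)%E.
Hypothesis d_indep : mutually_independent P
  (fun c : ('I_N * nat) + unit =>
     match c with inl (i, k) => Fd dn i k | inr _ => Fw_all w end).

Local Notation J := (('I_N * 'I_N) + {i : 'I_N & 'I_(m i)})%type.
Local Notation G k := (Gwd w dn k).
Local Notation F k := (g_sigma_algebraType (Gwd w dn k)).
Local Notation tc := (tcoord n_gt0).

Definition error (k : nat) (t : T) : 'M[R]_(N, n) :=
  err aw nu b alpha1 gam beta1 H theta theta0 (fun i k => w i k t) (fun i k => dn i k t) k.

Definition innovation (q : J) (k : nat) (t : T) : R :=
  noise aw nu b alpha1 gam beta1 H theta theta0 n_gt0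
    (fun i k => w i k t) (fun i k => dn i k t) q k.

(** The number [x_{i,k+1}] of the algorithm, to which sensor [i] adds its scaled dither at step
    [k+1]. *)
Definition state (k : nat) (i : 'I_N) (t : T) : R := error k t i (tc k.+1) + theta (tc k.+1) 0.

Lemma adapted_le k l (f : T -> R) : (k <= l)%N ->
  measurable_fun [set: F k] f -> measurable_fun [set: F l] f.
Proof.
move=> kl mf _ B mB; have := mf measurableT B mB; rewrite !setTI.
exact: (@Fwd_mono_le _ _ _ _ _ w dn _ _ kl).
Qed.

Lemma innovation_edge i j k t : 0 < aw i j ->
  innovation (inl (i, j)) k t =
  onebit (Cthr nu b j i k.+1) (state k j t + b j i * dn j k.+1 t)
    - Gfun nu b j i k.+1 (state k j t).
Proof.
move=> a0; rewrite /innovation /noise a0; congr (_ - _).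
by rewrite /shat /sbit /onebit (xval_err _ _ _ _ _ _ _ _ _ n_gt0).
Qed.

Lemma innovation_adapted k q :
  measurable_entries (T := F k) (error k) -> measurable_fun [set: F k.+1] (innovation q k).
Proof.
move=> me; case: q => [[i j]|[i q]]; last exact: wcoord_adapted.
case: (boolP (0 < aw i j)) => [a0|/negPf a0]; last first.
  by rewrite /innovation /noise a0.
have ms : measurable_fun [set: F k.+1] (state k j).
  by apply: measurable_funD => //; apply: (@adapted_le k) => //; exact: me.
rewrite (_ : innovation _ k = (fun t => onebit (Cthr nu b j i k.+1)
    (state k j t + b j i * dn j k.+1 t) - Gfun nu b j i k.+1 (state k j t))); last first.
  by apply/funext => t; exact: innovation_edge.
apply: measurable_funB; last exact: Gfun_measurable.
apply: onebit_comp_measurable; apply: measurable_funD => //; apply: measurable_funM => //.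
exact: dn_adapted.
Qed.

Lemma error_adapted k : measurable_entries (T := F k) (error k).
Proof.
elim: k => [i l|k IH].
  rewrite (_ : (fun _ => _) = cst (theta0 i l 0 - theta l 0)); first exact: measurable_cst.
  by apply/funext => t; rewrite mxE.
have IH' : measurable_entries (T := F k.+1) (error k).
  by move=> i l; apply: (@adapted_le k) => //; exact: IH.
rewrite (_ : error k.+1 = fun t => error k t
   + drift aw nu b alpha1 gam beta1 H theta n_gt0 k.+1 (error k t)
   + \sum_q innovation q k t *: gain aw alpha1 gam beta1 H n_gt0 q k.+1); last first.
  by apply/funext => t; exact: err_step.
apply: measurable_entriesD.
  by apply: measurable_entriesD => //; exact: drift_measurable.
move=> i l; rewrite (_ : (fun _ => _) =
  (fun t => \sum_q innovation q k t * gain aw alpha1 gam beta1 H n_gt0 q k.+1 i l)).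
  by apply: measurable_sum => q; apply: measurable_funM => //; exact: innovation_adapted.
by apply/funext => t; rewrite summxE; apply: eq_bigr => q _; rewrite mxE.
Qed.

Lemma state_adapted k i : measurable_fun [set: F k] (state k i).
Proof. by apply: measurable_funD => //; exact: error_adapted. Qed.

Lemma innovation_measurable q k : measurable_fun setT (innovation q k).
Proof.
apply: (gsigma_measurable_fun (Fwd_measurable w_meas d_meas (k := k.+1)) measurableT).
by apply: innovation_adapted; exact: error_adapted.
Qed.

Let G_meas k : <<s G k >> `<=` measurable.
Proof. exact: Fwd_measurable. Qed.

Let PA_fin A : measurable A -> (P A < +oo)%E.
Proof. by move=> mA; apply: (le_lt_trans (probability_le1 P mA)); exact: ltry. Qed.

Let bounded_integrable A (f : T -> R) (K : R) : measurable A -> measurable_fun setT f ->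
  (forall t, `|f t| <= K) -> P.-integrable A (EFin \o f).
Proof.
move=> mA mf fK; apply: (@rintegrable_le _ _ _ P A mA _ (cst K)) => //.
  exact: measurable_funTS.
exact/rintegrable_cst/PA_fin.
Qed.

Variable r : R.
Hypothesis r_range : 1 < r <= 2.
Hypothesis r_rho : 2 * r <= rho.

Definition moment_bounds (eta : T -> R) (A : set T) (v : R) : Prop :=
  [/\ P.-integrable A (EFin \o eta) /\ \int[P]_(t in A) eta t = 0,
      P.-integrable A (EFin \o (fun t => eta t ^+ 2)) /\
      \int[P]_(t in A) (eta t ^+ 2) <= v * fine (P A) &
      P.-integrable A (EFin \o (fun t => (eta t ^+ 2) `^ r)) /\
      \int[P]_(t in A) ((eta t ^+ 2) `^ r) <= v * fine (P A)].

(** Conditional probability, given the past, that [j] sends its bit to [i] at step [k+1]. *)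
Definition trigger (i j : 'I_N) (k : nat) (t : T) : R :=
  lapF ((state k j t - Cthr nu b j i k.+1) / b j i)
  + lapF ((- state k j t - Cthr nu b j i k.+1) / b j i).

Lemma onebit_norm_le1 (C z : R) : `|onebit C z| <= 1.
Proof. by rewrite /onebit; case: ifP => _; [case: ifP => _|]; rewrite ?normrN ?normr1 ?normr0. Qed.

(** The innovation is at most 2 in absolute value, so [(eta^2)^r <= 4 eta^2], while its variance is
    at most [4 v0] by [onebit_var]; together this gives 16. *)
Lemma edge_moments i j k A v0 : <<s G k >> A -> 0 <= v0 ->
  (0 < aw i j -> forall t, A t -> trigger i j k t <= v0) ->
  moment_bounds (innovation (inl (i, j)) k) A (16 * v0).
Proof.
move=> GA v00 tv; have mA := G_meas GA; set eta := innovation _ _.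
have PA0 : 0 <= fine (P A) by rewrite fine_ge0.
have meta : measurable_fun setT eta by exact: innovation_measurable.
case: (boolP (0 < aw i j)) => [a0|/negPf a0]; last first.
  have e0 : eta = fun _ => 0 by apply/funext => t; rewrite /eta /innovation /noise a0.
  have z0 : P.-integrable A (EFin \o (fun _ : T => 0 : R)) by exact/rintegrable_cst/PA_fin.
  have i0 : \int[P]_(t in A) (0 : R) = 0 by rewrite Rintegral_cst// mul0r.
  have rn0 : r != 0 by have /andP[h _] := r_range; rewrite gt_eqF//; lra.
  have e2 : (fun _ : T => (0 : R) ^+ 2) = fun _ => 0 by apply/funext => t; rewrite expr0n.
  have er : (fun _ : T => ((0 : R) ^+ 2) `^ r) = fun _ => 0.
    by apply/funext => t; rewrite expr0n powR0.
  by rewrite /moment_bounds e0 e2 er; split; split => //; rewrite i0 !mulr_ge0.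
have a0' : 0 < aw j i by rewrite aw_sym.
have bp := b_gt0 a0'; have C0 : 0 <= Cthr nu b j i k.+1 by apply: Cthr_ge0 => //; exact: nu_ge0.
have etaE t : eta t = _ := innovation_edge k t a0.
have ind A' B : <<s G k >> A' -> measurable B ->
  P (A' `&` dn j k.+1 @^-1` B) = (P A' * P (dn j k.+1 @^-1` B))%E.
  by move=> GA' mB; exact: dn_indep.
have lap B : measurable B -> P (dn j k.+1 @^-1` B) =
    (\int[lebesgue_measure]_(x in B) (lap_density x)%:E)%E by move=> mB; exact: d_lap.
have mX := @state_adapted k j.
have mean := onebit_mean (G_meas (k := k)) (d_meas j k.+1) ind lap mX GA bp C0.
have var := onebit_var (G_meas (k := k)) (d_meas j k.+1) ind lap mX GA bp C0.
have eta2 t : `|eta t| <= 2.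
  rewrite etaE; apply: (le_trans (ler_normB _ _)).
  have := onebit_norm_le1 (Cthr nu b j i k.+1) (state k j t + b j i * dn j k.+1 t).
  have := Gfun_norm_le1 nu b j i k.+1 (state k j t); lra.
have eta4 t : 0 <= eta t ^+ 2 <= 4.
  rewrite sqr_ge0 /= -real_normK ?num_real//.
  by have := lerXn2r 2 _ _ (eta2 t); rewrite !nnegrE => /(_ _ _) h; apply: le_trans (h _ _) _ => //; lra.
have mX' : measurable_fun setT (state k j).
  exact: (gsigma_measurable_fun (G_meas (k := k)) measurableT).
have itr : P.-integrable A (EFin \o trigger i j k).
  apply: (@bounded_integrable _ _ 2) => //.
    apply: measurable_funD; apply: lapF_comp_measurable; apply: measurable_funM => //.
      exact: measurable_funB.
    by apply: measurable_funB => //; exact: measurableT_comp.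
  move=> t; rewrite ger0_norm ?addr_ge0 ?lapF_ge0//; exact: trigger_prob_le2.
have i1 : P.-integrable A (EFin \o eta) by exact: (bounded_integrable mA meta eta2).
have i2 : P.-integrable A (EFin \o (fun t => eta t ^+ 2)).
  apply: (@bounded_integrable _ _ 4) => //; first exact: measurable_funX.
  by move=> t; rewrite ger0_norm ?sqr_ge0//; case/andP: (eta4 t).
have b2 : \int[P]_(t in A) (eta t ^+ 2) <= 4 * v0 * fine (P A).
  have -> : \int[P]_(t in A) (eta t ^+ 2) = \int[P]_(t in A)
     (onebit (Cthr nu b j i k.+1) (state k j t + b j i * dn j k.+1 t)
    - Gfun nu b j i k.+1 (state k j t)) ^+ 2.
    by apply: eq_Rintegral => t _; rewrite etaE.
  apply: (le_trans var); rewrite -mulrA ler_pM2l//.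
  rewrite -Rintegral_cst//; apply: le_Rintegral => //; first exact/rintegrable_cst/PA_fin.
  by move=> t At; exact: tv.
have rle t : (eta t ^+ 2) `^ r <= 4 * eta t ^+ 2.
  have /andP[x0 x4] := eta4 t; have /andP[r1 r2] := r_range.
  have r10 : 0 <= r - 1 by lra.
  rewrite -(mulr_powRB1 x0) ?(lt_trans _ r1)// mulrC ler_wpM2r//.
  apply: (@le_trans _ _ (4 `^ (r - 1))); first by apply: ge0_ler_powR; rewrite ?nnegrE.
  by rewrite -[leRHS]powRr1//; apply: ler_powR; lra.
have i3 : P.-integrable A (EFin \o (fun t => (eta t ^+ 2) `^ r)).
  apply: (@rintegrable_le _ _ _ P A mA _ (fun t => 4 * eta t ^+ 2)) => //.
  - apply: measurable_funTS; apply: (measurableT_comp (measurable_powR _)).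
    exact: measurable_funX.
  - exact: rintegrableZ.
  - by move=> t _; rewrite ger0_norm ?powR_ge0.
have v0P : 0 <= v0 * fine (P A) by exact: mulr_ge0.
split; split => //.
- rewrite (@eq_Rintegral _ _ _ P A (fun t =>
    onebit (Cthr nu b j i k.+1) (state k j t + b j i * dn j k.+1 t)
    - Gfun nu b j i k.+1 (state k j t))); last by move=> t _; rewrite etaE.
  rewrite RintegralB//; first by rewrite mean subrr.
    apply: (@bounded_integrable _ _ 1) => //; last by move=> t; exact: onebit_norm_le1.
    by apply: onebit_comp_measurable; apply: measurable_funD => //; apply: measurable_funM.
  apply: (@bounded_integrable _ _ 1) => //; last by move=> t; exact: Gfun_norm_le1.
  exact: Gfun_measurable.
- by apply: (le_trans b2); rewrite -!mulrA ler_wpM2r// ler_nat.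
- apply: (@le_trans _ _ (4 * (4 * v0 * fine (P A)))); last by rewrite !mulrA -natrM.
  apply: (@le_trans _ _ (\int[P]_(t in A) (4 * eta t ^+ 2))).
    by apply: le_Rintegral => //; exact: rintegrableZ.
  by rewrite RintegralZl// ler_pM2l.
Qed.

Lemma powR_le_1D (u v q s : R) : 0 <= u <= v -> 0 < q <= s -> u `^ q <= 1 + v `^ s.
Proof.
move=> /andP[u0 uv] /andP[q0 qs]; have v0 := le_trans u0 uv.
have [u1|u1] := leP u 1.
  apply: (@le_trans _ _ 1); last by rewrite lerDl powR_ge0.
  have := @ge0_ler_powR R q (ltW q0) u 1; rewrite !nnegrE powR1.
  by apply.
apply: (@le_trans _ _ (v `^ s)); last by rewrite lerDr.
apply: (@le_trans _ _ (u `^ s)); first by apply: ler_powR => //; exact: ltW.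
by apply: ge0_ler_powR; rewrite ?nnegrE//; apply: ltW; apply: lt_le_trans qs.
Qed.

(** A coordinate [u] is at most the norm of [w], and [|u|^(2s)] is at most 1 plus the [rho]-th power
    of that norm when [2s <= rho]; [s = 1] and [s = r] give both moments with the same bound. *)
Lemma obs_moments i (q : 'I_(m i)) k A (M : R) : <<s G k >> A -> 0 <= M ->
  (forall t, A t -> (Z i k.+1 t <= M%:E)%E) ->
  moment_bounds (innovation (inr (existT _ i q)) k) A (1 + M).
Proof.
move=> GA M0 ZM; have mA := G_meas GA.
have /andP[r1 r2] := r_range; have rho2 := rho_gt2; have rrho := r_rho.
rewrite (_ : innovation _ _ = fun t => w i k.+1 t q 0); last by apply/funext.
set u := fun t => w i k.+1 t q 0; set f := fun t => enorm (w i k.+1 t) `^ rho.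
have mu : measurable_fun setT u by exact: w_meas.
have f0 t : 0 <= f t by exact: powR_ge0.
have uf t : `|u t| <= enorm (w i k.+1 t).
  rewrite -sqrtr_sqr /enorm ler_sqrt; last by apply: sumr_ge0 => l _; exact: sqr_ge0.
  by rewrite (bigD1 q)//= lerDl; apply: sumr_ge0 => l _; exact: sqr_ge0.
have en_meas d' (T' : measurableType d') (g : T' -> 'cV[R]_(m i)) :
    (forall l, measurable_fun setT (fun t => g t l 0)) ->
    measurable_fun setT (fun t => enorm (g t) `^ rho).
  move=> mg; apply: (measurableT_comp (measurable_powR _)).
  rewrite /enorm (_ : (fun _ => _) = fun t => (\sum_l g t l 0 ^+ 2) `^ 2^-1); last first.
    by apply/funext => t; rewrite powR12_sqrt//; apply: sumr_ge0 => l _; exact: sqr_ge0.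
  apply: (measurableT_comp (measurable_powR _)).
  by apply: measurable_sum => l; exact: measurable_funX.
have mf : measurable_fun setT f by apply: en_meas => l; exact: w_meas.
have fall (B : set (\bar R)) : measurable B -> Fw_all w ((EFin \o f) @^-1` B).
  move=> mB; pose Gall : set (set T) := [set A | exists c B, (1 <= c.2)%N /\ measurable B /\
     A = wcoord w c @^-1` B].
  have mfa : measurable_fun [set: g_sigma_algebraType Gall] (EFin \o f).
    apply/measurable_EFinP; apply: en_meas => l _ B' mB'; rewrite setTI.
    by apply: sub_sigma_algebra; exists (existT _ i l, k.+1), B'.
  by have := mfa measurableT _ mB; rewrite setTI.
have fle : (\int[P]_(t in A) (f t)%:E <= M%:E * P A)%E.
  apply: (@cond_moment_bound _ _ _ P _ _ _ _ w_meas d_meas d_indep k.+1 _ (Z i k.+1)) => //.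
  exact: w_mom.
have PAf : (P A)%E \is a fin_num by exact: fin_num_measure.
have fi : P.-integrable A (EFin \o f).
  apply/integrableP; split; first exact/measurable_EFinP/measurable_funTS.
  rewrite (eq_integral (EFin \o f)); last by move=> t _ /=; rewrite ger0_norm.
  by apply: (le_lt_trans fle); rewrite -[P A]fineK// -EFinM ltry.
have c1 : P.-integrable A (EFin \o (fun _ : T => 1 : R)) by exact/rintegrable_cst/PA_fin.
have gi : P.-integrable A (EFin \o (fun t => 1 + f t)) by exact: rintegrableD.
have gb : \int[P]_(t in A) (1 + f t) <= (1 + M) * fine (P A).
  rewrite RintegralD// Rintegral_cst// mulrDl lerD2l.
  rewrite -lee_fin fineK; last exact: integrable_fin_num.
  by apply: (le_trans fle); rewrite EFinM fineK.
have ub (s : R) t : 1 <= s -> 2 * s <= rho -> (u t ^+ 2) `^ s <= 1 + f t.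
  move=> s1 srho; have -> : (u t ^+ 2) `^ s = `|u t| `^ (2 * s).
    by rewrite -real_normK ?num_real// -powR_mulrn// powRrM.
  by apply: powR_le_1D; [rewrite normr_ge0 uf|lra].
have mus (s : R) : measurable_fun A (fun t => (u t ^+ 2) `^ s).
  apply: measurable_funTS; apply: (measurableT_comp (measurable_powR _)).
  exact: measurable_funX.
have ints s : 1 <= s -> 2 * s <= rho -> P.-integrable A (EFin \o (fun t => (u t ^+ 2) `^ s)).
  move=> s1 srho; apply: (@rintegrable_le _ _ _ P A mA _ _ (mus s) gi) => t _.
  by rewrite ger0_norm ?powR_ge0// ub.
have bs s : 1 <= s -> 2 * s <= rho ->
    \int[P]_(t in A) ((u t ^+ 2) `^ s) <= (1 + M) * fine (P A).
  move=> s1 srho; apply: le_trans gb; apply: le_Rintegral => //; first exact: ints.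
  by move=> t _; exact: ub.
have e1 : (fun t => (u t ^+ 2) `^ 1) = fun t => u t ^+ 2.
  by apply/funext => t; rewrite powRr1// sqr_ge0.
have r2' : 2 * 1 <= rho by lra.
have r1' : 1 <= r by lra.
split; split.
- by apply: (@integrableS _ _ _ P setT) => //; exact: w_int.
- by rewrite /Rintegral w_mds// FwdE.
- by have := ints 1 (lexx 1) r2'; rewrite e1.
- by have := bs 1 (lexx 1) r2'; rewrite e1.
- exact: ints.
- exact: bs.
Qed.

End NoiseMoments.

(** * Eventual bounds and finite families *)

Section EventualBounds.
Variable R : realType.

Lemma natpow_small (c u eps : R) : 0 <= c -> 0 < u -> 0 < eps ->
  exists k1, forall k, (k1 <= k)%N -> (0 < k)%N -> c * k%:R `^ (- u) <= eps.
Proof.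
move=> c0 u0 e0; set x := (c / eps) `^ u^-1.
exists (Num.truncn x).+1 => k kx k0; have kp : 0 < k%:R :> R by rewrite ltr0n.
rewrite powRN ler_pdivrMr ?powR_gt0// mulrC -ler_pdivrMr//.
have xk : x <= k%:R.
  apply: ltW; apply: (lt_le_trans (truncnS_gt x)); by rewrite ler_nat.
have ce : 0 <= c / eps by rewrite divr_ge0// ltW.
have -> : c / eps = x `^ u by rewrite /x -powRrM mulVf ?gt_eqF// powRr1.
by apply: ge0_ler_powR; rewrite ?nnegrE ?powR_ge0 ?(ltW u0)// ltW.
Qed.

Lemma eventually_bounded (f : nat -> R) k0 (C : R) : (forall k, (k0 <= k)%N -> f k <= C) ->
  exists C', forall k, f k <= C'.
Proof.
move=> fC; exists (`|C| + \sum_(j < k0) `|f j|) => k.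
have S0 (n : nat) (g : 'I_n -> R) : 0 <= \sum_j `|g j| by apply: sumr_ge0.
have [kk|kk] := leqP k0 k.
  apply: (le_trans (fC k kk)); apply: (le_trans (ler_norm C)); by rewrite lerDl.
rewrite (bigD1 (Ordinal kk))//=; apply: (le_trans (ler_norm _)).
by rewrite addrCA lerDl addr_ge0// sumr_ge0.
Qed.

Lemma sum_bounded_pow_diff (b h : R) : b < 2 * h - 1 -> forall k0, (1 < k0)%N ->
  sum_bounded (fun j => (k0 + j.+1)%:R `^ (b - 2 * h) * 1 : R).
Proof.
move=> bh k0 k01; have s0 : 0 < 2 * h - 1 - b by lra.
apply: sum_bounded_le (sum_bounded_pow (ltnW k01) s0) => j.
by rewrite mulr1 le_eqVlt (_ : b - 2 * h = - (1 + (2 * h - 1 - b))) ?eqxx//; ring.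
Qed.

End EventualBounds.

Section FiniteFamilies.
Variables (R : realType) (I : finType) (Q : pred I).

Lemma fin_lower (f : I -> R) (c C : R) : c < C -> (forall i, Q i -> c < f i) ->
  exists g, c < g <= C /\ forall i, Q i -> g <= f i.
Proof.
move=> cC cf; exists (\big[Num.min/C]_(i | Q i) f i); split.
  by rewrite bigmin_le_id andbT; apply/lt_bigmin.
by move=> i Qi; exact: bigmin_le_cond.
Qed.

Lemma fin_upper (f : I -> R) : exists C, 0 <= C /\ forall i, Q i -> f i <= C.
Proof.
exists (\sum_i `|f i|); split; first by apply: sumr_ge0.
move=> i _; rewrite (bigD1 i)//=; apply: (le_trans (ler_norm _)).
by rewrite lerDl sumr_ge0.
Qed.

Lemma fin_eventually (A : I -> nat -> Prop) :
  (forall i, Q i -> exists k, forall K, (k <= K)%N -> A i K) ->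
  exists k, forall i K, Q i -> (k <= K)%N -> A i K.
Proof.
move=> H; have /choice[f hf] : forall i, exists k, Q i -> forall K, (k <= K)%N -> A i K.
  move=> i; case: (boolP (Q i)) => [/H[k hk]|nQ]; first by exists k.
  by exists 0%N.
exists (\max_(i | Q i) f i)%N => i K Qi kK; apply: hf => //.
by apply: leq_trans kK; exact: leq_bigmax_cond.
Qed.

End FiniteFamilies.

Lemma natpow_shift (R : realType) k (e : R) : (0 < k)%N -> 0 <= e <= 1 ->
  k%:R `^ (- e) <= 2 * k.+1%:R `^ (- e).
Proof.
move=> k0 /andP[e0 e1]; have kp : 0 < k%:R :> R by rewrite ltr0n.
rewrite !powRN -[leLHS]mul1r ler_pdivrMr ?powR_gt0// mulrAC ler_pdivlMr ?powR_gt0 ?ltr0n// mul1r.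
apply: (@le_trans _ _ ((2 * k%:R) `^ e)).
  apply: ge0_ler_powR; rewrite ?nnegrE// -natrM ler_nat.
  by rewrite mul2n -addnn -addn1 leq_add2l.
rewrite powRM//; apply: ler_wpM2r; first exact: powR_ge0.
by apply: ler1_powR => //; rewrite ler1n.
Qed.

(** * Coupling strength and the rate it permits *)

Section CouplingData.
Variables (R : realType) (N n : nat).
Variables (aw nu b alpha1 gam : 'I_N -> 'I_N -> R).
Variables (Hbar delta bmin l1 a m' g0 : R).
Hypothesis n_gt0 : (0 < n)%N.
Hypothesis N_gt1 : (1 < N)%N.
Hypothesis aw_ge0 : forall i j, 0 <= aw i j.
Hypothesis aw_sym : forall i j, aw i j = aw j i.
Hypothesis conn : \rank (laplacian aw) = N.-1.
Hypothesis Hbar_gt0 : 0 < Hbar.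
Hypothesis delta_gt0 : 0 < delta.
Hypothesis bmin_gt0 : 0 < bmin.
Hypothesis b_gt0 : forall i j, 0 < aw i j -> 0 < b i j.
Hypothesis alpha1_gt0 : forall i j, 0 < aw i j -> 0 < alpha1 i j.
Hypothesis nu_gam : forall i j, 0 < aw i j -> nu i j + gam i j <= 1.
Hypothesis g0_gt : 2^-1 < g0.
Local Notation lam2 := (lambda2 (laplacian aw)).
Local Notation rate := (rate n aw Hbar delta bmin).

(* lower bound on the coupling of [i] and [j] when both states are at most [Kc] *)
Definition pair_coupling (i j : 'I_N) (K : nat) (Kc : R) : R :=
  alpha1 i j * expR (- Kc / b i j) / b i j * K%:R `^ (- (gam i j + nu i j)).

Lemma pair_coupling_decr i j K Kc Kc' : 0 < aw i j -> Kc <= Kc' ->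
  pair_coupling i j K Kc' <= pair_coupling i j K Kc.
Proof.
move=> a0 kk; have bp := b_gt0 a0; have ap := alpha1_gt0 a0.
apply: ler_wpM2r; first exact: powR_ge0.
rewrite ler_pM2r ?invr_gt0//; apply: ler_wpM2l; first exact: ltW.
by rewrite ler_expR ler_pM2r ?invr_gt0// lerN2.
Qed.

Let lam2_gt0 : 0 < lam2.
Proof. by have [] := laplacian_spectral_gap aw_ge0 aw_sym N_gt1 conn. Qed.

Let Np : 0 < N%:R :> R. Proof. by rewrite ltr0n ltnW. Qed.

Let q0 : R := 2 * N%:R * n%:R * Hbar ^+ 2 * bmin.
Let q0_gt0 : 0 < q0.
Proof. by have N0 := ltnW N_gt1; rewrite /q0 !mulr_gt0 ?exprn_gt0 ?ltr0n. Qed.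

Lemma rate_gt0 kap : 0 < kap -> 0 < rate kap.
Proof.
move=> k0; rewrite /rate divr_gt0 ?mulr_gt0//.
by rewrite addr_gt0// !mulr_gt0.
Qed.

(** As a function of [kap], [rate] is [A kap/(kap + const)], so it misses its limit [A] by
    [O(1/kap)]. *)
Lemma rate_deficit kap : 0 < kap ->
  delta * bmin / N%:R - (delta * bmin / N%:R * q0 / (N%:R * lam2)) / kap <= rate kap.
Proof.
move=> k0; set A := delta * bmin / N%:R; have A0 : 0 < A by rewrite divr_gt0// mulr_gt0.
have d0 : 0 < q0 + N%:R * lam2 * kap by rewrite addr_gt0// !mulr_gt0.
have -> : rate kap = A - A * q0 / (q0 + N%:R * lam2 * kap).
  rewrite /rate -/q0 /A; field.
  by rewrite !gt_eqF.
rewrite lerD2l lerN2 -[leRHS]mulrA -invfM; apply: ler_wpM2l.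
  by rewrite mulr_ge0 ?ltW.
by rewrite lef_pV2 ?posrE ?mulr_gt0// lerDr ltW.
Qed.

Lemma boundedstate_coupling Kc : exists kap, 0 < kap /\
  forall i j K, 0 < aw i j -> (0 < K)%N -> coupling kap 0 K <= pair_coupling i j K Kc.
Proof.
pose f (q : 'I_N * 'I_N) := alpha1 q.1 q.2 * expR (- Kc / b q.1 q.2) / b q.1 q.2.
have [|[i j] /= a0|kap [/andP[k0 _] hk]] := @fin_lower R _ (fun q : 'I_N * 'I_N => 0 < aw q.1 q.2) f 0 1.
- exact: ltr01.
- by rewrite /f /= divr_gt0 ?b_gt0// mulr_gt0 ?expR_gt0 ?alpha1_gt0.
exists kap; split => // i j K a0 K0; rewrite /coupling /pair_coupling.
apply: ler_pM; [exact: ltW|exact: powR_ge0|exact: (hk (i, j))|].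
by apply: natpow_mono => //; have := nu_gam a0; lra.
Qed.

(** What the sharp pass needs along a path whose errors are at most [M K^(-eps)]: the target rate up
    to [O(K^(-s))] and the coupling of every edge up to [O(K^-(1+s))], so that both defects
    contribute summable terms to the contraction. *)
Definition coupling_data (M eps : R) : Prop :=
  exists (kap e0 s Cer Cdf : R) (k1 : nat), [/\ 0 <= kap, 0 <= e0 <= 4^-1,
    0 < s <= 4^-1 /\ 1 + s <= 2 * g0, 0 <= Cer /\ 0 <= Cdf &
    forall K, (k1 <= K)%N -> (1 < K)%N ->
      a - Cdf * K%:R `^ (- s) <= rate (K%:R * coupling kap e0 K) /\
      forall i j y, 0 < aw i j -> 0 <= y <= M * K%:R `^ (- eps) ->
        coupling kap e0 K - Cer * K%:R `^ (- (1 + s)) <= pair_coupling i j K (l1 + y)].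

(** No edge is critical, so all couplings decay more slowly than [1/K], by a factor [K^e0] with [e0]
    a positive lower bound of the slacks. Then [K * coupling] tends to infinity, and the rate
    reaches [delta * bmin / N] up to [O(K^(-e0))]. *)
Lemma exact_coupling (M eps : R) : 0 <= M -> 0 < eps ->
  (forall i j, 0 < aw i j -> nu i j + gam i j <> 1) -> a = delta * bmin / N%:R ->
  coupling_data M eps.
Proof.
move=> M0 eps0 nE aE; pose Q (q : 'I_N * 'I_N) := 0 < aw q.1 q.2.
pose f (q : 'I_N * 'I_N) := alpha1 q.1 q.2 * expR (- (l1 + M) / b q.1 q.2) / b q.1 q.2.
have [|[i j] /= a0|kap [/andP[k0 _] hk]] := @fin_lower R _ Q f 0 1; first exact: ltr01.
  by rewrite /f /= divr_gt0 ?b_gt0// mulr_gt0 ?expR_gt0 ?alpha1_gt0.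
have [||e0 [/andP[e00 e01] he]] := @fin_lower R _ Q (fun q => 1 - (nu q.1 q.2 + gam q.1 q.2)) 0 4^-1.
- by rewrite invr_gt0.
- move=> [i j] /= a0; rewrite subr_gt0 lt_neqAle nu_gam// andbT; apply/eqP; exact: nE.
pose s := Num.min e0 (2 * g0 - 1); have g0' := g0_gt.
have s0 : 0 < s by rewrite /s lt_min e00 /=; lra.
have se : s <= e0 by rewrite /s ge_min lexx.
have sg : s <= 2 * g0 - 1 by rewrite /s ge_min lexx orbT.
pose A := delta * bmin / N%:R * q0 / (N%:R * lam2).
have A0 : 0 < A by rewrite /A divr_gt0 ?(mulr_gt0 _ q0_gt0) ?divr_gt0 ?mulr_gt0.
exists kap, e0, s, 0, (A / kap), 2%N; split.
- exact: ltW.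
- by rewrite (ltW e00).
- by split; [rewrite s0 (le_trans se)|lra].
- by split => //; rewrite divr_ge0 ?ltW.
move=> K K1 _; have K0 : (0 < K)%N by exact: ltnW.
have Kp : 0 < K%:R :> R by rewrite ltr0n.
split.
  have -> : K%:R * coupling kap e0 K = kap * K%:R `^ e0.
    rewrite /coupling mulrCA -{1}[K%:R]powRr1//.
    by rewrite -natpowD//; congr (_ * _ `^ _); ring.
  have kp : 0 < kap * K%:R `^ e0 by rewrite mulr_gt0 ?powR_gt0.
  rewrite aE; apply: le_trans (rate_deficit kp); rewrite lerD2l lerN2 -/A.
  rewrite [(kap * _)^-1]invfM mulrA -powRN.
  apply: ler_wpM2l; first by rewrite divr_ge0 ?ltW.
  by apply: natpow_mono => //; rewrite lerN2.
move=> i j y a0 /andP[y0 yM]; rewrite mul0r subr0.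
have yM' : y <= M.
  apply: (le_trans yM); rewrite -[leRHS]mulr1; apply: ler_wpM2l => //.
  by apply: natpow_le1 => //; exact: ltW.
apply: (@le_trans _ _ (pair_coupling i j K (l1 + M))); last first.
  by apply: pair_coupling_decr => //; rewrite lerD2l.
apply: ler_pM; [exact: ltW|exact: powR_ge0|exact: (hk (i, j))|].
by apply: natpow_mono => //; have := he (i, j) a0; rewrite /=; lra.
Qed.

(** Noncritical edges eventually couple more strongly than [m'/K]. On a critical edge, a bound
    [l1 + y] instead of [l1] on the states costs the factor [exp(-y/b) >= 1 - y/b], a defect of
    order [K^-(1+eps)]; this is why some polynomial decay of the errors has to be known
    beforehand. *)
Lemma critical_coupling (M eps : R) : 0 <= M -> 0 < eps ->
  (exists i j, [/\ 0 < aw i j, nu i j + gam i j = 1 &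
                     m' = alpha1 i j * expR (- l1 / b i j) / b i j]) ->
  (forall i j, 0 < aw i j -> nu i j + gam i j = 1 ->
                  m' <= alpha1 i j * expR (- l1 / b i j) / b i j) ->
  a = rate m' ->
  coupling_data M eps.
Proof.
move=> M0 eps0 [i0 [j0 [a00 _ m'E]]] m'le aE; pose Q (q : 'I_N * 'I_N) := 0 < aw q.1 q.2.
have m'0 : 0 < m' by rewrite m'E divr_gt0 ?b_gt0// mulr_gt0 ?expR_gt0 ?alpha1_gt0.
have [Cer [Cer0 hC]] := @fin_upper R _ Q (fun q =>
   alpha1 q.1 q.2 * expR (- l1 / b q.1 q.2) / b q.1 q.2 * (M / b q.1 q.2)).
pose Q' (q : 'I_N * 'I_N) := (0 < aw q.1 q.2) && (nu q.1 q.2 + gam q.1 q.2 != 1).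
have [|k1 hk1] := @fin_eventually _ Q' (fun q K => (0 < K)%N ->
    coupling m' 0 K <= pair_coupling q.1 q.2 K (l1 + M)).
  move=> [i j] /andP[/= a0 ne]; set f := alpha1 i j * expR (- (l1 + M) / b i j) / b i j.
  have f0 : 0 < f by rewrite /f divr_gt0 ?b_gt0// mulr_gt0 ?expR_gt0 ?alpha1_gt0.
  have u0 : 0 < 1 - (nu i j + gam i j) by rewrite subr_gt0 lt_neqAle nu_gam// ne.
  have [k1 hk1] := @natpow_small R m' _ f (ltW m'0) u0 f0.
  exists k1 => K kK K0; rewrite /coupling /pair_coupling -/f.
  have -> : - (gam i j + nu i j) = (1 - (nu i j + gam i j)) + (- (1 - 0)) by ring.
  rewrite natpowD// mulrA; apply: ler_wpM2r; first exact: powR_ge0.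
  rewrite -ler_pdivrMr ?powR_gt0 ?ltr0n// -powRN; exact: hk1.
have g0' := g0_gt.
pose s := Num.min (Num.min 4^-1 eps) (2 * g0 - 1).
have s0 : 0 < s by rewrite /s !lt_min eps0 invr_gt0 ltr0n /=; lra.
have s4 : s <= 4^-1 by rewrite /s !ge_min lexx.
have se : s <= eps by rewrite /s !ge_min lexx orbT.
have sg : s <= 2 * g0 - 1 by rewrite /s ge_min lexx orbT.
exists m', 0, s, Cer, 0, k1; split.
- exact: ltW.
- by rewrite lexx invr_ge0 ler0n.
- by split; [rewrite s0 s4|lra].
- by [].
move=> K kK K1; have K0 : (0 < K)%N by exact: ltnW.
have Kp : 0 < K%:R :> R by rewrite ltr0n.
split.
  rewrite mul0r subr0 /coupling subr0 natpow_N1 mulrCA divff ?gt_eqF// mulr1.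
  by rewrite aE.
move=> i j y a0 /andP[y0 yM].
have Ce0 : 0 <= Cer * K%:R `^ (- (1 + s)) by rewrite mulr_ge0 ?powR_ge0.
have bp := b_gt0 a0.
have [e1|ne1] := eqVneq (nu i j + gam i j) 1; last first.
  apply: (@le_trans _ _ (coupling m' 0 K)); first by rewrite lerBlDr lerDl.
  apply: (@le_trans _ _ (pair_coupling i j K (l1 + M))).
    by apply: (hk1 (i, j)) => //; rewrite /Q' /= a0.
  apply: pair_coupling_decr => //; rewrite lerD2l; apply: (le_trans yM).
  rewrite -[leRHS]mulr1; apply: ler_wpM2l => //.
  by apply: natpow_le1 => //; exact: ltW.
rewrite /coupling /pair_coupling subr0 [gam i j + _]addrC e1.
set c := alpha1 i j * expR (- l1 / b i j) / b i j.
have c0 : 0 <= c by rewrite /c divr_ge0 ?(ltW bp)// mulr_ge0 ?expR_ge0// ltW// alpha1_gt0.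
have mc : m' <= c by exact: m'le.
have -> : alpha1 i j * expR (- (l1 + y) / b i j) / b i j = c * expR (- (y / b i j)).
  by rewrite opprD mulrDl expRD mulNr [- y / _]mulNr /c mulNr; ring.
have hexp : 1 - y / b i j <= expR (- (y / b i j)) by exact: expR_ge1Dx.
have h1 : c * (1 - y / b i j) <= c * expR (- (y / b i j)) by exact: ler_wpM2l.
set p1 := K%:R `^ (- 1).
have p10 : 0 <= p1 by exact: powR_ge0.
have yb : c * (y / b i j) * p1 <= Cer * K%:R `^ (- (1 + s)).
  apply: (@le_trans _ _ (c * (M / b i j) * (K%:R `^ (- eps) * p1))).
    have -> : c * (M / b i j) * (K%:R `^ (- eps) * p1) = c * (M * K%:R `^ (- eps) / b i j) * p1.
      by ring.
    apply: ler_wpM2r => //; apply: ler_wpM2l => //.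
    by rewrite ler_pM2r ?invr_gt0.
  apply: ler_pM.
  - by rewrite mulr_ge0// divr_ge0// ltW.
  - by rewrite mulr_ge0 ?powR_ge0.
  - exact: (hC (i, j)).
  - by rewrite /p1 -natpowD//; apply: natpow_mono => //; lra.
have h2 := ler_wpM2r p10 h1; have h3 := ler_wpM2r p10 mc.
rewrite mulrBr mulr1 mulrBl in h2; lra.
Qed.

End CouplingData.

(** * The three passes *)

Section ErrorRates.
Context {R : realType} {d : measure_display} {T : measurableType d}.
Variable P : probability T R.
Variables (N n : nat) (m : 'I_N -> nat).
Variables (aw nu b alpha1 gam : 'I_N -> 'I_N -> R) (beta1 : 'I_N -> R).
Variable H : forall i : 'I_N, nat -> 'M[R]_(m i, n).
Variables (theta : 'cV[R]_n) (theta0 : 'I_N -> 'cV[R]_n).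
Variable w : forall i : 'I_N, nat -> T -> 'cV[R]_(m i).
Variable dn : 'I_N -> nat -> T -> R.
Variables (Hbar delta bmin : R) (p : nat) (rho : R).
Hypothesis n_gt0 : (0 < n)%N.
Hypothesis N_gt1 : (1 < N)%N.
Hypothesis aw_ge0 : forall i j, 0 <= aw i j.
Hypothesis aw_sym : forall i j, aw i j = aw j i.
Hypothesis Hbar_gt0 : 0 < Hbar.
Hypothesis H_bnd : forall i k, (0 < k)%N -> opnorm_le (H i k) Hbar.
Hypothesis p_gt0 : (0 < p)%N.
Hypothesis delta_gt0 : 0 < delta.
Hypothesis PE : forall k, (0 < k)%N ->
     loewner_ge (p%:R^-1 *: \sum_(k <= t < k + p) \sum_(i < N) (H i t)^T *m H i t)
                (delta%:M).
Hypothesis w_meas : forall i k (l : 'I_(m i)), measurable_fun setT (fun t => w i k t l 0).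
Hypothesis d_meas : forall i k, measurable_fun setT (dn i k).
Hypothesis rho_gt2 : 2 < rho.
Hypothesis w_int : forall i k (l : 'I_(m i)), (0 < k)%N ->
  P.-integrable setT (fun t => (w i k t l 0)%:E).
Hypothesis w_mds : forall i k (l : 'I_(m i)) A, (0 < k)%N -> Fwd w dn k.-1 A ->
  (\int[P]_(t in A) (w i k t l 0)%:E = 0)%E.
Variable Z : 'I_N -> nat -> T -> \bar R.
Hypothesis w_mom : forall i k, (0 < k)%N ->
  cond_exp_nonneg P (Fw w k.-1) (fun t => (enorm (w i k t) `^ rho)%:E) (Z i k).
Hypothesis conn : \rank (laplacian aw) = N.-1.
Hypothesis d_lap : forall i k (B : set R), (0 < k)%N -> measurable B ->
  P (dn i k @^-1` B) = (\int[lebesgue_measure]_(x in B) (lap_density x)%:E)%E.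
Hypothesis d_indep : mutually_independent P
  (fun c : ('I_N * nat) + unit =>
     match c with inl (i, k) => Fd dn i k | inr _ => Fw_all w end).
Hypothesis nu_ge0 : forall i j, 0 < aw i j -> 0 <= nu i j.
Hypothesis nu_sym : forall i j, 0 < aw i j -> nu i j = nu j i.
Hypothesis b_gt0 : forall i j, 0 < aw i j -> 0 < b i j.
Hypothesis b_sym : forall i j, 0 < aw i j -> b i j = b j i.
Hypothesis alpha1_gt0 : forall i j, 0 < aw i j -> 0 < alpha1 i j.
Hypothesis alpha1_sym : forall i j, 0 < aw i j -> alpha1 i j = alpha1 j i.
Hypothesis beta1_gt0 : forall i, 0 < beta1 i.
Hypothesis gam_sym : forall i j, 0 < aw i j -> gam i j = gam j i.
Hypothesis bmin_gt0 : 0 < bmin.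
Hypothesis bmin_le : forall i, bmin <= beta1 i.
Variable g0 : R.
Hypothesis g0_range : 0 <= g0 <= 1.
Hypothesis g0_le : forall i j, 0 < aw i j -> g0 <= gam i j.

Local Notation J := (('I_N * 'I_N) + {i : 'I_N & 'I_(m i)})%type.
Local Notation G k := (Gwd w dn k).
Local Notation tc := (tcoord n_gt0).
Local Notation error := (error aw nu b alpha1 gam beta1 H theta theta0 w dn).
Local Notation innovation := (innovation aw nu b alpha1 gam beta1 H theta theta0 w dn n_gt0).
Local Notation state := (state aw nu b alpha1 gam beta1 H theta theta0 w dn n_gt0).
Local Notation trigger := (trigger aw nu b alpha1 gam beta1 H theta theta0 w dn n_gt0).
Local Notation drift := (drift aw nu b alpha1 gam beta1 H theta n_gt0).
Local Notation gain := (gain aw alpha1 gam beta1 H n_gt0).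
Local Notation gain_bound := (gain_bound n aw alpha1 gam beta1 Hbar).

Variable r : R.
Hypothesis r_range : 1 < r <= 2.
Hypothesis r_rho : 2 * r <= rho.
Section OneStage.
(** Decay exponent of the sending probability that a pass may use: 0 in the first two passes, [nu]
    in the last. *)
Variable nup : 'I_N -> 'I_N -> R.
Variables (h a b' : R) (ell : nat -> R) (Lb : R).
Variables (kap e0 s Cer Cdf pb M : R) (k1 : nat).
Hypothesis nup_range : forall i j, 0 < aw i j -> 0 <= nup i j <= 2^-1.
Hypothesis h_le : forall i j, 0 < aw i j -> 2 * h <= 2 * gam i j + nup i j.
Hypothesis h_le1 : h <= 1.
Hypothesis b'_ge0 : 0 <= b'.
Hypothesis b'_le : b' <= 2 * a.
Hypothesis b'_h : b' <= 2 * h - 1.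
Hypothesis ell_decr : forall k, (1 < k)%N -> 0 < ell k /\ ell k.+1 <= ell k.
Hypothesis ell_bnd : forall k, (1 < k)%N -> ell k <= Lb.
Hypothesis kap_ge0 : 0 <= kap.
Hypothesis e0_range : 0 <= e0 <= 4^-1.
Hypothesis s_range : 0 < s <= 4^-1.
Hypothesis s_g0 : 1 + s <= 2 * g0.
Hypothesis Cer_ge0 : 0 <= Cer.
Hypothesis Cdf_ge0 : 0 <= Cdf.
Hypothesis pb_ge0 : 0 <= pb.
Hypothesis M_ge0 : 0 <= M.
Hypothesis rate_le : forall K, (k1 <= K)%N -> (1 < K)%N ->
  a - Cdf * K%:R `^ (- s) <= rate n aw Hbar delta bmin (K%:R * coupling kap e0 K).
Variable B : nat -> set T.
Hypothesis B_adapted : forall k, (k1 <= k)%N -> <<s G k >> (B k).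
Hypothesis B_moment : forall k t i, (k1 <= k)%N -> B k t -> (Z i k.+1 t <= M%:E)%E.
Hypothesis B_trigger : forall k t i j, (k1 <= k)%N -> B k t -> 0 < aw i j ->
  trigger i j k t <= pb * k.+1%:R `^ (- nup i j).
Hypothesis B_coupling : forall k t i j, (k1 <= k)%N -> B k t -> 0 < aw i j ->
  (coupling kap e0 k.+1 - Cer * k.+1%:R `^ (- (1 + s))) *
    (error k t i (tc k.+1) - error k t j (tc k.+1)) ^+ 2 <=
  alpha1 i j / k.+1%:R `^ gam i j * ((error k t i (tc k.+1) - error k t j (tc k.+1)) *
    (Gfun nu b i j k.+1 (state k i t) - Gfun nu b i j k.+1 (state k j t))).
Hypothesis tau_sum :
  (forall k0, (1 < k0)%N ->
     sum_bounded (fun j => (k0 + j.+1)%:R `^ (b' - 2 * h) * ell (k0 + j.+1)%N)) \/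
  (b' < 2 * a /\ forall K, (1 < K)%N ->
     K%:R `^ (b' - 2 * h) * ell K <= 1 / (K%:R * ln K%:R)).

(* [gain_bound q K = cq q * K ^ (- gq q)] and the variance of the innovation [q] is at most
   [dq q * K ^ (- nq q)] *)
Let cq (q : J) : R := match q with
  | inl (i, j) => if 0 < aw i j then (alpha1 i j * aw i j) ^+ 2 else 0
  | inr q' => beta1 (projT1 q') ^+ 2 * (n%:R * Hbar ^+ 2) end.
Let gq (q : J) : R := match q with inl (i, j) => 2 * gam i j | inr _ => 2 end.
Let dq (q : J) : R := match q with inl _ => 16 * pb | inr _ => 1 + M end.
Let nq (q : J) : R := match q with inl (i, j) => nup i j | inr _ => 0 end.
Let vq (q : J) (K : nat) : R := dq q * K%:R `^ (- nq q).

Let gain_boundE q K : gain_bound q K = cq q * K%:R `^ (- gq q).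
Proof. by case: q => [[i j]|q'] //=; case: ifP; rewrite ?mul0r. Qed.

Let cq_ge0 q : 0 <= cq q.
Proof.
case: q => [[i j]|q'] /=; first by case: ifP => // _; rewrite sqr_ge0.
by rewrite mulr_ge0 ?sqr_ge0// mulr_ge0 ?sqr_ge0.
Qed.

Let dq_ge0 q : 0 <= dq q.
Proof. by case: q => [[i j]|q'] /=; rewrite ?mulr_ge0 ?addr_ge0. Qed.

Let vq_ge0 q K : 0 <= vq q K. Proof. by rewrite mulr_ge0 ?powR_ge0. Qed.

Let exponents q : cq q = 0 \/ (2 * h <= gq q + nq q /\ 0 <= nq q <= 2^-1).
Proof.
case: q => [[i j]|q'] /=.
  by case: ifP => a0; [right; split; [exact: h_le|exact: nup_range]|left].
by right; have := h_le1; split; [|apply/andP; split => //]; rewrite ?invr_ge0//; lra.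
Qed.

Let Ctau : R := \sum_q cq q * dq q.
Let Ctau_ge0 : 0 <= Ctau. Proof. by apply: sumr_ge0 => q _; rewrite mulr_ge0. Qed.

Let gain_var K : (0 < K)%N -> \sum_q gain_bound q K * vq q K <= Ctau * K%:R `^ (- (2 * h)).
Proof.
move=> K0; rewrite mulr_suml; apply: ler_sum => q _; rewrite gain_boundE /vq.
have [->|[hq _]] := exponents q; first by rewrite !mul0r.
rewrite mulrACA -natpowD//; apply: ler_wpM2l; first by rewrite mulr_ge0.
by apply: natpow_mono => //; lra.
Qed.

Let Lb_ge0 : 0 <= Lb.
Proof. by have [h1 _] := ell_decr (isT : (1 < 2)%N); apply: ltW; apply: (lt_le_trans h1); exact: ell_bnd. Qed.

Let Csig : R := \sum_q Lb `^ r * (cq q `^ r * dq q).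
Let Csig_ge0 : 0 <= Csig.
Proof. by apply: sumr_ge0 => q _; rewrite !mulr_ge0 ?powR_ge0. Qed.

(** Since [b' <= 2h - 1], the exponent is at most [nq (r - 1) - r], and [nq <= 1/2] brings it below
    [-(1 + (r - 1)/2)], which is summable because [r > 1]. *)
Let gain_moment K : (1 < K)%N ->
  weight b' ell K `^ r * \sum_q gain_bound q K `^ r * vq q K <=
  Csig * K%:R `^ (- (1 + (r - 1) / 2)).
Proof.
move=> K1; have K0 : (0 < K)%N by exact: ltnW.
have [l0 _] := ell_decr K1; have /andP[r1 r2] := r_range.
have r0 : 0 <= r by lra.
rewrite /weight powRM ?powR_ge0 ?(ltW l0)// mulr_sumr mulr_suml; apply: ler_sum => q _.
have [c0|[hq /andP[n0 n1]]] := exponents q.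
  rewrite gain_boundE c0 mul0r powR0; last by rewrite gt_eqF//; lra.
  by rewrite !mul0r !mulr0 mul0r.
rewrite gain_boundE powRM ?powR_ge0// /vq -!powRrM.
have -> : K%:R `^ (b' * r) * ell K `^ r * (cq q `^ r * K%:R `^ (- gq q * r) *
   (dq q * K%:R `^ (- nq q))) = ell K `^ r * (cq q `^ r * dq q) *
   (K%:R `^ (b' * r) * K%:R `^ (- gq q * r) * K%:R `^ (- nq q)) by ring.
rewrite -!natpowD//; apply: ler_pM.
- by rewrite !mulr_ge0 ?powR_ge0.
- exact: powR_ge0.
- apply: ler_wpM2r; first by rewrite mulr_ge0 ?powR_ge0.
  by apply: ge0_ler_powR; rewrite ?nnegrE ?(ltW l0) ?ell_bnd.
- apply: natpow_mono => //; have bh := b'_h.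
  have : (b' - gq q) * r <= (nq q - 1) * r by apply: ler_wpM2r => //; lra.
  nra.
Qed.

(** Time is restarted at some [k0] from which [lyap] is positive semidefinite and comparable with
    [inner], the events [B] are in force and the weights of [weights_exist] apply; earlier times
    only enlarge [C]. *)
Lemma stage_rate : {ae P, forall t, (forall k, (k1 <= k)%N -> B k t) ->
  exists C : R, forall k, (1 < k)%N -> weight b' ell k * inner (error k t) (error k t) <= C}.
Proof.
have /andP[s0 s1] := s_range; have /andP[e00 e01] := e0_range.
have a_ge0 : 0 <= a by have := b'_ge0; have := b'_le; lra.
have [F [F0 driftF]] := drift_bound nu theta n_gt0 aw_ge0 Hbar_gt0 H_bnd b_gt0 alpha1_gt0
  beta1_gt0 g0_range g0_le.
set cb := corr_bound n aw Hbar bmin p kap.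
have cb0 : 0 <= cb by apply: corr_bound_ge0.
have [k2 hk2] : exists k2, forall k, (k2 <= k)%N -> (0 < k)%N ->
    cb * k%:R `^ (- (1 - e0)) <= 4^-1.
  by apply: natpow_small => //; lra.
pose Cc : R := 2 * (2 * Cer * Pbound aw + F ^+ 2 + 4 * cb * F + 4 * cb + 2 * Cdf).
have Cc0 : 0 <= Cc.
  have Pb0 : 0 <= Pbound aw by exact: Pbound_ge0.
  by rewrite mulr_ge0// !addr_ge0 ?mulr_ge0// sqr_ge0.
pose Kn : R := 20 * 16 ^+ #|{: J}|.
have Kn0 : 0 <= Kn by rewrite mulr_ge0// exprn_ge0.
have s1' : 0 < s <= 1 by lra.
pose tau K := Ctau * (K%:R `^ (b' - 2 * h) * ell K).
pose sig K : R := Csig * K%:R `^ (- (1 + (r - 1) / 2)).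
have tau0 K : (1 < K)%N -> 0 <= tau K.
  by move=> K1; have [l0 _] := ell_decr K1; rewrite !mulr_ge0 ?powR_ge0 ?(ltW l0).
have sig0 K : (1 < K)%N -> 0 <= sig K by rewrite mulr_ge0 ?powR_ge0.
have taus : (forall k0, (1 < k0)%N -> sum_bounded (fun j => tau (k0 + j.+1)%N)) \/
   (b' < 2 * a /\ exists2 c, 0 <= c & forall K, (1 < K)%N -> tau K <= c / (K%:R * ln K%:R)).
  have [hs|[ba hs]] := tau_sum; [left|right].
    by move=> k0 k01; apply: sum_boundedZ => //; exact: hs.
  split => //; exists Ctau => // K K1; apply: ler_wpM2l => //.
  by have := hs K K1; rewrite mul1r.
have sigs k0 : (1 < k0)%N -> sum_bounded (fun j => sig (k0 + j.+1)%N).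
  move=> k01; apply: sum_boundedZ => //; apply: sum_bounded_pow; first exact: ltnW.
  by have /andP[r1 _] := r_range; rewrite divr_gt0//; lra.
have [k0 [k10 k01 ctr0 [eps [Me [eps0 epsM wstep]]]]] :=
  weights_exist (maxn k1 k2) r_range b'_ge0 b'_le s1' Cc0 Kn0 ell_decr tau0 sig0 taus sigs.
have k0j j : (0 < k0 + j)%N by rewrite addn_gt0 (ltnW k01).
have k0j1 j : (1 < k0 + j)%N by rewrite ltn_addr.
have k1j j : (k1 <= k0 + j)%N.
  by apply: (@leq_trans k0); [exact: leq_trans (leq_maxl _ _) k10|exact: leq_addr].
have k2j j : cb * (k0 + j)%:R `^ (- (1 - e0)) <= 4^-1.
  apply: hk2 => //.
  by apply: (@leq_trans k0); [exact: leq_trans (leq_maxr _ _) k10|exact: leq_addr].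
pose Q j := lyap aw H n_gt0 bmin p kap e0 (k0 + j).
have psdQ j : psd_form (Q j).
  exact: (lyap_psd n_gt0 aw_ge0 Hbar_gt0 H_bnd p_gt0 bmin_gt0 kap_ge0 e0_range (k0j j) (k2j j)).
pose z j t := error (k0 + j) t + drift (k0 + j).+1 (error (k0 + j) t).
have e_step j t : error (k0 + j.+1) t =
  z j t + \sum_q innovation q (k0 + j) t *: gain q (k0 + j).+1.
  by rewrite addnS; exact: err_step.
have Gm j : <<s G (k0 + j) >> `<=` measurable by exact: Fwd_measurable.
have Gmono j : <<s G (k0 + j) >> `<=` <<s G (k0 + j.+1) >> by rewrite addnS; exact: Fwd_mono.
have me j : measurable_entries (T := g_sigma_algebraType (G (k0 + j))) (error (k0 + j)).
  exact: error_adapted.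
have mz j : measurable_entries (T := g_sigma_algebraType (G (k0 + j))) (z j).
  by apply: measurable_entriesD => //; exact: drift_measurable.
have contract j t : B (k0 + j) t ->
    Q j.+1 (z j t) (z j t) <= contraction a Cc s (k0 + j.+1) * Q j (error (k0 + j) t) (error (k0 + j) t).
  move=> Bt; rewrite /Q addnS.
  apply: (@lyap_contract R N n m aw H n_gt0 N_gt1 aw_ge0 aw_sym Hbar delta bmin p
     Hbar_gt0 H_bnd p_gt0 bmin_gt0 PE conn kap e0 kap_ge0 e0_range a F g0 s Cer Cdf) => //.
  - apply: inner_drift => // i j' a0; exact: B_coupling.
  - exact: driftF.
  - by apply: rate_le => //; rewrite -addnS.
have mom q j A : <<s G (k0 + j) >> A -> A `<=` B (k0 + j) ->
    moment_bounds P r (innovation q (k0 + j)) A (vq q (k0 + j).+1).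
  move=> GA AB; case: q => [[i j']|[i q]].
    rewrite /vq /dq /nq -mulrA; apply: (@edge_moments _ _ _ P) => //.
      by rewrite mulr_ge0// powR_ge0.
    by move=> a0 t /AB Bt; exact: B_trigger.
  rewrite /vq /dq /nq oppr0 powRr0 mulr1.
  by apply: (@obs_moments _ _ _ P _ _ _ _ _ _ _ _ _ _ _ _ _ _ n_gt0 w_meas d_meas rho rho_gt2 w_int w_mds Z) => // t /AB Bt; exact: B_moment.
have om0 j : 0 < weight b' ell (k0 + j).
  by have [l0 _] := ell_decr (k0j1 j); rewrite mulr_gt0// powR_gt0// ltr0n.
have wst j y : 0 <= y ->
  (weight b' ell (k0 + j.+1) * contraction a Cc s (k0 + j.+1) / weight b' ell (k0 + j) * y) `^ r
  + Kn * ((weight b' ell (k0 + j.+1) * contraction a Cc s (k0 + j.+1) / weight b' ell (k0 + j) * y)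
     `^ (r - 1) * (weight b' ell (k0 + j.+1) * \sum_q gain_bound q (k0 + j).+1 * vq q (k0 + j).+1))
  + Kn * (weight b' ell (k0 + j.+1) `^ r * \sum_q gain_bound q (k0 + j).+1 `^ r * vq q (k0 + j).+1) + 1
  <= (1 + eps j) * (y `^ r + 1).
  move=> y0; apply: wstep => //; rewrite -addnS; apply/andP; split.
  - rewrite mulr_ge0 ?(ltW (om0 _))//; apply: sumr_ge0 => q _.
    by rewrite mulr_ge0// gain_boundE mulr_ge0 ?powR_ge0.
  - have [l0 _] := ell_decr (k0j1 j.+1).
    rewrite /tau /weight natpowD// (_ : Ctau * _ = (k0 + j.+1)%:R `^ b' * ell (k0 + j.+1)%N *
      (Ctau * (k0 + j.+1)%:R `^ (- (2 * h)))); last by ring.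
    apply: ler_wpM2l; first by rewrite mulr_ge0 ?powR_ge0 ?(ltW l0).
    exact: gain_var.
  - rewrite mulr_ge0 ?powR_ge0//; apply: sumr_ge0 => q _.
    by rewrite mulr_ge0 ?powR_ge0.
  - exact: gain_moment.
have C1 j : measurable_fun [set: g_sigma_algebraType (G (k0 + j))]
   (fun t => Q j (error (k0 + j) t) (error (k0 + j) t)) by exact: lyap_measurable.
have C2 j : measurable_fun [set: g_sigma_algebraType (G (k0 + j))]
   (fun t => Q j.+1 (z j t) (z j t)) by exact: lyap_measurable.
have C3 j q : measurable_fun [set: g_sigma_algebraType (G (k0 + j))]
   (fun t => Q j.+1 (z j t) (gain q (k0 + j).+1)) by exact: lyap_measurable.
have C4 j : <<s G (k0 + j) >> (B (k0 + j)) by exact: B_adapted.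
have C5 (q : J) j : 0 <= gain_bound q (k0 + j).+1 by rewrite gain_boundE mulr_ge0 ?powR_ge0.
have C6 q j : Q j.+1 (gain q (k0 + j).+1) (gain q (k0 + j).+1) <= gain_bound q (k0 + j).+1.
  apply: (@le_trans _ _ (inner (gain q (k0 + j).+1) (gain q (k0 + j).+1))); last exact: gain_le.
  exact: lyap_le.
apply: (filterS _ (stage_bounded (J := {: J}) Gm Gmono e_step psdQ C1 C2 C3 C4 ctr0 contract
  r_range C5 (fun q j => vq_ge0 q (k0 + j).+1) C6
  (fun q j A g1 g2 => let: And3 x _ _ := mom q j A g1 g2 in x.1)
  (fun q j A g1 g2 => let: And3 x _ _ := mom q j A g1 g2 in x.2)
  (fun q j A g1 g2 => let: And3 _ x _ := mom q j A g1 g2 in x.1)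
  (fun q j A g1 g2 => let: And3 _ x _ := mom q j A g1 g2 in x.2)
  (fun q j A g1 g2 => let: And3 _ _ x := mom q j A g1 g2 in x.1)
  (fun q j A g1 g2 => let: And3 _ _ x := mom q j A g1 g2 in x.2)
  om0 eps0 epsM wst)).
move=> t Ht Bt; have [|C hC] := Ht; first by move=> j; exact: Bt.
have [|C' hC'] := @eventually_bounded R
    (fun k => weight b' ell k * inner (error k t) (error k t)) k0 (2 * C).
  move=> k kk; rewrite -(subnKC kk); move: (k - k0)%N => j.
  have := hC j; rewrite -(ler_pM2l (ltr0n R 2)) => /(le_trans _); apply.
  rewrite mulrCA ler_pM2l//.
  exact: (lyap_ge n_gt0 aw_ge0 Hbar_gt0 H_bnd p_gt0 bmin_gt0 kap_ge0 e0_range).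
by exists C' => k _.
Qed.

End OneStage.

Hypothesis Z_bnd : {ae P, forall t, exists M : R, forall i k, (0 < k)%N -> (Z i k t <= M%:E)%E}.
Hypothesis nu_gam : forall i j, 0 < aw i j -> nu i j + gam i j <= 1.
Hypothesis g0_gt : 2^-1 < g0.

Local Notation l1 := (l1norm theta).
Local Notation sI k t := (Num.sqrt (inner (error k t) (error k t))).
Local Notation pair_coupling := (pair_coupling nu b alpha1 gam).

Lemma exists_nat_ge (x : R) : exists M : nat, x <= M%:R.
Proof. by exists (Num.truncn x).+1; apply: ltW; exact: truncnS_gt. Qed.

Lemma state_le k t i : `|state k i t| <= l1 + sI k t.
Proof.
apply: (le_trans (ler_normD _ _)); rewrite addrC; apply: lerD; last exact: coord_le_sqrt.
rewrite /l1norm (bigD1 (tc k.+1))//= lerDl; exact: sumr_ge0.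
Qed.

(** Monotonicity of [G] with the slope of [Gfun_lower], in both orders of the two states;
    [pair_coupling] is the step size times that slope. *)
Lemma coupling_le k t i j (c Kc : R) : 0 < aw i j ->
  `|state k i t| <= Kc -> `|state k j t| <= Kc -> c <= pair_coupling i j k.+1 Kc ->
  c * (error k t i (tc k.+1) - error k t j (tc k.+1)) ^+ 2 <=
  alpha1 i j / k.+1%:R `^ gam i j * ((error k t i (tc k.+1) - error k t j (tc k.+1)) *
    (Gfun nu b i j k.+1 (state k i t) - Gfun nu b i j k.+1 (state k j t))).
Proof.
move=> a0; have -> : error k t i (tc k.+1) - error k t j (tc k.+1) = state k i t - state k j t.
  by rewrite /state; ring.
move: (state k i t) (state k j t) => x y xK yK cK; have bp := b_gt0 a0.
set B0 := k.+1%:R `^ (- nu i j) * (expR (- Kc / b i j) / b i j).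
have mono : B0 * (x - y) ^+ 2 <= (x - y) * (Gfun nu b i j k.+1 x - Gfun nu b i j k.+1 y).
  have [xy|/ltW xy] := leP y x.
    have h := @Gfun_lower _ _ _ _ _ _ bp (nu_ge0 a0) k.+1 isT Kc x y xy xK yK.
    have -> : B0 * (x - y) ^+ 2 = (B0 * (x - y)) * (x - y) by ring.
    have d0 : 0 <= x - y by rewrite subr_ge0.
    by rewrite [leRHS]mulrC; exact: (ler_wpM2r d0 h).
  have h := @Gfun_lower _ _ _ _ _ _ bp (nu_ge0 a0) k.+1 isT Kc y x xy yK xK.
  have -> : B0 * (x - y) ^+ 2 = (B0 * (y - x)) * (y - x) by ring.
  have d0 : 0 <= y - x by rewrite subr_ge0.
  have := ler_wpM2r d0 h; rewrite -/B0.
  by move: (Gfun _ _ _ _ _ _) (Gfun _ _ _ _ _ _) => u v; lra.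
apply: (@le_trans _ _ (pair_coupling i j k.+1 Kc * (x - y) ^+ 2)).
  by apply: ler_wpM2r => //; exact: sqr_ge0.
have -> : pair_coupling i j k.+1 Kc * (x - y) ^+ 2 =
    alpha1 i j / k.+1%:R `^ gam i j * (B0 * (x - y) ^+ 2).
  by rewrite /pair_coupling opprD natpowD// [_ `^ (- gam i j)]powRN /B0; ring.
apply: ler_wpM2l => //; rewrite divr_ge0 ?powR_ge0// ltW//; exact: alpha1_gt0.
Qed.

(** Adapted cutoffs. They are used with natural numbers [M], so that the exceptional sets of all
    cutoffs form a countable union. *)
Definition moment_event (M : R) (k : nat) : set T :=
  [set t | forall i, (Z i k.+1 t <= M%:E)%E].
Definition error_event (c : R) (k : nat) : set T :=
  [set t | inner (error k t) (error k t) <= c].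

Lemma moment_event_adapted M k : <<s G k >> (moment_event M k).
Proof.
rewrite (_ : moment_event M k =
    \bigcap_(i in [set: 'I_N]) (Z i k.+1 @^-1` `]-oo, M%:E]%classic)).
  apply: (@fin_bigcap_measurable _ (g_sigma_algebraType (G k))); first exact: finite_finset.
  move=> i _; apply: (@Fw_sub_Fwd _ _ _ _ _ w dn k).
  by have [_ [h _]] := w_mom i (ltn0Sn k); apply: h; exact: emeasurable_itv.
by apply/seteqP; split => t /= h i; [move=> _|]; have := h i; rewrite /= in_itv/=; [|apply].
Qed.

Lemma error_event_adapted c k : <<s G k >> (error_event c k).
Proof.
have mi : measurable_fun [set: g_sigma_algebraType (G k)]
    (fun t => inner (error k t) (error k t)).
  by apply: inner_measurable; exact: error_adapted.
have := mi measurableT _ (measurable_itv `]-oo, c]); rewrite setTI.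
by congr (<<s G k >> _); apply/seteqP; split => t /=; rewrite in_itv.
Qed.

Lemma adaptedI k A B : <<s G k >> A -> <<s G k >> B -> <<s G k >> (A `&` B).
Proof. exact: (@measurableI _ (g_sigma_algebraType (G k))). Qed.

Let s0 : R := Num.min 4^-1 (2 * g0 - 1).
Let s0_range : 0 < s0 <= 4^-1.
Proof. by rewrite /s0 lt_min ge_min lexx invr_gt0 ltr0n /= andbT; have := g0_gt; lra. Qed.
Let s0_g0 : 1 + s0 <= 2 * g0.
Proof.
have : s0 <= 2 * g0 - 1 by rewrite /s0 ge_min lexx orbT.
lra.
Qed.

Let trigger_crude k t i j : 0 < aw i j -> trigger i j k t <= 2 * k.+1%:R `^ (- 0).
Proof. by move=> a0; rewrite oppr0 powRr0 mulr1; exact: trigger_prob_le2. Qed.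

Let g0_le1 : g0 <= 1. Proof. by case/andP: g0_range. Qed.

(** With rate, weight exponent and coupling all 0: monotonicity of [G] makes the dissipation merely
    nonnegative, and the crude variance bound [O(K^(-2 g0))] is summable because [g0 > 1/2]. *)
Lemma error_bounded : {ae P, forall t, exists M : nat, forall k, (1 < k)%N -> sI k t <= M%:R}.
Proof.
have st M : {ae P, forall t, (forall k, (0 <= k)%N -> moment_event M%:R k t) ->
    exists C : R, forall k, (1 < k)%N -> weight 0 (fun _ => 1) k *
      inner (error k t) (error k t) <= C}.
  apply: (@stage_rate (fun _ _ => 0) g0 0 0 (fun _ => 1) 1 0 0 s0 0 0 2 M%:R 0) => //.
  - by move=> i j _; rewrite lexx invr_ge0 ler0n.
  - by move=> i j a0; rewrite addr0 ler_pM2l// g0_le.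
  - by have := g0_gt; lra.
  - by rewrite lexx invr_ge0 ler0n.
  - by move=> K _ _; rewrite /coupling !mul0r mulr0 /rate !mulr0 mul0r subr0.
  - by move=> k _; exact: moment_event_adapted.
  - by move=> k t i j _ _; exact: trigger_crude.
  - move=> k t i j _ _ a0; rewrite /coupling !mul0r subr0.
    apply: (@coupling_le k t i j _ (l1 + sI k t)) => //; try exact: state_le.
    by rewrite !mulr_ge0 ?expR_ge0 ?invr_ge0 ?powR_ge0//; apply: ltW; [exact: alpha1_gt0|exact: b_gt0].
  - by left; apply: sum_bounded_pow_diff; have := g0_gt; lra.
have := ae_foralln st; move: Z_bnd; apply: filterS2 => t [M hM] hst.
have [Mn hMn] := exists_nat_ge M.
have [|C hC] := hst Mn.
  move=> k _ i; apply: (le_trans (hM i k.+1 isT)); by rewrite lee_fin.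
have [Cn hCn] := exists_nat_ge (Num.sqrt C); exists Cn => k k1.
apply: le_trans hCn; have := hC k k1; rewrite /weight powRr0 !mul1r; exact: ler_wsqrtr.
Qed.

(** Errors bounded by [M] bound the slope of [G] from below, which gives a coupling [kap/K] and a
    positive rate depending on [M]. One integer serves as constant and, through [1/(M+1)], as
    exponent, so that the events of the last pass are again indexed by integers. *)
Lemma error_polynomial_decay : {ae P, forall t, exists M : nat, forall k, (1 < k)%N ->
  sI k t <= M%:R * k.+1%:R `^ (- M.+1%:R^-1)}.
Proof.
have st M : {ae P, forall t, (forall k, (2 <= k)%N ->
     (moment_event M%:R k `&` error_event (M%:R ^+ 2) k) t) ->
    exists a C : R, 0 < a /\ forall k, (1 < k)%N ->
      k%:R `^ (2 * a) * inner (error k t) (error k t) <= C}.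
  have [kap [kap0 hk]] := boundedstate_coupling b_gt0 alpha1_gt0 nu_gam (l1 + M%:R).
  have rk := rate_gt0 n_gt0 N_gt1 aw_ge0 aw_sym conn Hbar_gt0 delta_gt0 bmin_gt0 kap0.
  set rt := rate n aw Hbar delta bmin kap in rk.
  have g1 : 0 < (2 * g0 - 1) / 4 by have := g0_gt; lra.
  (* The second bound keeps [2a < 2 g0 - 1], so that the noise stays summable under the weight
     [k^(2a)]. *)
  pose a := Num.min rt ((2 * g0 - 1) / 4).
  have a0 : 0 < a by rewrite /a lt_min rk.
  have ar : a <= rt by rewrite /a ge_min lexx.
  have ag : a <= (2 * g0 - 1) / 4 by rewrite /a ge_min lexx orbT.
  suff : {ae P, forall t, (forall k, (2 <= k)%N ->
     (moment_event M%:R k `&` error_event (M%:R ^+ 2) k) t) ->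
     exists C : R, forall k, (1 < k)%N -> weight (2 * a) (fun _ => 1) k *
      inner (error k t) (error k t) <= C}.
    apply: filterS => t hst /hst [C hC]; exists a, C; split => // k k1.
    by have := hC k k1; rewrite /weight mulr1.
  apply: (@stage_rate (fun _ _ => 0) g0 a (2 * a) (fun _ => 1) 1 kap 0 s0 0 0 2 M%:R 2) => //.
  - by move=> i j _; rewrite lexx invr_ge0 ler0n.
  - by move=> i j e; rewrite addr0 ler_pM2l// g0_le.
  - by rewrite mulr_ge0// ltW.
  - by lra.
  - exact: ltW.
  - by rewrite lexx invr_ge0 ler0n.
  - move=> K _ K1; rewrite mul0r subr0 /coupling subr0 natpow_N1 mulrCA divff ?mulr1//.
    by rewrite pnatr_eq0 -lt0n ltnW.
  - by move=> k _; apply: adaptedI; [exact: moment_event_adapted|exact: error_event_adapted].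
  - by move=> k t i _ [h _]; exact: h.
  - by move=> k t i j _ _; exact: trigger_crude.
  - move=> k t i j k2 [_ hB] e; rewrite mul0r subr0.
    have sM : sI k t <= M%:R.
      by have := ler_wsqrtr hB; rewrite sqrtr_sqr ger0_norm.
    apply: (@coupling_le k t i j _ (l1 + M%:R)) => //; last exact: hk.
      by apply: (le_trans (state_le _ _ _)); rewrite lerD2l.
    by apply: (le_trans (state_le _ _ _)); rewrite lerD2l.
  - by left; apply: sum_bounded_pow_diff; lra.
have := ae_foralln st; move: Z_bnd error_bounded; apply: filterS3 => t [M hM] [M' hM'] hst.
have [Mn hMn] := exists_nat_ge M.
have [|a [C [a0 hC]]] := hst (maxn Mn M').
  move=> k k2; split.
    move=> i; apply: (le_trans (hM i k.+1 isT)); rewrite lee_fin; apply: (le_trans hMn).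
    by rewrite ler_nat leq_maxl.
  have sM := hM' k k2; rewrite /error_event /=.
  rewrite -[leLHS]sqr_sqrtr ?inner_ge0// lerXn2r ?nnegrE ?sqrtr_ge0//.
  by apply: (le_trans sM); rewrite ler_nat leq_maxr.
(* The factor 2 pays for passing from [k] to [k+1] in the power, by [natpow_shift]. *)
have [K1 hK1] := exists_nat_ge (2 * Num.sqrt C).
have [K2 hK2] := exists_nat_ge a^-1.
exists (maxn K1 K2) => k k1; set K := maxn K1 K2.
have k0 : (0 < k)%N by exact: ltnW.
have kp : 0 < k%:R :> R by rewrite ltr0n.
have aK : K.+1%:R^-1 <= a.
  rewrite -[leRHS]invrK lef_pV2 ?posrE ?invr_gt0 ?ltr0n//; apply: (le_trans hK2).
  by rewrite ler_nat leqW// leq_maxr.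
have CK : 2 * Num.sqrt C <= K%:R by apply: (le_trans hK1); rewrite ler_nat leq_maxl.
have e1 : sI k t <= Num.sqrt C * k%:R `^ (- a).
  have p0 : 0 < k%:R `^ a by exact: powR_gt0.
  rewrite powRN ler_pdivlMr//; have := ler_wsqrtr (hC k k1).
  rewrite sqrtrM ?powR_ge0// (_ : Num.sqrt (k%:R `^ (2 * a)) = k%:R `^ a); first by rewrite mulrC.
  by rewrite (_ : 2 * a = a + a) ?natpowD// -?expr2 ?sqrtr_sqr ?ger0_norm ?(ltW p0)//; ring.
apply: (le_trans e1); apply: (@le_trans _ _ (Num.sqrt C * (2 * k.+1%:R `^ (- K.+1%:R^-1)))).
  apply: ler_wpM2l; first exact: sqrtr_ge0.
  apply: (@le_trans _ _ (k%:R `^ (- K.+1%:R^-1))).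
    by apply: natpow_mono => //; rewrite lerN2.
  apply: natpow_shift => //; rewrite invr_ge0 ler0n /= invf_le1 ?ltr0n// ler1n//.
rewrite mulrA; apply: ler_wpM2r; first exact: powR_ge0.
by rewrite mulrC.
Qed.

Variables (h a : R).
Hypothesis h_le : forall i j, 0 < aw i j -> h <= nu i j / 2 + gam i j.
Hypothesis h_le1 : h <= 1.
Hypothesis couple : forall M eps, 0 <= M -> 0 < eps ->
  coupling_data n aw nu b alpha1 gam Hbar delta bmin l1 a g0 M eps.

(** With errors at most [M (k+1)^(-1/(M+1))], the limiting slope and the sending probability
    [O(k^(-nu))] become available: [couple] provides the rate [a], and [h] is the exponent of the
    noise input. *)
Lemma error_rate (b' : R) (ell : nat -> R) (Lb : R) :
  0 <= b' -> b' <= 2 * a -> b' <= 2 * h - 1 ->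
  (forall k, (1 < k)%N -> 0 < ell k /\ ell k.+1 <= ell k) ->
  (forall k, (1 < k)%N -> ell k <= Lb) ->
  ((forall k0, (1 < k0)%N ->
     sum_bounded (fun j => (k0 + j.+1)%:R `^ (b' - 2 * h) * ell (k0 + j.+1)%N)) \/
   (b' < 2 * a /\ forall K, (1 < K)%N ->
     K%:R `^ (b' - 2 * h) * ell K <= 1 / (K%:R * ln K%:R))) ->
  {ae P, forall t, exists C : R, forall k, (1 < k)%N ->
    weight b' ell k * inner (error k t) (error k t) <= C}.
Proof.
move=> b0 ba bh elld ellb taus.
have st M : {ae P, forall t, (forall k, (2 <= k)%N ->
     (moment_event M%:R k `&` error_event ((M%:R * k.+1%:R `^ (- M.+1%:R^-1)) ^+ 2) k) t) ->
    exists C : R, forall k, (1 < k)%N ->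
      weight b' ell k * inner (error k t) (error k t) <= C}.
  have eM : 0 < M.+1%:R^-1 :> R by rewrite invr_gt0 ltr0n.
  have [kap [e0 [s [Cer [Cdf [k1 [kap0 e0r [sr sg] [Cer0 Cdf0] hK]]]]]]] :=
    couple (ler0n R M) eM.
  have [pb [pb0 hpb]] := @fin_upper R _ (fun q : 'I_N * 'I_N => 0 < aw q.1 q.2)
    (fun q => expR ((l1 + M%:R) / b q.2 q.1)).
  have sM k t : (2 <= k)%N ->
     error_event ((M%:R * k.+1%:R `^ (- M.+1%:R^-1)) ^+ 2) k t ->
     0 <= sI k t <= M%:R * k.+1%:R `^ (- M.+1%:R^-1).
    move=> k2 hB; rewrite sqrtr_ge0 /=.
    by have := ler_wsqrtr hB; rewrite sqrtr_sqr ger0_norm// mulr_ge0 ?powR_ge0.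
  have sM' k t : (2 <= k)%N ->
     error_event ((M%:R * k.+1%:R `^ (- M.+1%:R^-1)) ^+ 2) k t -> sI k t <= M%:R.
    move=> k2 /(sM k t k2) /andP[_] /le_trans; apply; rewrite -[leRHS]mulr1.
    by apply: ler_wpM2l => //; apply: natpow_le1 => //; exact: ltW.
  have := @stage_rate nu h a b' ell Lb kap e0 s Cer Cdf pb M%:R (maxn k1 2).
  move=> /(_ _ _ h_le1 b0 ba bh elld ellb kap0 e0r sr sg Cer0 Cdf0 pb0 (ler0n R M)).
  move=> hst; apply: (filterS _ (hst _ _ _ (fun k => moment_event M%:R k `&`
     error_event ((M%:R * k.+1%:R `^ (- M.+1%:R^-1)) ^+ 2) k) _ _ _ _ taus)).
  - move=> t Ht Bt; apply: Ht => k kk; apply: Bt.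
    by apply: leq_trans kk; exact: leq_maxr.
  - move=> i j e; rewrite nu_ge0//=; have := nu_gam e; have := g0_le e; have := g0_gt; lra.
  - by move=> i j e; have := h_le e; lra.
  - move=> K kK K1; apply: (hK K _ K1).1; exact: leq_trans (leq_maxl _ _) kK.
  - by move=> k _; apply: adaptedI; [exact: moment_event_adapted|exact: error_event_adapted].
  - by move=> k t i _ [hB _]; exact: hB.
  - move=> k t i j kk [_ hB] e; have k2 : (2 <= k)%N by exact: leq_trans (leq_maxr _ _) kk.
    have e' : 0 < aw j i by rewrite aw_sym.
    have := trigger_prob_le nu (b_gt0 e') (isT : (0 < k.+1)%N) (state k j t).
    move/le_trans; apply; rewrite (nu_sym e) mulrC; apply: ler_wpM2r; first exact: powR_ge0.
    apply: le_trans (hpb (i, j) e); rewrite ler_expR /= ler_pM2r ?invr_gt0 ?b_gt0//.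
    by apply: (le_trans (state_le _ _ _)); rewrite lerD2l; exact: sM'.
  - move=> k t i j kk [_ hB] e; have k2 : (2 <= k)%N by exact: leq_trans (leq_maxr _ _) kk.
    apply: (@coupling_le k t i j _ (l1 + sI k t)) => //; try exact: state_le.
    have kK : (k1 <= k.+1)%N by apply: leqW; exact: leq_trans (leq_maxl _ _) kk.
    by apply: (hK k.+1 kK (leqW k2)).2 => //; exact: sM.
have := ae_foralln st; move: Z_bnd error_polynomial_decay; apply: filterS3 => t [M hM] [M' hM'] hst.
have [Mn hMn] := exists_nat_ge M; set K := maxn Mn M'.
apply: (hst K) => k k2; split.
  move=> i; apply: (le_trans (hM i k.+1 isT)); rewrite lee_fin; apply: (le_trans hMn).
  by rewrite ler_nat leq_maxl.
rewrite /error_event /= -[leLHS]sqr_sqrtr ?inner_ge0// lerXn2r ?nnegrE ?sqrtr_ge0 ?mulr_ge0 ?powR_ge0//.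
apply: (le_trans (hM' k k2)); apply: ler_pM => //.
  by rewrite ler_nat leq_maxr.
apply: natpow_mono => //; rewrite lerN2 lef_pV2 ?posrE ?ltr0n// ler_nat ltnS; exact: leq_maxr.
Qed.

End ErrorRates.

(** * Logarithmic weights and the three rates *)

Section LogWeights.
Variable R : realType.

Lemma ln_weight_decr q k : (1 < k)%N ->
  0 < (ln k%:R ^+ q)^-1 :> R /\ (ln k.+1%:R ^+ q)^-1 <= (ln k%:R ^+ q)^-1 :> R.
Proof.
move=> k1; have l0 := @ln_nat_gt0 R k k1; have l1 := @ln_nat_gt0 R k.+1 (leqW k1).
rewrite invr_gt0 exprn_gt0// lef_pV2 ?posrE ?exprn_gt0//; split => //.
apply: lerXn2r; rewrite ?nnegrE ?(ltW l0) ?(ltW l1)//.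
by rewrite ler_ln ?posrE ?ltr0n ?ler_nat// ltnW.
Qed.

Lemma ln_weight_bnd q k : (1 < k)%N -> (ln k%:R ^+ q)^-1 <= (ln 2 ^+ q)^-1 :> R.
Proof.
move=> k1; have l0 := @ln_nat_gt0 R k k1; have l1 := @ln_nat_gt0 R 2 isT.
rewrite lef_pV2 ?posrE ?exprn_gt0//; apply: lerXn2r; rewrite ?nnegrE ?(ltW l0) ?(ltW l1)//.
by rewrite ler_ln ?posrE ?ltr0n ?ler_nat// ltnW.
Qed.

Lemma natpow_half k (x : R) : (0 < k)%N -> (k%:R `^ (x / 2)) ^+ 2 = k%:R `^ x.
Proof. by move=> k0; rewrite expr2 -natpowD//; congr (_ `^ _); field. Qed.

End LogWeights.

Theorem theorem4p3
  (R : realType) (dsp : measure_display) (T : measurableType dsp)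
  (P : probability T R)
  (N n : nat) (m : 'I_N -> nat)
  (aw : 'I_N -> 'I_N -> R)
  (H : forall i : 'I_N, nat -> 'M[R]_(m i, n))
  (theta : 'cV[R]_n) (theta0 : 'I_N -> 'cV[R]_n)
  (w : forall i : 'I_N, nat -> T -> 'cV[R]_(m i))
  (dn : 'I_N -> nat -> T -> R)
  (nu b alpha1 gam : 'I_N -> 'I_N -> R) (beta1 : 'I_N -> R)
  (Hbar delta : R) (p : nat) (rho : R)
  (h bmin m' a : R)
  (* network *)
  (aw_ge0 : forall i j, 0 <= aw i j)
  (aw_sym : forall i j, aw i j = aw j i)
  (aw_noloop : forall i, aw i i = 0)
  (* (A1) *)
  (Hbar_gt0 : 0 < Hbar)
  (H_bnd : forall i k, (0 < k)%N -> opnorm_le (H i k) Hbar)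
  (p_gt0 : (0 < p)%N) (delta_gt0 : 0 < delta)
  (PE : forall k, (0 < k)%N ->
     loewner_ge (p%:R^-1 *: \sum_(k <= t < k + p) \sum_(i < N) (H i t)^T *m H i t)
                (delta%:M))
  (* the noises are random variables *)
  (w_meas : forall i k (l : 'I_(m i)), measurable_fun setT (fun t => w i k t l 0))
  (d_meas : forall i k, measurable_fun setT (dn i k))
  (* (A2) *)
  (rho_gt2 : 2 < rho)
  (w_int : forall i k (l : 'I_(m i)), (0 < k)%N ->
     P.-integrable setT (fun t => (w i k t l 0)%:E))
  (w_mds : forall i k (l : 'I_(m i)) A, (0 < k)%N -> Fwd w dn k.-1 A ->
     (\int[P]_(t in A) (w i k t l 0)%:E = 0)%E)
  (w_mom : exists Z : 'I_N -> nat -> T -> \bar R,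
     (forall i k, (0 < k)%N ->
        cond_exp_nonneg P (Fw w k.-1) (fun t => (enorm (w i k t) `^ rho)%:E) (Z i k)) /\
     {ae P, forall t, exists M : R, forall i k, (0 < k)%N -> (Z i k t <= M%:E)%E})
  (* (A3) *)
  (conn : \rank (laplacian aw) = N.-1)
  (* (A4) *)
  (d_lap : forall i k (B : set R), (0 < k)%N -> measurable B ->
     P (dn i k @^-1` B) = (\int[lebesgue_measure]_(x in B) (lap_density x)%:E)%E)
  (d_indep : mutually_independent P
     (fun c : ('I_N * nat) + unit =>
        match c with inl (i, k) => Fd dn i k | inr _ => Fw_all w end))
  (* algorithm parameters *)
  (nu_ge0 : forall i j, 0 < aw i j -> 0 <= nu i j)
  (nu_sym : forall i j, 0 < aw i j -> nu i j = nu j i)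
  (b_gt0 : forall i j, 0 < aw i j -> 0 < b i j)
  (b_sym : forall i j, 0 < aw i j -> b i j = b j i)
  (* (i) *)
  (alpha1_gt0 : forall i j, 0 < aw i j -> 0 < alpha1 i j)
  (alpha1_sym : forall i j, 0 < aw i j -> alpha1 i j = alpha1 j i)
  (beta1_gt0 : forall i, 0 < beta1 i)
  (* (ii) *)
  (gam_range : forall i j, 0 < aw i j -> 1 / 2 < gam i j <= 1)
  (gam_sym : forall i j, 0 < aw i j -> gam i j = gam j i)
  (nu_gam : forall i j, 0 < aw i j -> nu i j + gam i j <= 1)
  (* the constants h, underline beta, m', a *)
  (h_def : (exists i j, 0 < aw i j /\ h = nu i j / 2 + gam i j) /\
           (forall i j, 0 < aw i j -> h <= nu i j / 2 + gam i j))
  (bmin_def : (exists i, bmin = beta1 i) /\ (forall i, bmin <= beta1 i))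
  (m'_def : (exists i j, 0 < aw i j /\ nu i j + gam i j = 1) ->
     (exists i j, [/\ 0 < aw i j, nu i j + gam i j = 1 &
                     m' = alpha1 i j * expR (- l1norm theta / b i j) / b i j]) /\
     (forall i j, 0 < aw i j -> nu i j + gam i j = 1 ->
                  m' <= alpha1 i j * expR (- l1norm theta / b i j) / b i j))
  (a_def1 : (forall i j, 0 < aw i j -> nu i j + gam i j <> 1) ->
     a = delta * bmin / N%:R)
  (a_def2 : (exists i j, 0 < aw i j /\ nu i j + gam i j = 1) ->
     a = delta * lambda2 (laplacian aw) * bmin * m' /
         (2 * N%:R * n%:R * Hbar ^+ 2 * bmin + N%:R * lambda2 (laplacian aw) * m'))
  : forall i : 'I_N,
    {ae P, forall t,
      let err k := SC_est aw nu b
                     (fun i j k => alpha1 i j / (k%:R `^ gam i j))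
                     (fun i k => beta1 i / k%:R)
                     H theta theta0 (fun i k => w i k t) (fun i k => dn i k t) k i
                   - theta in
      [/\ 1 < 2 * h - 2 * a ->
            exists C : R, forall k, (2 <= k)%N -> enorm (err k) <= C * k%:R `^ (- a),
          2 * h - 2 * a = 1 ->
            exists C : R, forall k, (2 <= k)%N ->
              enorm (err k) <= C * (ln k%:R / k%:R `^ (h - 1 / 2)) &
          2 * h - 2 * a < 1 ->
            exists C : R, forall k, (2 <= k)%N ->
              enorm (err k) <= C * (Num.sqrt (ln k%:R) / k%:R `^ (h - 1 / 2))]}.
Proof.
(* For [n = 0] every norm is an empty sum; otherwise [tcoord] is defined. *)
move=> i; case: (posnP n) => [n0|n_gt0].
  have e0 (v : 'cV[R]_n) : enorm v = 0.
    by rewrite /enorm big1 ?sqrtr0// => -[l hl]; exfalso; rewrite n0 in hl.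
  by apply: aeW => t; split => _; exists 0 => k _; rewrite e0 mul0r.
have [[i0 [j0 [a00 hE]]] h_le] := h_def; have [[i1 bE] bmin_le] := bmin_def.
(* The minimum [h] is attained on an edge, and an edge joins two distinct sensors. *)
have N_gt1 : (1 < N)%N.
  rewrite ltnNge; apply/negP => N1; move: a00.
  suff -> : i0 = j0 by rewrite aw_noloop ltxx.
  apply: val_inj => /=; have := leq_trans (ltn_ord i0) N1; have := leq_trans (ltn_ord j0) N1.
  by rewrite !ltnS !leqn0 => /eqP -> /eqP ->.
have bmin_gt0 : 0 < bmin by rewrite bE.
(* A common exponent strictly above 1/2 for all step sizes; the strictness leaves room for some
   [s > 0] with [1 + s <= 2 g0]. *)
have [||g0 [/andP[g0h g01] g0_le']] := @fin_lower R _ (fun q : 'I_N * 'I_N => 0 < aw q.1 q.2)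
    (fun q => gam q.1 q.2) 2^-1 1.
- by rewrite invf_lt1 ?ltr1n ?ltr0n.
- by move=> [i' j'] /= /gam_range; rewrite div1r => /andP[].
have g0_le i' j' (e : 0 < aw i' j') : g0 <= gam i' j' by exact: (g0_le' (i', j')).
have g0_range : 0 <= g0 <= 1 by rewrite g01 andbT; lra.
pose r := Num.min 2 (rho / 2).
have r_range : 1 < r <= 2.
  by rewrite /r lt_min ge_min lexx ltr1n /= andbT; lra.
have r_rho : 2 * r <= rho.
  have : r <= rho / 2 by rewrite /r ge_min lexx orbT.
  lra.
have [Z [w_mom' Z_bnd]] := w_mom.
have h_le1 : h <= 1 by have := h_le _ _ a00; have := nu_gam _ _ a00; have := nu_ge0 _ _ a00; lra.
have h_gt : 2^-1 < h.
  by have := nu_ge0 _ _ a00; have := g0_le _ _ a00; rewrite hE; lra.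
have [a_ge0 couple] : 0 <= a /\ forall M eps, 0 <= M -> 0 < eps ->
    coupling_data n aw nu b alpha1 gam Hbar delta bmin (l1norm theta) a g0 M eps.
  case: (pselect (exists i j, 0 < aw i j /\ nu i j + gam i j = 1)) => [Ene|Ee].
    have [mex mle] := m'_def Ene; have aE := a_def2 Ene.
    have m'0 : 0 < m'.
      have [i' [j' [e _ ->]]] := mex.
      by rewrite divr_gt0 ?b_gt0// mulr_gt0 ?expR_gt0 ?alpha1_gt0.
    split; last by move=> M eps M0 eps0; exact: (critical_coupling b_gt0 alpha1_gt0 nu_gam g0h M0 eps0 mex mle aE).
    rewrite aE; apply: ltW.
    exact: (rate_gt0 n_gt0 N_gt1 aw_ge0 aw_sym conn Hbar_gt0 delta_gt0 bmin_gt0 m'0).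
  have nE i' j' : 0 < aw i' j' -> nu i' j' + gam i' j' <> 1.
    by move=> e e1; apply: Ee; exists i', j'.
  have aE := a_def1 nE; split; last first.
    move=> M eps M0 eps0; exact: (exact_coupling (l1norm theta) n_gt0 N_gt1 aw_ge0 aw_sym conn
      Hbar_gt0 delta_gt0 bmin_gt0 b_gt0 alpha1_gt0 nu_gam g0h M0 eps0 nE aE).
  by rewrite aE divr_ge0// mulr_ge0 ?ltW.
pose err t k : 'M[R]_(N, n) := error aw nu b alpha1 gam beta1 H theta theta0 w dn k t.
have err_rate (b' : R) ell Lb := @error_rate R _ T P N n m aw nu b alpha1 gam beta1 H theta theta0
  w dn Hbar delta bmin p rho n_gt0 N_gt1 aw_ge0 aw_sym Hbar_gt0 H_bnd p_gt0 delta_gt0 PE w_meas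
  d_meas rho_gt2 w_int w_mds Z w_mom' conn d_lap d_indep nu_ge0 nu_sym b_gt0 b_sym alpha1_gt0
  alpha1_sym beta1_gt0 gam_sym bmin_gt0 bmin_le g0 g0_range g0_le r r_range r_rho Z_bnd nu_gam
  g0h h a h_le h_le1 couple b' ell Lb.
(* [v] is the inverse square root of the weight: a bound on the weighted sum of squared errors over
   all sensors becomes one on the norm at sensor [i]. *)
have convert (b' : R) ell (v : nat -> R) t :
    (forall k, (1 < k)%N -> 0 <= v k /\ weight b' ell k * v k ^+ 2 = 1) ->
    (exists C : R, forall k, (1 < k)%N -> weight b' ell k * inner (err t k) (err t k) <= C) ->
    exists C : R, forall k, (2 <= k)%N -> enorm (SC_est aw nu b
                     (fun i j k => alpha1 i j / (k%:R `^ gam i j))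
                     (fun i k => beta1 i / k%:R)
                     H theta theta0 (fun i k => w i k t) (fun i k => dn i k t) k i
                   - theta) <= C * v k.
  move=> hv [C hC]; exists (Num.sqrt C) => k k2; have [v0 Wv] := hv k k2.
  apply: (@le_trans _ _ (Num.sqrt (inner (err t k) (err t k)))).
    apply: ler_wsqrtr; rewrite innerE (bigD1 i)//=.
    under eq_bigr do rewrite mxE [in X in _ + X]mxE.
    under [X in X + _]eq_bigr do rewrite mxE.
    by rewrite lerDl; do 2 (apply: sumr_ge0 => ? _); exact: sqr_ge0.
  have -> : inner (err t k) (err t k) =
      v k ^+ 2 * (weight b' ell k * inner (err t k) (err t k)).
    by rewrite mulrA [v k ^+ 2 * _]mulrC Wv mul1r.
  rewrite sqrtrM ?sqr_ge0// sqrtr_sqr ger0_norm// mulrC; apply: ler_wpM2r => //.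
  exact: ler_wsqrtr (hC k k2).
have vln (x : R) k : (1 < k)%N -> (x / k%:R `^ (h - 1 / 2)) ^+ 2 = x ^+ 2 / k%:R `^ (2 * h - 1).
  move=> k1; rewrite exprMn exprVn; congr (_ * _^-1).
  by rewrite -(natpow_half (2 * h - 1) (ltnW k1)); congr ((_ `^ _) ^+ _); field.
have kpow k (x : R) : (1 < k)%N -> 0 < k%:R `^ x by move=> k1; rewrite powR_gt0// ltr0n ltnW.
case: (ltgtP 1 (2 * h - 2 * a)) => c.
- have ae1 := err_rate (2 * a) (fun _ => 1) 1.
  apply: (filterS _ (ae1 _ _ _ _ _ _)); rewrite ?mulr_ge0 ?lexx//; try lra; last first.
    by left; apply: sum_bounded_pow_diff; lra.
  move=> t ht; split; try (by move=> c'; exfalso; lra).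
  move=> _; apply: (convert (2 * a) (fun _ => 1) (fun k => k%:R `^ (- a))) => // k k1.
  split; first exact: powR_ge0.
  rewrite /weight mulr1 powRN exprVn -(natpow_half (2 * a) (ltnW k1)).
  rewrite (_ : 2 * a / 2 = a); last by field.
  by rewrite divff// expf_neq0// gt_eqF// kpow.
- have ae3 := err_rate (2 * h - 1) (fun k => (ln k%:R ^+ 1)^-1) (ln 2 ^+ 1)^-1.
  apply: (filterS _ (ae3 _ _ _ _ _ _)); try lra; last first.
  (* The input [1/(K ln K)] is not summable; the strict inequality [2h - 1 < 2a] provides a surplus
     of contraction instead. *)
  + right; split; first by lra.
    move=> K K1; rewrite (_ : 2 * h - 1 - 2 * h = - 1); last by ring.
    by rewrite natpow_N1 expr1 invfM mul1r.
  + by move=> k k1; exact: ln_weight_bnd.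
  + by move=> k k1; exact: ln_weight_decr.
  move=> t ht; split; try (by move=> c'; exfalso; lra).
  move=> _; apply: (convert _ _ (fun k => Num.sqrt (ln k%:R) / k%:R `^ (h - 1 / 2)) _ _ ht) => k k1.
  have l0 := @ln_nat_gt0 R k k1; split; first by rewrite divr_ge0 ?sqrtr_ge0 ?powR_ge0.
  rewrite vln// sqr_sqrtr ?(ltW l0)// /weight expr1.
  by field; rewrite !gt_eqF// kpow.
- have ae2 := err_rate (2 * h - 1) (fun k => (ln k%:R ^+ 2)^-1) (ln 2 ^+ 2)^-1.
  apply: (filterS _ (ae2 _ _ _ _ _ _)); try lra; last first.
  (* Here [2h - 1 = 2a] leaves no surplus, so the weight carries [(ln k)^-2], which makes the input
     [1/(K (ln K)^2)] summable. *)
  + left => k0 k01; apply: sum_bounded_le (sum_bounded_ln k01 (ltr1n R 2)) => j.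
    rewrite (_ : 2 * h - 1 - 2 * h = - 1); last by ring.
    rewrite natpow_N1 powRN powR_mulrn ?lexx//.
    by apply: ltW; apply: ln_nat_gt0; rewrite addnS ltnS ltn_addr// ltnW.
  + by move=> k k1; exact: ln_weight_bnd.
  + by move=> k k1; exact: ln_weight_decr.
  move=> t ht; split; try (by move=> c'; exfalso; lra).
  move=> _; apply: (convert _ _ (fun k => ln k%:R / k%:R `^ (h - 1 / 2)) _ _ ht) => k k1.
  have l0 := @ln_nat_gt0 R k k1; split; first by rewrite divr_ge0 ?powR_ge0 ?(ltW l0).
  rewrite vln// /weight.
  by field; rewrite !gt_eqF// kpow.
Qed.
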